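(* Let $X\subset\mathbb{P}^{N}$ be an irreducible non-degenerate complex projective variety of dimension $n\geq 1$ (not assumed smooth), set theoretically defined by homogeneous polynomials $G_{i}\in\mathbb{C}[x_0,\ldots,x_N]$ of degree $d_{i}$, for $i = 1,\ldots,m$. If $$\sum_{i=1}^{m}d_{i}\leq \frac{N+m}{2},$$ then $X$ is connected by singular conics. Moreover, assume that $X$ is smooth, that $G_1,\ldots,G_m$ define $X$ scheme theoretically, and that they are in decreasing order of degrees, $d_1\geq d_2\geq\cdots\geq d_m$. Let $c=N-n$ be the codimension of $X$. If $$\sum_{i=1}^{c}d_{i}\leq \frac{N+c}{2},$$ then $X$ is conic-connected by smooth conics also (that is, it is connected by singular conics and also by smooth conics).
   Context: We work over $\mathbb{C}$. $X\subset\mathbb{P}^N$ is a proper closed subvariety; non-degenerate means not contained in a hyperplane. $X$ is set theoretically defined by $G_1,\ldots,G_m$ if $X$ is the common zero locus of the $G_i$ as a set; it is scheme theoretically defined by them if the closed subscheme of $\mathbb{P}^N$ cut out by $G_1,\ldots,G_m$ is $X$ with its reduced structure. A conic is a plane curve of degree $2$; a singular conic is a union of two (possibly coincident) lines meeting each other. $X$ is connected by singular conics (respectively, conic-connected by smooth conics) if for general points $x,y\in X$ there is a singular (respectively, smooth) conic contained in $X$ and passing through $x$ and $y$. ''General points $x,y\in X$'' means: for all $(x,y)$ in some non-empty Zariski open subset of $X\times X$. *)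

(* Defs.v *)
From HB Require Import structures.
From mathcomp Require Import all_boot all_order all_algebra.
From mathcomp Require Import boolp classical_sets reals.
From mathcomp Require Import mpoly.
From mathcomp Require Export complex.

Set Implicit Arguments.
Unset Strict Implicit.
Unset Printing Implicit Defensive.

Import GRing.Theory.
Local Open Scope ring_scope.
Local Open Scope classical_set_scope.

(* The points of P^N are the lines through the origin of K^(N+1), so that
   equality of points is Leibniz equality. *)
Record proj_space (K : closedFieldType) (N : nat) : Type := ProjPoint {
  proj_line :> {vspace 'rV[K]_N.+1};
  _ : \dim proj_line == 1%N
}.

HB.instance Definition _ (K : closedFieldType) (N : nat) :=
  [isSub for @proj_line K N].
HB.instance Definition _ (K : closedFieldType) (N : nat) :=
  [Choice of proj_space K N by <:].

Section ProjectiveGeometry.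
Variables (K : closedFieldType) (N : nat).
Local Notation PN := (proj_space K N).
Local Notation poly := {mpoly K[N.+1]}.

Definition vanishes_at (f : poly) (p : PN) : Prop :=
  forall u : 'rV[K]_N.+1, u \in (p : {vspace _}) -> f.@[u 0] = 0.

Definition zero_locus (S : set poly) : set PN :=
  [set p : PN | forall f, S f -> vanishes_at f p].

Definition zariski_closed (Z : set PN) : Prop :=
  exists2 S : set poly,
    (forall f, S f -> exists e : nat, f \is e.-homog) & Z = zero_locus S.

Definition irreducible_set (Z : set PN) : Prop :=
  Z !=set0 /\
  forall Z1 Z2 : set PN, zariski_closed Z1 -> zariski_closed Z2 ->
    Z `<=` Z1 `|` Z2 -> Z `<=` Z1 \/ Z `<=` Z2.

Definition irreducible_variety (Z : set PN) : Prop :=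
  zariski_closed Z /\ irreducible_set Z.

Definition irreducible_chain (X : set PN) (k : nat) (Z : nat -> set PN) : Prop :=
  (forall i : nat, (i <= k)%N -> irreducible_variety (Z i) /\ Z i `<=` X) /\
  (forall i : nat, (i < k)%N -> Z i `<` Z i.+1).

Definition has_dimension (X : set PN) (n : nat) : Prop :=
  (exists Z, irreducible_chain X n Z) /\
  (forall k Z, irreducible_chain X k Z -> (k <= n)%N).

Definition linear_subspace (L : {vspace 'rV[K]_N.+1}) : set PN :=
  [set p : PN | (p <= L)%VS].

Definition nondegenerate_variety (X : set PN) : Prop :=
  forall H : {vspace 'rV[K]_N.+1}, \dim H = N -> ~ (X `<=` linear_subspace H).

(* The homogeneous ideal I(X): vanishing on every line of the cone over X
   amounts to the vanishing on X of all homogeneous components. *)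
Definition vanishing_ideal (X : set PN) : set poly :=
  [set f | forall p, X p -> vanishes_at f p].

(* v lies in the affine cone over the embedded projective tangent space at p *)
Definition tangent_at (X : set PN) (p : PN) (v : 'rV[K]_N.+1) : Prop :=
  forall f, vanishing_ideal X f ->
  forall u : 'rV[K]_N.+1, u \in (p : {vspace _}) -> u != 0 ->
    \sum_(i < N.+1) (f^`M(i)).@[u 0] * v 0 i = 0.

(* smoothness of X, which is meant to be irreducible of dimension n *)
Definition smooth_of_dimension (X : set PN) (n : nat) : Prop :=
  forall p, X p -> exists2 T : {vspace 'rV[K]_N.+1},
    \dim T = n.+1 & forall v, v \in T <-> tangent_at X p v.

Definition set_theoretically_defined (m : nat) (G : 'I_m -> poly)
    (X : set PN) : Prop :=
  X = zero_locus (range G).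

(* Equality of two closed subschemes of P^N is tested on the standard charts
   U_j = {x_j <> 0} = Spec K[x_0, .., x_N]/(x_j - 1). There the subscheme cut
   out by the G_i has the ideal generated by the G_i (modulo x_j - 1), and the
   reduced structure on X has the ideal of all functions vanishing on X. *)
Definition scheme_theoretically_defined (m : nat) (G : 'I_m -> poly)
    (X : set PN) : Prop :=
  forall (j : 'I_N.+1) (f : poly),
    (exists (h : 'I_m -> poly) (g : poly),
       f = \sum_(i < m) h i * G i + g * ('X_j - 1))
    <->
    (forall p, X p -> forall u : 'rV[K]_N.+1,
       u \in (p : {vspace _}) -> u 0 j = 1 -> f.@[u 0] = 0).

(* polynomials in x_0, .., x_N, y_0, .., y_N *)
Definition bihomogeneous (F : {mpoly K[N.+1 + N.+1]}) : Prop :=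
  exists a b : nat, forall mon : 'X_{1..N.+1 + N.+1}, mon \in msupp F ->
    (\sum_(i < N.+1) mon (lshift N.+1 i))%N = a /\
    (\sum_(i < N.+1) mon (rshift N.+1 i))%N = b.

Definition vanishes_at2 (F : {mpoly K[N.+1 + N.+1]}) (x y : PN) : Prop :=
  forall u v : 'rV[K]_N.+1, u \in (x : {vspace _}) -> v \in (y : {vspace _}) ->
    F.@[row_mx u v 0] = 0.

(* The Zariski topology of P^N x P^N (not the product topology) *)
Definition zariski_open2 (U : set (PN * PN)) : Prop :=
  exists2 S : set {mpoly K[N.+1 + N.+1]},
    (forall F, S F -> bihomogeneous F) &
    U = [set xy : PN * PN | ~ (forall F, S F -> vanishes_at2 F xy.1 xy.2)].

Definition for_general_pair (X : set PN) (P : PN -> PN -> Prop) : Prop :=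
  exists U : set (PN * PN),
    [/\ zariski_open2 U, (X `*` X) `&` U !=set0 &
        forall x y, X x -> X y -> U (x, y) -> P x y].

(* the union of two lines, possibly coincident, that meet *)
Definition singular_conic (C : set PN) : Prop :=
  exists L1 L2 : {vspace 'rV[K]_N.+1},
    [/\ \dim L1 = 2%N, \dim L2 = 2%N,
        linear_subspace L1 `&` linear_subspace L2 !=set0 &
        C = linear_subspace L1 `|` linear_subspace L2].

(* The image, under the linear embedding P^2 -> P^N of matrix A, of the plane
   curve q = 0 *)
Definition plane_curve (A : 'M[K]_(3, N.+1)) (q : {mpoly K[3]}) : set PN :=
  [set p : PN | exists2 u : 'rV[K]_3,
     q.@[u 0] = 0 & (p : {vspace _}) = <[u *m A]>%VS].

Definition smooth_plane_curve (q : {mpoly K[3]}) : Prop :=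
  forall u : 'rV[K]_3, u != 0 -> q.@[u 0] = 0 ->
    exists i : 'I_3, (q^`M(i)).@[u 0] != 0.

Definition smooth_conic (C : set PN) : Prop :=
  exists (A : 'M[K]_(3, N.+1)) (q : {mpoly K[3]}),
    [/\ row_free A, q != 0, q \is 2.-homog, smooth_plane_curve q &
        C = plane_curve A q].

Definition connected_by (conic : set PN -> Prop) (X : set PN) : Prop :=
  for_general_pair X (fun x y =>
    exists C : set PN, [/\ conic C, C `<=` X, C x & C y]).

Definition connected_by_singular_conics (X : set PN) : Prop :=
  connected_by singular_conic X.

Definition conic_connected_by_smooth_conics (X : set PN) : Prop :=
  connected_by smooth_conic X.

End ProjectiveGeometry.

(* Main.v *)
(** Let the cone over [X] contain [u] and [v]. The coefficients of [t], .., [t^d] in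
    [G_i (u + t z)] and of [t], .., [t^(d - 1)] in [G_i (v + t z)], where [d] is the
    degree of [G_i], are [2 d - 1] forms in [z], and the leading coefficient [G_i z] is
    common to both polynomials. The hypothesis of the first part says that there are at
    most [N] such forms; hence they have a common nonzero zero [z], and the lines [u z]
    and [v z] lie in [X]. When [X] is smooth and defined by the [G_i] as a scheme, it is
    enough to use [c] of the equations, with a Jacobian minor that does not vanish at [u]
    and [v]: along a line through [u] on which these vanish, the lowest order terms of
    the other equations vanish too.

    The smooth conics are obtained by smoothing the chain of two lines through the
    generic pair [(x, y)] of points. In the family of conics [a x + zeta + b y] with
    [a b = q], [zeta] a function of [q] and [zeta 0 = z], the equations of [X] are solved
    modulo [q^(k + 1)], for every [k]. There is no obstruction because [(x, y)] is
    generic: every tangent vector to [X] at [x] or [y] lifts to a first order deformation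
    of the chain of lines. The equations for [zeta] and [q] are then satisfied modulo all
    powers of [q], and an ideal in a polynomial ring with such truncated solutions has a
    true solution with [q <> 0]. *)

Require Import Defs.
From HB Require Import structures.
From mathcomp Require Import all_boot all_order all_algebra.
From mathcomp Require Import boolp classical_sets reals.
From mathcomp Require Import mpoly complex ring zify.

Set Implicit Arguments.
Unset Strict Implicit.
Unset Printing Implicit Defensive.

Import GRing.Theory.
Local Open Scope ring_scope.
Local Open Scope classical_set_scope.
Local Open Scope quotient_scope.

(** * Generic zeros of ideals *)

(** Dimension theory, parameter spaces of curves and cohomology are replaced by field-valued points.
    A prime containing given equations and avoiding given functions yields a point over some field
    [L], and the extension of homomorphisms into an algebraically closed field brings it back to
    [K]. Tangent vectors at such points are homomorphisms to [{poly L}] read modulo ['X^2]; in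
    characteristic 0 they extend to new variables. This one tool shows both that a small number of
    forms has a common zero and that the chain of lines through the generic pair moves with its end
    points. The difficulty in smoothing is that one correction of [zeta] must serve both lines. On
    each line separately the error is cancelled by a constant vector: weights bound its degree, and
    the mobility of the line lowers the degree of the solution. The two vectors differ by a tangent
    vector at [z], which splits into two parts, each harmless on one of the lines. Truncated
    solutions of different orders need not be compatible, so no limit is taken: they only show that
    the ideal of their common relations contains no [t * q^j] with [t] nonzero at the generic
    pair. *)

Definition ideal_set (A : comNzRingType) (I : set A) : Prop :=
  [/\ I 0, forall a b, I a -> I b -> I (a + b) & forall c a, I a -> I (c * a)].

Definition mult_set (A : comNzRingType) (T : set A) : Prop :=
  T 1 /\ forall a b, T a -> T b -> T (a * b).

Section PrimeQuotient.
Variables (A : comNzRingType) (P : set A).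
Hypotheses (P_ideal : ideal_set P) (P1 : ~ P 1).
Hypothesis P_prime : forall a b, P (a * b) -> P a \/ P b.

Definition prime_pred : {pred A} := fun a => `[< P a >].

Let prime_pred_closed : idealr_closed prime_pred.
Proof.
case: P_ideal => [P0 PD PM]; split.
- by rewrite unfold_in; exact/asboolP.
- by rewrite unfold_in; apply/asboolPn.
- move=> a u v; rewrite !unfold_in => /asboolP Pu /asboolP Pv.
  by apply/asboolP/PD => //; exact: PM.
Qed.

HB.instance Definition _ := isIdealr.Build A prime_pred prime_pred_closed.

Let prime_pred_prime : prime_idealr_closed prime_pred.
Proof.
move=> u v; rewrite !unfold_in => /asboolP /P_prime [Pu|Pv].
- by apply/orP; left; apply/asboolP.
- by apply/orP; right; apply/asboolP.
Qed.

HB.instance Definition _ :=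
  isPrimeIdealrClosed.Build A prime_pred prime_pred_prime.

Definition prime_quot : Type := {ideal_quot prime_pred}.
HB.instance Definition _ := GRing.ComNzRing.on prime_quot.

Definition prime_quot_unit : {pred prime_quot} :=
  fun x => `[< exists y, y * x = 1 >].
Definition prime_quot_inv (x : prime_quot) : prime_quot :=
  if x \in prime_quot_unit then xget 0 [set y | y * x = 1] else x.

Let prime_quot_mulVx : {in prime_quot_unit, left_inverse 1 prime_quot_inv *%R}.
Proof.
move=> x ux; rewrite /prime_quot_inv ux.
move: ux; rewrite unfold_in => /asboolP [y yx].
by have := @xgetPex _ 0 [set y | y * x = 1] (ex_intro _ y yx).
Qed.

Let prime_quot_unitP (x y : prime_quot) : y * x = 1 -> x \in prime_quot_unit.
Proof. by move=> yx; rewrite unfold_in; apply/asboolP; exists y. Qed.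

Let prime_quot_inv_out : {in [predC prime_quot_unit], prime_quot_inv =1 id}.
Proof. by move=> x; rewrite !inE /prime_quot_inv => /negPf ->. Qed.

HB.instance Definition _ := GRing.ComNzRing_hasMulInverse.Build prime_quot
  prime_quot_mulVx prime_quot_unitP prime_quot_inv_out.

Let prime_quot_integral (x y : prime_quot) :
  x * y = 0 -> (x == 0) || (y == 0).
Proof. exact: Quotient.rquot_IdomainAxiom. Qed.

HB.instance Definition _ :=
  GRing.ComUnitRing_isIntegral.Build prime_quot prime_quot_integral.

Let pi (a : A) : prime_quot := \pi_{ideal_quot prime_pred} a.

Let pi_zmod : zmod_morphism pi.
Proof. exact: (@raddfB _ _ (\pi_({ideal_quot prime_pred}) : {additive _ -> _})). Qed.

Let pi_monoid : monoid_morphism pi.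
Proof.
split; first by rewrite /pi -[1 in LHS]/(1 : A) pi_oner.
by move=> a b; rewrite /pi pi_mulr.
Qed.

HB.instance Definition _ := GRing.isZmodMorphism.Build A prime_quot pi pi_zmod.
HB.instance Definition _ := GRing.isMonoidMorphism.Build A prime_quot pi pi_monoid.

Lemma prime_quotient_field :
  exists (L : fieldType) (phi : {rmorphism A -> L}),
    forall a, phi a = 0 <-> P a.
Proof.
exists {fraction prime_quot}, (@tofrac prime_quot \o pi) => a /=.
have -> : (tofrac (pi a) = 0) <-> (pi a = 0).
  by split=> [/eqP|->]; [rewrite tofrac_eq0 => /eqP|rewrite tofrac0].
rewrite -[pi a = 0]/(\pi_{ideal_quot prime_pred} a = 0).
have -> : (\pi_({ideal_quot prime_pred}) a = 0) <-> (a - 0 \in prime_pred).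
  rewrite Quotient.idealrBE; split=> [->|/eqP ->]; last by rewrite pi_zeror.
  by rewrite pi_zeror.
by rewrite subr0 unfold_in; split=> /asboolP.
Qed.

End PrimeQuotient.

Lemma ideal_sum (A : comNzRingType) (I : set A) (J : Type) (r : seq J)
    (Q : pred J) (F : J -> A) :
  ideal_set I -> (forall j, Q j -> I (F j)) -> I (\sum_(j <- r | Q j) F j).
Proof. by case=> I0 ID _ IF; elim/big_ind: _ => //; exact: ID. Qed.

(** An ideal that contains [I] and is maximal among those missing [T] is prime; [L] is the fraction
    field of its quotient. Thus [phi] is a point over [L] of the zeros of [I] at which no function
    of [T] vanishes. *)
Lemma avoiding_field (A : comNzRingType) (I T : set A) :
  ideal_set I -> mult_set T -> (forall a, I a -> ~ T a) ->
  exists (L : fieldType) (phi : {rmorphism A -> L}),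
    (forall a, I a -> phi a = 0) /\ (forall a, T a -> phi a <> 0).
Proof.
move=> I_ideal [T1 TM] IT.
(* The condition is on the union with [I], so that the empty set, the union of the empty chain,
   satisfies it as well. *)
pose ok (J : set A) := ideal_set (J `|` I) /\ forall a, (J `|` I) a -> ~ T a.
have [|M [[M_ideal MT] Mmax]] := @Zorn_bigcup A ok.
  move=> F Fok Ftot.
  have [[J0 FJ0]|F0] := pselect (exists J, F J); last first.
    have -> : \bigcup_(X in F) X = set0.
      by apply/seteqP; split=> // a [J FJ]; case: F0; exists J.
    by split; rewrite set0U.
  have up a b : (\bigcup_(X in F) X `|` I) a -> (\bigcup_(X in F) X `|` I) b ->
      exists J, [/\ F J, (J `|` I) a & (J `|` I) b].
    move=> [[J FJ Ja]|Ia] [[J' FJ' Jb]|Ib].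
    - have [JJ'|J'J] := Ftot _ _ FJ FJ'.
      + by exists J'; split=> //; left => //; exact: JJ'.
      + by exists J; split=> //; left => //; exact: J'J.
    - by exists J; split=> //; [left|right].
    - by exists J'; split=> //; [right|left].
    - by exists J0; split=> //; right.
  have down J a : F J -> (J `|` I) a -> (\bigcup_(X in F) X `|` I) a.
    by move=> FJ [Ja|Ia]; [left; exists J|right].
  split; last by move=> a Ja; have [J [FJ Ja' _]] := up _ _ Ja Ja; exact: (Fok _ FJ).2.
  split.
  - by right; case: I_ideal.
  - move=> a b /up {}up /up [J [FJ Ja Jb]].
    by apply: (down _ _ FJ); have [[_ JD _] _] := Fok _ FJ; exact: JD.
  - move=> c a Ja; have [J [FJ {}Ja _]] := up _ _ Ja Ja.
    by apply: (down _ _ FJ); have [[_ _ JM] _] := Fok _ FJ; exact: JM.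
set P := M `|` I.
have [P0 PD PM] := M_ideal.
have P_meets a : ~ P a -> exists p c, P p /\ T (p + c * a).
  move=> Pa; apply: contrapT => none.
  pose J : set A := [set b | exists p c, P p /\ b = p + c * a].
  have IJ b : P b -> J b by move=> Pb; exists b, 0; rewrite mul0r addr0.
  apply: (Mmax J).
    split=> [b Mb|/(_ a)]; first by apply: IJ; left.
    by move=> Ma; apply: Pa; left; apply: Ma; exists 0, 1; rewrite add0r mul1r.
  have JI : J `|` I = J.
    by apply/seteqP; split=> [b [//|Ib]|b]; [apply: IJ; right|left].
  rewrite /ok JI; split; last first.
    by move=> b [p [c [Pp ->]]] Tb; apply: none; exists p, c.
  split; first exact: IJ.
  - move=> _ _ [p [c [Pp ->]]] [p' [c' [Pp' ->]]]; exists (p + p'), (c + c').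
    by split; [exact: PD|rewrite mulrDl addrACA].
  - move=> e _ [p [c [Pp ->]]]; exists (e * p), (e * c).
    by split; [exact: PM|rewrite mulrDr mulrA].
have [||L [phi phiE]] := @prime_quotient_field A P M_ideal.
- by move=> P1; exact: (MT _ P1).
- move=> a b Pab; apply: contrapT => /not_orP [/P_meets [p [c [Pp Ta]]]].
  move=> /P_meets [q [e [Pq Tb]]].
  apply: MT (TM _ _ Ta Tb).
  have -> : (p + c * a) * (q + e * b) =
     (q + e * b) * p + ((c * a) * q + (c * e) * (a * b)).
    by rewrite mulrDl mulrC; congr (_ + _); rewrite mulrDr mulrACA.
  by apply: (PD); [exact: PM|apply: (PD); exact: PM].
exists L, phi; split=> a.
- by move=> Ia; apply/phiE; right.
- by move=> Ta /phiE Pa; exact: (MT _ Pa).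
Qed.

Lemma mmap_unique (A S : comNzRingType) (n : nat)
    (f g : {rmorphism {mpoly A[n]} -> S}) :
  (forall a, f a%:MP = g a%:MP) -> (forall i, f 'X_i = g 'X_i) -> f =1 g.
Proof.
move=> fgC fgX p; rewrite [p]mpolyE !rmorph_sum; apply: eq_bigr => m _ /=.
rewrite -mul_mpolyC !rmorphM fgC; congr (_ * _).
rewrite mpolyXE_id !rmorph_prod; apply: eq_bigr => i _ /=.
by rewrite !rmorphXn /= fgX.
Qed.

Lemma poly_unique (A S : comNzRingType) (f g : {rmorphism {poly A} -> S}) :
  (forall a, f a%:P = g a%:P) -> f 'X = g 'X -> f =1 g.
Proof.
move=> fgC fgX; elim/poly_ind=> [|p c IH]; first by rewrite !rmorph0.
by rewrite !rmorphD !rmorphM /= IH fgX fgC.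
Qed.

Lemma X2_dvdp (L : fieldType) (p : {poly L}) :
  ('X^2 %| p) = (p`_0 == 0) && (p`_1 == 0).
Proof.
apply/idP/andP.
  by move/dvdpP => [q ->]; rewrite !coefMXn.
move=> [/eqP p0 /eqP p1]; apply/dvdpP; exists (drop_poly 2 p).
rewrite -[LHS](poly_take_drop 2) [take_poly 2 p](_ : _ = 0) ?add0r //.
by apply/polyP => -[|[|i]]; rewrite coef_take_poly coef0.
Qed.

Lemma horner_taylor1 (A : comNzRingType) (p : {poly A}) (x h : A) :
  exists r, p.[x + h] = p.[x] + p^`().[x] * h + r * h ^+ 2.
Proof.
elim/poly_ind: p => [|p c [r IH]].
  by exists 0; rewrite deriv0 !horner0 !mul0r !addr0.
exists (r * (x + h) + p^`().[x]).
rewrite derivD derivC addr0 derivM derivX mulr1.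
by rewrite !(hornerMX, hornerD, hornerC) IH; ring.
Qed.

Definition horner_map (A S : comNzRingType) (f : {rmorphism A -> S}) (s : S) :
  {poly A} -> S := horner_eval s \o map_poly f.
HB.instance Definition _ (A S : comNzRingType) (f : {rmorphism A -> S}) (s : S) :=
  GRing.RMorphism.on (horner_map f s).

Lemma horner_mapC (A S : comNzRingType) (f : {rmorphism A -> S}) (s : S) a :
  horner_map f s a%:P = f a.
Proof. by rewrite /horner_map /= map_polyC /horner_eval hornerC. Qed.

Lemma horner_mapX (A S : comNzRingType) (f : {rmorphism A -> S}) (s : S) :
  horner_map f s 'X = s.
Proof. by rewrite /horner_map /= map_polyX /horner_eval hornerX. Qed.

Lemma horner_mapE (A S : comNzRingType) (f : {rmorphism A -> S}) (s : S) p :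
  horner_map f s p = (map_poly f p).[s].
Proof. by []. Qed.

(** * Algebraic relations of one element over the image of a ring *)

Section OneVariable.
Variables (A : comNzRingType) (L : fieldType).
Variables (phi : {rmorphism A -> L}) (b : L).

Local Notation eval1 := (horner_map phi b).

Lemma map_take_poly p :
  map_poly phi (take_poly (size (map_poly phi p)) p) = map_poly phi p.
Proof.
apply/polyP => i; rewrite !coef_map coef_take_poly /=.
by case: ltnP => // le; rewrite rmorph0 -coef_map nth_default.
Qed.

(** The top coefficients of a relation may be killed by [phi]. Cutting them off keeps the image and
    leaves a leading coefficient that survives, as pseudo-division requires. *)
Lemma size_map_take_poly p (f := take_poly (size (map_poly phi p)) p) :
  map_poly phi p != 0 ->
  size f = size (map_poly phi p) /\ phi (lead_coef f) != 0.
Proof.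
move=> p0; have s : size f = size (map_poly phi p).
  apply/eqP; rewrite eqn_leq size_take_poly /=.
  by rewrite -{1}(map_take_poly p) size_poly.
split=> //; rewrite lead_coefE s -coef_map map_take_poly.
by rewrite -lead_coefE lead_coef_eq0.
Qed.

(** The alternative between transcendental and algebraic over the fractions of the image of [phi],
    with a minimal polynomial whose coefficients stay in [A]; pseudo-division replaces division,
    whence the power of the leading coefficient. *)
Lemma transcendental_or_minimal :
  (forall p, eval1 p = 0 -> map_poly phi p = 0) \/
  (exists f, [/\ eval1 f = 0, phi (lead_coef f) != 0,
    (forall p, eval1 p = 0 -> map_poly phi p != 0 ->
       (size f <= size (map_poly phi p))%N) &
    forall p, eval1 p = 0 -> exists k h r,
      lead_coef f ^+ k *: p = h * f + r /\ map_poly phi r = 0]).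
Proof.
have [|nt] := pselect (forall p, eval1 p = 0 -> map_poly phi p = 0); first by left.
right; pose rel n := `[< exists p, [/\ eval1 p = 0, map_poly phi p != 0 &
  size (map_poly phi p) = n] >].
have ex : exists n, rel n.
  apply: contrapT => none; apply: nt => p p0; apply/eqP/negP => /negP p1.
  by apply: none; exists (size (map_poly phi p)); apply/asboolP; exists p.
case: (ex_minnP ex) => n /asboolP [p [p0 p1 pn]] nmin.
have [sf lf] := size_map_take_poly p1.
set f := take_poly _ p in sf lf.
have f0 : eval1 f = 0 by rewrite horner_mapE map_take_poly.
have fmin q : eval1 q = 0 -> map_poly phi q != 0 ->
    (size f <= size (map_poly phi q))%N.
  by move=> q0 q1; rewrite sf pn; apply: nmin; apply/asboolP; exists q.
exists f; split=> // q q0.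
have fn0 : f != 0 by apply: contraNneq lf => ->; rewrite lead_coef0 rmorph0.
have E := Pdiv.ComRing.rdivp_eq f q.
exists (Pdiv.Ring.rscalp q f), (Pdiv.Ring.rdivp q f), (Pdiv.Ring.rmodp q f).
split=> //; set r := Pdiv.Ring.rmodp q f in E *.
have r0 : eval1 r = 0.
  have : eval1 (lead_coef f ^+ Pdiv.Ring.rscalp q f *: q) = 0.
    by rewrite -mul_polyC rmorphM /= q0 mulr0.
  by rewrite E rmorphD rmorphM /= f0 mulr0 add0r.
apply/eqP/negP => /negP /(fmin _ r0); apply/negP; rewrite -ltnNge.
apply: leq_ltn_trans (_ : size r < _)%N; first exact: size_poly.
by rewrite Pdiv.Ring.ltn_rmodp.
Qed.

(** The derivative is shorter than [f], so by minimality it vanishes at [b] only if [phi] kills its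
    coefficients; in characteristic 0 this makes [f] constant, and a constant with surviving leading
    coefficient is no relation. *)
Lemma minimal_relation_separable (f : {poly A}) : [pchar L] =i pred0 ->
  eval1 f = 0 -> phi (lead_coef f) != 0 ->
  (forall p, eval1 p = 0 -> map_poly phi p != 0 ->
       (size f <= size (map_poly phi p))%N) ->
  eval1 f^`() != 0.
Proof.
move=> L0 f0 lf fmin; apply/eqP => /fmin s0.
have f1 : f != 0 by apply: contraNneq lf => ->; rewrite lead_coef0 rmorph0.
have lt : (size (map_poly phi f^`()) < size f)%N.
  by apply: leq_ltn_trans (size_poly _ _) _; rewrite lt_size_deriv.
have d0 : map_poly phi f^`() = 0.
  by apply/eqP/negP => /negP /s0; rewrite leqNgt lt.
have sf : (size f <= 1)%N.
  rewrite leqNgt; apply: contra_neqN lf => sf; rewrite lead_coefE.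
  have /eqP : (map_poly phi f^`())`_(size f).-2 = 0 by rewrite d0 coef0.
  rewrite coef_map coef_deriv (raddfMn phi).
  rewrite (_ : (size f).-2.+1 = (size f).-1); last by lia.
  rewrite -mulr_natr mulf_eq0 => /orP[/eqP -> //|].
  by move/pcharf0P: L0 => ->; lia.
by move: lf f0; rewrite (size1_polyC sf) lead_coefC horner_mapC => /eqP.
Qed.

End OneVariable.

(* The reduction of [Phi] modulo ['X^2] induces a first order deformation of the
   homomorphism [fun a => (Phi a).[0]] on the image of the latter. *)
Definition admissible (A : comNzRingType) (L : fieldType)
    (Phi : A -> {poly L}) : Prop :=
  forall a, (Phi a).[0] = 0 -> 'X^2 %| Phi a.

Section AdmissibleExtension.
Variables (A : comNzRingType) (L : fieldType).
Hypothesis L0 : [pchar L] =i pred0.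
Variables (Phi : {rmorphism A -> {poly L}}) (b : L).
Hypothesis Phi_adm : admissible Phi.

Let phi : {rmorphism A -> L} := (horner_eval (0 : L) \o Phi)%FUN.

Lemma horner_map_eval1 (w : L) (p : {poly A}) :
  (horner_map Phi (b%:P + w%:P * 'X) p).[0] = horner_map phi b p.
Proof.
pose f : {rmorphism {poly A} -> L} :=
  (horner_eval (0 : L) \o horner_map Phi (b%:P + w%:P * 'X))%FUN.
rewrite -[LHS]/(f p); apply: poly_unique => [a|].
  by rewrite /f /= !horner_mapC.
by rewrite /f /= !horner_mapX /horner_eval !hornerE.
Qed.

Lemma horner_map_dvd (w : L) (r : {poly A}) : map_poly phi r = 0 ->
  'X^2 %| horner_map Phi (b%:P + w%:P * 'X) r.
Proof.
move=> r0; rewrite /horner_map /= /horner_eval horner_coef.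
elim/big_ind: _ => [|? ? *|i _]; [exact: dvdp0|exact: dvdp_add|].
apply: dvdp_mulr; rewrite coef_map; apply: Phi_adm.
by rewrite -[LHS]/(phi r`_i) -coef_map r0 coef0.
Qed.

(** A derivation extends to a further element [b]: with any value if [b] is transcendental, with a
    prescribed one if [b] is separable algebraic. *)
Lemma admissible_extend : exists w : L,
  admissible (horner_map Phi (b%:P + w%:P * 'X)).
Proof.
have [tr|[f [f0 lf fmin fdiv]]] := transcendental_or_minimal phi b.
  exists 0 => p; rewrite horner_map_eval1 => /tr; exact: horner_map_dvd.
pose s := horner_map phi b f^`().
have s0 : s != 0 by exact: minimal_relation_separable.
pose F := map_poly Phi f.
(* The coefficient of ['X] in [f] at [b + w 'X] is that of [F.[b%:P]] plus [s * w]; this [w] makes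
   it zero. *)
pose w := - F.[b%:P]`_1 / s.
exists w => p; rewrite horner_map_eval1 => p0.
have [k [h [r [E r0]]]] := fdiv _ p0.
have df : 'X^2 %| horner_map Phi (b%:P + w%:P * 'X) f.
  have c0 : (horner_map Phi (b%:P + w%:P * 'X) f).[0] = 0.
    by rewrite horner_map_eval1.
  rewrite X2_dvdp -horner_coef0 c0 eqxx /=.
  rewrite /horner_map /= /horner_eval -/F.
  have [q ->] := horner_taylor1 F b%:P (w%:P * 'X).
  rewrite exprMn [q * _]mulrA [_ * (w%:P * 'X)]mulrA !coefD coefMXn /= addr0.
  rewrite coefMX /= coefMC.
  have -> : (F^`().[b%:P])`_0 = s.
    rewrite /s -(horner_map_eval1 0) mul0r addr0 /horner_map /= /horner_eval.
    by rewrite deriv_map horner_coef0.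
  by rewrite /w mulrC divfK // addrN.
(* Pseudo-division controls only a multiple of [p]; the factor has a nonzero constant term, so it is
   prime to ['X^2] and cancels. *)
have : 'X^2 %| horner_map Phi (b%:P + w%:P * 'X) (lead_coef f ^+ k *: p).
  rewrite E rmorphD rmorphM /=; apply: dvdp_add (horner_map_dvd _ r0).
  exact: dvdp_mull.
rewrite -mul_polyC rmorphM polyC_exp rmorphXn /= Gauss_dvdpr //.
rewrite /horner_map /= /horner_eval map_polyC hornerC.
apply/coprimep_expl/coprimep_expr.
by rewrite coprimep_sym coprimepX; exact: lf.
Qed.

End AdmissibleExtension.

(** A derivation that is zero on the image of [phi] kills separable algebraic elements: modulo
    ['X^2], the value of [f] at [b + v 'X] is [v 'X] times the value of its derivative at [b]. *)
Lemma first_order_root (A : comNzRingType) (L : fieldType)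
    (phi : {rmorphism A -> L}) (b v : L) (f : {poly A}) :
  horner_map phi b f = 0 -> horner_map phi b f^`() != 0 ->
  'X^2 %| horner_map (polyC \o phi) (b%:P + v%:P * 'X) f -> v = 0.
Proof.
move=> f0 f1; rewrite horner_mapE.
have [q ->] := horner_taylor1 (map_poly (polyC \o phi) f) b%:P (v%:P * 'X).
rewrite X2_dvdp => /andP [_].
have hF g : (map_poly (polyC \o phi) g).[b%:P] = (horner_map phi b g)%:P.
  pose h : {rmorphism {poly A} -> {poly L}} := (polyC \o horner_map phi b)%FUN.
  rewrite -horner_mapE -[RHS]/(h g); apply: poly_unique => [a|].
    by rewrite /h /= !horner_mapC.
  by rewrite /h /= !horner_mapX.
rewrite deriv_map !hF f0 polyC0 add0r exprMn [q * _]mulrA mulrA.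
rewrite coefD coefMXn /= addr0 coefMX /= -polyCM coefC /= mulf_eq0.
by rewrite (negPf f1) => /eqP.
Qed.

(** * Specialization and the Nullstellensatz *)

Section Specialization.
Variables (A : comNzRingType) (L : fieldType) (K : closedFieldType).
Variables (phi : {rmorphism A -> L}) (b : L).
Local Notation eval1 := (horner_map phi b).

Lemma map_poly_killed (psi : {rmorphism A -> K}) (p : {poly A}) :
  (forall a, phi a = 0 -> psi a = 0) -> map_poly phi p = 0 ->
  map_poly psi p = 0.
Proof.
move=> kill p0; apply/polyP => i; rewrite coef_map coef0; apply: kill.
by rewrite -coef_map p0 coef0.
Qed.

Lemma rel_size_gt1 (f : {poly A}) :
  eval1 f = 0 -> phi (lead_coef f) != 0 -> (1 < size f)%N.
Proof.
move=> f0 lf; rewrite ltnNge; apply/negP => sf.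
by move: lf f0; rewrite (size1_polyC sf) lead_coefC horner_mapC => /eqP.
Qed.

(* A minimal relation [f] of [b] is irreducible over the fractions of [phi A],
   so that it is comaximal with any [g] that does not vanish at [b]. *)
Lemma minimal_relation_comaximal (f g : {poly A}) :
  eval1 f = 0 -> phi (lead_coef f) != 0 -> eval1 g <> 0 ->
  (forall p, eval1 p = 0 -> map_poly phi p != 0 ->
       (size f <= size (map_poly phi p))%N) ->
  exists h u v r,
    [/\ h%:P = u * g + v * f + r, phi h != 0 & map_poly phi r = 0].
Proof.
move=> f0 lf g0 fmin.
pose S (e : {poly A}) := exists u v r, e = u * g + v * f + r /\ map_poly phi r = 0.
have S_comb a c e e' : S e -> S e' -> S (a * e + c * e').
  move=> [u [v [r [-> r0]]]] [u' [v' [r' [-> r0']]]].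
  exists (a * u + c * u'), (a * v + c * v'), (a * r + c * r'); split; first by ring.
  by rewrite rmorphD !rmorphM /= r0 r0' !mulr0 addr0.
have Sf : S f by exists 0, 1, 0; rewrite !rmorph0; split=> //; ring.
have Sg : S g by exists 1, 0, 0; rewrite !rmorph0; split=> //; ring.
pose rel n := `[< exists e, [/\ S e, map_poly phi e != 0 &
  size (map_poly phi e) = n] >].
have mf0 : map_poly phi f != 0.
  by apply: contraNneq lf => mf; rewrite lead_coefE -coef_map mf coef0.
have ex : exists n, rel n.
  by exists (size (map_poly phi f)); apply/asboolP; exists f.
(* An element of least degree in the ideal generated by [f] and [g] over the fractions of the image
   of [phi]; it divides all the others and will turn out to be constant. *)
case: (ex_minnP ex) => n /asboolP [e0 [Se0 e0n0 e0n]] nmin.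
have [se le] := size_map_take_poly e0n0; set e := take_poly _ e0 in se le.
have Se : S e.
  have [u [v [r [E r0]]]] := Se0; exists u, v, (r + (e - e0)); split.
    by rewrite addrA -E addrC subrK.
  by rewrite rmorphD /= r0 add0r rmorphB /= map_take_poly subrr.
have en0 : e != 0 by apply: contraNneq le => ->; rewrite lead_coef0 rmorph0.
have e_div q : S q -> exists k h r,
    lead_coef e ^+ k *: q = h * e + r /\ map_poly phi r = 0.
  move=> Sq; exists (Pdiv.Ring.rscalp q e), (Pdiv.Ring.rdivp q e), (Pdiv.Ring.rmodp q e).
  have E := Pdiv.ComRing.rdivp_eq e q; split=> //.
  set r := Pdiv.Ring.rmodp q e in E *.
  apply/eqP/negP => /negP r0.
  have : rel (size (map_poly phi r)).
    apply/asboolP; exists r; split=> //.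
    have -> : r = (lead_coef e ^+ Pdiv.Ring.rscalp q e)%:P * q +
        (- Pdiv.Ring.rdivp q e) * e by rewrite mul_polyC E; ring.
    exact: S_comb.
  move=> /nmin; apply/negP; rewrite -ltnNge -e0n -se.
  apply: leq_ltn_trans (_ : size r < _)%N; first exact: size_poly.
  by rewrite Pdiv.Ring.ltn_rmodp.
have e1n0 : eval1 e != 0.
  apply/eqP => e1; apply: g0.
  have [k [h [r [E r0]]]] := e_div _ Sg.
  have : eval1 (lead_coef e ^+ k *: g) = 0.
    by rewrite E rmorphD rmorphM /= e1 mulr0 add0r horner_mapE r0 horner0.
  rewrite -mul_polyC rmorphM /= horner_mapC rmorphXn => /eqP.
  by rewrite mulf_eq0 expf_eq0 (negPf le) andbF => /eqP.
(* [f] is a multiple of [e], whose value at [b] is not zero, so the cofactor vanishes at [b]; by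
   minimality it has at least the degree of [f]. *)
have se1 : size e = 1%N.
  have [k [h [r [E r0]]]] := e_div _ Sf.
  have Em : phi (lead_coef e) ^+ k *: map_poly phi f = map_poly phi h * map_poly phi e.
    have := congr1 (map_poly phi) E.
    rewrite rmorphD rmorphM /= r0 addr0 => <-.
    by rewrite -!mul_polyC rmorphM /= map_polyC /= rmorphXn.
  have c0 : phi (lead_coef e) ^+ k != 0 by rewrite expf_neq0.
  have hn0 : map_poly phi h != 0.
    apply: contra_neq mf0 => h0; move/eqP: Em; rewrite h0 mul0r scaler_eq0.
    by rewrite (negPf c0) => /eqP.
  have h1 : eval1 h = 0.
    have := congr1 (horner^~ b) Em; rewrite hornerZ hornerM.
    rewrite -(horner_mapE phi b f) f0 mulr0 => /esym/eqP.
    by rewrite mulf_eq0 -!horner_mapE (negPf e1n0) orbF => /eqP.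
  have sh := fmin _ h1 hn0.
  have men0 : map_poly phi e != 0 by rewrite map_take_poly.
  have := congr1 (@size L) (congr1 (@polyseq L) Em).
  rewrite size_scale // size_mul //.
  have -> : size (map_poly phi e) = size e by rewrite se map_take_poly.
  have arith a c d i : (0 < a -> c <= d -> i <= c -> i = (d + a).-1 -> a = 1)%N.
    by lia.
  by apply: arith sh (size_poly _ _); rewrite size_poly_gt0.
have [u [v [r [E r0]]]] := Se.
exists e`_0, u, v, r; split=> //; last by move: le; rewrite lead_coefE se1.
by rewrite -size1_polyC ?se1.
Qed.

(** One step of the extension of homomorphisms into an algebraically closed field: [h] collects what
    must survive [psi] for a suitable image [c] of [b] to exist. *)
Lemma specialize_extend (g : {poly A}) : eval1 g <> 0 ->
  exists2 h, phi h <> 0 & forall psi : {rmorphism A -> K},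
    (forall a, phi a = 0 -> psi a = 0) -> psi h <> 0 ->
    exists2 c : K, (forall p, eval1 p = 0 -> horner_map psi c p = 0) &
                   horner_map psi c g <> 0.
Proof.
move=> g0.
have [tr|[f [f0 lf fmin fdiv]]] := transcendental_or_minimal phi b.
  have : map_poly phi g != 0.
    by apply/eqP => mg; apply: g0; rewrite horner_mapE mg horner0.
  rewrite -lead_coef_eq0 lead_coefE coef_map; set i := _.-1 => gi.
  exists g`_i; first exact/eqP.
  move=> psi kill psi_gi.
  have : map_poly psi g != 0.
    by apply/eqP => mg; apply: psi_gi; rewrite -[LHS]coef_map mg coef0.
  move=> /closed_nonrootP [c gc]; exists c; last exact/eqP.
  move=> p /tr p0; rewrite horner_mapE.
  by rewrite (map_poly_killed kill p0) horner0.
have [h [u [v [r [E h0 r0]]]]] := minimal_relation_comaximal f0 lf g0 fmin.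
(* [lead_coef f] preserves the degree of [f], which thus has a root after [psi]; [h] keeps [f] and
   [g] comaximal, so that [g] is not zero at that root. *)
exists (h * lead_coef f).
  by rewrite rmorphM /=; apply/eqP; rewrite mulf_neq0.
move=> psi kill; rewrite rmorphM /= => /eqP; rewrite mulf_eq0 negb_or.
move=> /andP [psi_h psi_lf].
have : size (map_poly psi f) != 1%N.
  by rewrite size_poly_eq // neq_ltn rel_size_gt1 // orbT.
move=> /closed_rootP [c fc]; exists c.
  move=> p /fdiv [k [q [s [E' s0]]]].
  have : horner_map psi c (lead_coef f ^+ k *: p) = 0.
    rewrite E' rmorphD rmorphM /= !horner_mapE (eqP fc) mulr0 add0r.
    by rewrite (map_poly_killed kill s0) horner0.
  rewrite -mul_polyC rmorphM /= horner_mapC rmorphXn => /eqP.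
  by rewrite mulf_eq0 expf_eq0 (negPf psi_lf) andbF => /eqP.
move=> g1; move/eqP: psi_h; apply.
have := congr1 (horner_map psi c) E.
rewrite horner_mapC !rmorphD !rmorphM /= g1 [horner_map psi c r]horner_mapE.
by rewrite (map_poly_killed kill r0) !horner_mapE (eqP fc) horner0 !mulr0 !addr0.
Qed.

End Specialization.

Definition cons_var (T : Type) (s : nat) (c : T) (b : 'I_s -> T) (i : 'I_s.+1) : T :=
  if unlift ord0 i is Some j then b j else c.

Lemma cons_var0 (T : Type) (s : nat) (c : T) (b : 'I_s -> T) :
  cons_var c b ord0 = c.
Proof. by rewrite /cons_var unlift_none. Qed.

Lemma cons_varS (T : Type) (s : nat) (c : T) (b : 'I_s -> T) j :
  cons_var c b (lift ord0 j) = b j.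
Proof. by rewrite /cons_var liftK. Qed.

Section FirstVariable.
Variables (A : comNzRingType) (s : nat).

Definition mshift : {mpoly A[s]} -> {mpoly A[s.+1]} :=
  mmap (@mpolyC s.+1 A) (fun j => 'X_(lift ord0 j)).
HB.instance Definition _ := GRing.RMorphism.on mshift.

Definition mfirst : {mpoly A[s.+1]} -> {poly {mpoly A[s]}} :=
  mmap (@polyC {mpoly A[s]} \o @mpolyC s A) (cons_var 'X (fun j => ('X_j)%:P)).
HB.instance Definition _ := GRing.RMorphism.on mfirst.

Lemma mshiftC a : mshift a%:MP = a%:MP. Proof. exact: mmapC. Qed.
Lemma mshiftX j : mshift 'X_j = 'X_(lift ord0 j).
Proof. by rewrite /mshift mmapX mmap1U. Qed.

Lemma mfirst_eval (S : comNzRingType) (f : {rmorphism {mpoly A[s.+1]} -> S}) p :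
  f p = horner_map (f \o mshift) (f 'X_ord0) (mfirst p).
Proof.
pose g : {rmorphism {mpoly A[s.+1]} -> S} :=
  (horner_map (f \o mshift) (f 'X_ord0) \o mfirst)%FUN.
rewrite -[RHS]/(g p); apply: mmap_unique => [a|i].
  by rewrite /g /= /mfirst mmapC horner_mapC /= mshiftC.
rewrite /g /= /mfirst mmapX mmap1U.
case: (unliftP ord0 i) => [j ->|->]; last by rewrite cons_var0 horner_mapX.
by rewrite cons_varS horner_mapC /= mshiftX.
Qed.
End FirstVariable.

Lemma mmap_cons (A : comNzRingType) (s : nat) (S : comNzRingType)
   (psi : {rmorphism A -> S}) c (b : 'I_s -> S) p :
  mmap psi (cons_var c b) p = horner_map (mmap psi b) c (mfirst p).
Proof.
rewrite (mfirst_eval (mmap psi (cons_var c b))) /= mmapX mmap1U cons_var0.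
rewrite !horner_mapE; congr (_.[_]); apply/polyP => i; rewrite !coef_map /=.
pose f : {rmorphism {mpoly A[s]} -> S} := (mmap psi (cons_var c b) \o @mshift A s)%FUN.
rewrite -[LHS]/(f _); apply: mmap_unique => [a|j] /=.
  by rewrite mshiftC !mmapC.
by rewrite mshiftX !mmapX !mmap1U cons_varS.
Qed.

Section SeveralVariables.
Variables (L : fieldType) (K : closedFieldType).

(** An algebraic form of Chevalley's theorem: all points [psi] of the base that satisfy the
    relations of [phi] and lie off [h = 0] lift to points off [g = 0]. The base [A] is [K] itself
    for the Nullstellensatz and the ring of functions of two points for the smooth conics. *)
Lemma specialize_mpoly (s : nat) (A : comNzRingType)
    (phi : {rmorphism {mpoly A[s]} -> L}) (g : {mpoly A[s]}) : phi g <> 0 ->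
  exists2 h : A, phi h%:MP <> 0 & forall psi : {rmorphism A -> K},
    (forall a, phi a%:MP = 0 -> psi a = 0) -> psi h <> 0 ->
    exists2 c : 'I_s -> K, (forall p, phi p = 0 -> mmap psi c p = 0) &
                           mmap psi c g <> 0.
Proof.
elim: s phi g => [|s IH] phi g g0.
  exists g@_0%MM; first by rewrite -nvar0_mpolyC.
  move=> psi kill psi_g; exists (fun=> 0); last by rewrite [g]nvar0_mpolyC mmapC.
  by move=> p; rewrite [p]nvar0_mpolyC mmapC => /kill.
pose phi' : {rmorphism {mpoly A[s]} -> L} := (phi \o @mshift A s)%FUN.
have g1 : horner_map phi' (phi 'X_ord0) (mfirst g) <> 0 by rewrite -mfirst_eval.
have [h' h'0 spec1] := specialize_extend K g1.
have [h h0 spec2] := IH phi' h' h'0.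
exists h; first by move: h0; rewrite /phi' /= mshiftC.
move=> psi kill psi_h.
have [|b kb h'b] := spec2 psi _ psi_h.
  by move=> a; rewrite /phi' /= mshiftC => /kill.
have [c kc gc] := spec1 (mmap psi b) kb h'b.
exists (cons_var c b) => [p|]; last by rewrite mmap_cons.
by move=> p0; rewrite mmap_cons; apply: kc; rewrite -(mfirst_eval phi).
Qed.

Hypothesis L0 : [pchar L] =i pred0.

Lemma admissible_mpoly (s : nat) (A : comNzRingType)
    (phi : {rmorphism {mpoly A[s]} -> L}) (Phi : {rmorphism A -> {poly L}}) :
  (forall a, (Phi a).[0] = phi a%:MP) -> admissible Phi ->
  exists w : 'I_s -> L,
    admissible (mmap Phi (fun i => (phi 'X_i)%:P + (w i)%:P * 'X)).
Proof.
elim: s phi => [|s IH] phi phiE adm.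
  by exists (fun=> 0) => p; rewrite [p]nvar0_mpolyC mmapC; exact: adm.
pose phi' : {rmorphism {mpoly A[s]} -> L} := (phi \o @mshift A s)%FUN.
have [|w admw] := IH phi' _ adm; first by move=> a; rewrite /phi' /= mshiftC.
have [w0 admw0] := admissible_extend L0 (phi 'X_ord0) admw.
exists (cons_var w0 w) => p.
have -> : mmap Phi (fun i => (phi 'X_i)%:P + (cons_var w0 w i)%:P * 'X) p =
  horner_map (mmap Phi (fun i => (phi' 'X_i)%:P + (w i)%:P * 'X))
     ((phi 'X_ord0)%:P + w0%:P * 'X) (mfirst p); last exact: admw0.
rewrite -mmap_cons; apply: mmap_unique => [a|i] /=; first by rewrite !mmapC.
rewrite !mmapX !mmap1U; case: (unliftP ord0 i) => [j ->|->].
  by rewrite !cons_varS /phi' /= mshiftX.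
by rewrite !cons_var0.
Qed.

End SeveralVariables.

(** If no power of [g] lies in [I], some point over a field satisfies [I] and has [g] nonzero;
    specializing it gives such a point over [K]. *)
Theorem nullstellensatz (K : closedFieldType) (n : nat)
    (I : set {mpoly K[n]}) (g : {mpoly K[n]}) : ideal_set I ->
  (forall c : 'I_n -> K, (forall f, I f -> f.@[c] = 0) -> g.@[c] = 0) ->
  exists k, I (g ^+ k).
Proof.
move=> I_ideal Ig; apply: contrapT => none.
have [||L [phi [phiI phiT]]] := @avoiding_field _ I [set g ^+ k | k in setT] I_ideal.
- split; first by exists 0%N.
  by move=> _ _ [k _ <-] [l _ <-]; exists (k + l)%N => //; rewrite exprD.
- by move=> f If [k _ E]; apply: none; exists k; rewrite E.
have [|h h0 spec] := @specialize_mpoly L K n K phi g.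
  by apply: phiT; exists 1%N.
have [a a0|h1|c kc gc] := spec idfun.
- by apply/eqP; rewrite -(fmorph_eq0 (phi \o @mpolyC n K)) /= a0.
- by apply: h0; rewrite (h1 : h = 0) !rmorph0.
by apply: gc; apply: Ig => f If; apply: kc; exact: phiI.
Qed.

(** * Taylor expansions and weights *)

Lemma mpoly_ring_ind (A : comNzRingType) (n : nat) (P : {mpoly A[n]} -> Prop) :
  (forall a, P a%:MP) -> (forall i, P 'X_i) ->
  (forall p q, P p -> P q -> P (p + q)) ->
  (forall p q, P p -> P q -> P (p * q)) -> forall p, P p.
Proof.
move=> PC PX PD PM p; rewrite [p]mpolyE.
elim/big_ind: _ => [|//|m _]; first by rewrite -[0](mpolyC0 n A); exact: PC.
rewrite -mul_mpolyC; apply: (PM); first exact: PC.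
rewrite mpolyXE_id; elim/big_ind: _ => [|//|i _]; first by rewrite -mpolyC1.
elim: (m i) => [|k IH]; first by rewrite expr0 -mpolyC1.
by rewrite exprS; exact: PM.
Qed.

Lemma mmap_comp (A B C : comNzRingType) (n : nat) (i : {rmorphism A -> B})
    (p : 'I_n -> B) (t : {rmorphism B -> C}) f :
  t (mmap i p f) = mmap (t \o i) (t \o p) f.
Proof.
pose g : {rmorphism {mpoly A[n]} -> C} := (t \o mmap i p)%FUN.
rewrite -[LHS]/(g f); apply: mmap_unique => [a|l].
  by rewrite /g /= !mmapC.
by rewrite /g /= !mmapX !mmap1U.
Qed.

Lemma mmap_congr (A B : comNzRingType) (n : nat) (i j : {rmorphism A -> B})
    (p q : 'I_n -> B) f : i =1 j -> p =1 q -> mmap i p f = mmap j q f.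
Proof.
move=> ij pq; apply: mmap_unique => [a|l] /=.
  by rewrite !mmapC; exact: ij.
by rewrite !mmapX !mmap1U; exact: pq.
Qed.

Lemma rmorph_congr (A B : comNzRingType) (n : nat) (J : set B)
    (f g : {rmorphism {mpoly A[n]} -> B}) : ideal_set J ->
  (forall a, J (f a%:MP - g a%:MP)) -> (forall i, J (f 'X_i - g 'X_i)) ->
  forall p, J (f p - g p).
Proof.
move=> [J0 JD JM] JC JX; apply: mpoly_ring_ind => // [p q Jp Jq|p q Jp Jq].
  by rewrite !rmorphD opprD addrACA; exact: JD.
rewrite !rmorphM /=.
have -> : f p * f q - g p * g q = f q * (f p - g p) + g p * (f q - g q) by ring.
by apply: JD; exact: JM.
Qed.

Section Taylor.
Variables (A B : comNzRingType) (n : nat) (i : {rmorphism A -> B}).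

Lemma mmap_taylor (a v : 'I_n -> B) (e : B) f :
  exists r, mmap i (fun l => a l + e * v l) f =
    mmap i a f + e * (\sum_l mmap i a f^`M(l) * v l) + e ^+ 2 * r.
Proof.
have arithD (f0 g0 df dg r s : B) :
    f0 + e * df + e ^+ 2 * r + (g0 + e * dg + e ^+ 2 * s) =
    f0 + g0 + e * (df + dg) + e ^+ 2 * (r + s) by ring.
have arithM (f0 g0 df dg r s : B) :
    (f0 + e * df + e ^+ 2 * r) * (g0 + e * dg + e ^+ 2 * s) =
    f0 * g0 + e * (g0 * df + f0 * dg) +
    e ^+ 2 * (f0 * s + g0 * r + df * dg + e * (df * s + dg * r) + e ^+ 2 * r * s).
  by ring.
elim/mpoly_ring_ind: f => [c|k|f g [r Er] [s Es]|f g [r Er] [s Es]].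
- exists 0; rewrite !mmapC big1 ?mulr0 ?addr0 // => l _.
  by rewrite mderivC rmorph0 mul0r.
- exists 0; rewrite !mmapX !mmap1U mulr0 addr0; congr (_ + _ * _).
  rewrite (bigD1 k) //= big1 ?addr0.
    rewrite mderivX mnm1E eqxx scale1r.
    have -> : (U_(k) - U_(k))%MM = 0%MM :> 'X_{1..n}.
      by apply/mnmP => j; rewrite mnmBE subnn mnm0E.
    by rewrite mpolyX0 rmorph1 mul1r.
  move=> l lk; rewrite mderivX mnm1E eq_sym (negPf lk) scale0r rmorph0.
  by rewrite mul0r.
- exists (r + s); rewrite !rmorphD /= Er Es.
  rewrite arithD; congr (_ + _ * _ + _); rewrite -big_split; apply: eq_bigr.
  by move=> l _ /=; rewrite mderivD rmorphD mulrDl.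
- set df := \sum_l _ * _ in Er; set dg := \sum_l _ * _ in Es.
  set f0 := mmap i a f in Er *; set g0 := mmap i a g in Es *.
  exists (f0 * s + g0 * r + df * dg + e * (df * s + dg * r) + e ^+ 2 * r * s).
  rewrite !rmorphM /= -/f0 -/g0 Er Es arithM; congr (_ + _ * _ + _).
  rewrite /df /dg !mulr_sumr -big_split; apply: eq_bigr => l _ /=.
  by rewrite mderivM rmorphD !rmorphM /= -/f0 -/g0; ring.
Qed.

Lemma mmap_chain (c : 'I_n -> {poly B}) f :
  (mmap (polyC \o i) c f)^`() =
    \sum_l mmap (polyC \o i) c f^`M(l) * (c l)^`().
Proof.
elim/mpoly_ring_ind: f => [a|k|f g IHf IHg|f g IHf IHg].
- rewrite mmapC /= derivC big1 // => l _.
  by rewrite mderivC rmorph0 mul0r.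
- rewrite !mmapX !mmap1U (bigD1 k) //= big1 ?addr0.
    rewrite mderivX mnm1E eqxx scale1r.
    have -> : (U_(k) - U_(k))%MM = 0%MM :> 'X_{1..n}.
      by apply/mnmP => j; rewrite mnmBE subnn mnm0E.
    by rewrite mpolyX0 rmorph1 mul1r.
  move=> l lk; rewrite mderivX mnm1E eq_sym (negPf lk) scale0r rmorph0.
  by rewrite mul0r.
- rewrite rmorphD derivD IHf IHg -big_split; apply: eq_bigr => l _ /=.
  by rewrite mderivD rmorphD mulrDl.
- rewrite rmorphM derivM /= IHf IHg mulr_suml mulr_sumr -big_split.
  by apply: eq_bigr => l _ /=; rewrite mderivM rmorphD !rmorphM /=; ring.
Qed.

Lemma mmap_scale (d : nat) (c : B) (a : 'I_n -> B) f : f \is d.-homog ->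
  mmap i (fun l => c * a l) f = c ^+ d * mmap i a f.
Proof.
move=> /dhomogP fd; rewrite /mmap mulr_sumr big_seq [RHS]big_seq.
apply: eq_bigr => m /fd md; rewrite mulrCA -[d](md : mdeg m = d); congr (_ * _).
rewrite /mmap1 mdegE (eq_bigr (fun l => c ^+ m l * a l ^+ m l)).
  by rewrite big_split prodrXr.
by move=> l _; rewrite exprMn.
Qed.

End Taylor.

(* [F] in [B[u][v]] has weight at most [d] for [u] of weight 1 and [v] of weight
   -1, and [c] is the coefficient of [u ^ d]; no other monomial has weight [d]. *)
Definition weighted (B : comNzRingType) (d : nat) (c : B) (F : {poly {poly B}}) :=
  forall e, (size (F`_e)%R <= (d + e).+1)%N /\
            (F`_e)`_(d + e) = if e == 0%N then c else 0.

Section Weighted.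
Variables (B : comNzRingType).
Implicit Types (F : {poly {poly B}}).

Lemma coefM_top (p q : {poly B}) a b :
  (size p <= a.+1)%N -> (size q <= b.+1)%N -> (p * q)`_(a + b) = p`_a * q`_b.
Proof.
move=> pa qb; have a_lt : (a < (a + b).+1)%N by rewrite ltnS leq_addr.
rewrite coefM (bigD1 (Ordinal a_lt)) //= addKn big1 ?addr0 // => k ka.
have [ak|ka'] := ltnP a k.
  by rewrite [p`_k]nth_default ?mul0r //; exact: leq_trans ak.
rewrite [q`__]nth_default ?mulr0 //; apply: leq_trans qb _.
have : k != a :> nat by apply: contra ka => /eqP E; apply/eqP/val_inj.
by move: ka'; lia.
Qed.

Lemma weighted0 d : weighted d 0 (0 : {poly {poly B}}).
Proof. by move=> e; rewrite !coef0 size_poly0; case: ifP. Qed.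

Lemma weightedC c : weighted 0 c (c%:P%:P : {poly {poly B}}).
Proof.
move=> e; rewrite coefC; case: eqP => [->|_]; last by rewrite size_poly0 coef0.
by rewrite size_polyC coefC; split => //; case: (c != 0).
Qed.

Lemma weightedD d c c' F F' :
  weighted d c F -> weighted d c' F' -> weighted d (c + c') (F + F').
Proof.
move=> WF WF' e; have [s t] := WF e; have [s' t'] := WF' e; split.
  by rewrite coefD (leq_trans (size_polyD _ _)) // geq_max s s'.
by rewrite !coefD t t'; case: ifP => _ //; rewrite addr0.
Qed.

Lemma weightedM d d' c c' F F' :
  weighted d c F -> weighted d' c' F' -> weighted (d + d') (c * c') (F * F').
Proof.
move=> WF WF' e.
have E (k : 'I_e.+1) : (d + d' + e = (d + k) + (d' + (e - k)))%N.
  by have := ltn_ord k; lia.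
rewrite coefM; split.
  apply: (leq_trans (size_sum _ _ _)); apply/bigmax_leqP => k _.
  apply: (leq_trans (size_polyMleq _ _)); rewrite (E k).
  by have [s _] := WF k; have [s' _] := WF' (e - k)%N; move: s s'; lia.
rewrite coef_sum (eq_bigr (fun k : 'I_e.+1 =>
   (if k == 0%N :> nat then c else 0) * (if (e - k == 0)%N then c' else 0))).
  rewrite big_ord_recl subn0 [X in _ + X]big1 ?addr0 /=.
    by case: ifP => _ //; rewrite mulr0.
  by move=> k _; rewrite mul0r.
move=> k _; rewrite (E k); have [s t] := WF k; have [s' t'] := WF' (e - k)%N.
by rewrite coefM_top // t t'.
Qed.

Lemma weightedX d c F k : weighted d c F -> weighted (d * k) (c ^+ k) (F ^+ k).
Proof.
move=> WF; elim: k => [|k IH]; first by rewrite muln0 !expr0; exact: (weightedC 1).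
by rewrite mulnS !exprS; exact: weightedM.
Qed.

Lemma weighted_mmap (A : comNzRingType) (n : nat) (i : {rmorphism A -> B})
    (d : nat) (c : 'I_n -> {poly {poly B}}) (x : 'I_n -> B) f :
  f \is d.-homog -> (forall l, weighted 1 (x l) (c l)) ->
  weighted d (mmap i x f) (mmap (polyC \o (polyC \o i)) c f).
Proof.
move=> /dhomogP fd cx; rewrite /mmap big_seq [X in weighted _ _ X]big_seq.
elim/big_ind2: _ => [|? ? ? ? ? ?|m /fd md]; [exact: weighted0|exact: weightedD|].
rewrite -[d](md : mdeg m = d) -[mdeg m]add0n; apply: weightedM; first exact: weightedC.
rewrite mdegE /mmap1.
elim/big_ind3: _ => [|? ? ? ? ? ? ? ?|l _]; [exact: (weightedC 1)|exact: weightedM|].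
by have := weightedX (m l) (cx l); rewrite mul1n.
Qed.

End Weighted.

Definition line_pt (B : comNzRingType) (n : nat) (a x : 'I_n -> B) :
  'I_n -> {poly B} := fun l => (a l)%:P + (x l)%:P * 'X.

(** The top coefficient along a line is the value at its point at infinity. The count of weights is
    applied to the line as a curve that is constant in the outer variable. *)
Lemma mmap_line_top (A B : comNzRingType) (n d : nat) (i : {rmorphism A -> B})
    (a x : 'I_n -> B) (f : {mpoly A[n]}) : f \is d.-homog ->
  (size (mmap (polyC \o i) (line_pt a x) f) <= d.+1)%N /\
  (mmap (polyC \o i) (line_pt a x) f)`_d = mmap i x f.
Proof.
move=> fd; set g := line_pt a x.
have W := @weighted_mmap B A n i d (fun l => (g l)%:P) x f fd.
have E : mmap (polyC \o (polyC \o i)) (fun l => (g l)%:P) f =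
    (mmap (polyC \o i) g f)%:P by rewrite (mmap_comp _ _ (@polyC {poly B})).
have [|] := W _ 0%N; last by rewrite E coefC addn0.
move=> l e; rewrite coefC; case: eqP => [->|_]; last by rewrite size_poly0 coef0.
rewrite addn0; split; last by rewrite coefD coefC coefMX coefC add0r.
apply: leq_trans (size_polyD _ _) _; rewrite geq_max size_polyC.
rewrite (leq_trans (leq_b1 _)) //=.
apply: leq_trans (size_polyMleq _ _) _; rewrite size_polyX size_polyC addn2 /=.
by case: (_ != 0).
Qed.

(** * Common zeros of at most n forms in n + 1 variables *)

Definition gen_ideal (A : comNzRingType) (I : finType) (f : I -> A) : set A :=
  [set p | exists h : I -> A, p = \sum_i h i * f i].

Lemma gen_ideal_set (A : comNzRingType) (I : finType) (f : I -> A) :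
  ideal_set (gen_ideal f).
Proof.
split.
- by exists (fun=> 0); rewrite big1 // => i _; rewrite mul0r.
- move=> _ _ [h ->] [h' ->]; exists (fun i => h i + h' i).
  by rewrite -big_split; apply: eq_bigr => i _; rewrite mulrDl.
- move=> c _ [h ->]; exists (fun i => c * h i).
  by rewrite mulr_sumr; apply: eq_bigr => i _; rewrite mulrA.
Qed.

Lemma gen_ideal_gen (A : comNzRingType) (I : finType) (f : I -> A) i :
  gen_ideal f (f i).
Proof.
exists (fun j => (j == i)%:R); rewrite (bigD1 i) //= eqxx mul1r big1 ?addr0 //.
by move=> j /negPf ->; rewrite mul0r.
Qed.

Lemma X2_ideal (L : fieldType) : ideal_set [set p : {poly L} | 'X^2 %| p].
Proof.
by split; [exact: dvdp0|move=> a b; exact: dvdp_add|move=> c a; exact: dvdp_mull].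
Qed.

Lemma pihomogM (A : comNzRingType) (n d e : nat) (h f : {mpoly A[n]}) :
  f \is e.-homog -> pihomog mdeg d (h * f) =
    (if (e <= d)%N then pihomog mdeg (d - e) h else 0) * f.
Proof.
move=> fe; rewrite [h]mpolyE mulr_suml !linear_sum /=.
have -> : (if (e <= d)%N then \sum_(m <- msupp h) pihomog mdeg (d - e) (h@_m *: 'X_[m])
   else 0) = \sum_(m <- msupp h) (if (e <= d)%N then pihomog mdeg (d - e) (h@_m *: 'X_[m])
   else 0) by case: ifP => // _; rewrite big1.
rewrite mulr_suml; apply: eq_bigr => m _.
rewrite -scalerAl linearZ /=.
have homXf : 'X_[m] * f \is (mdeg m + e).-homog.
  by apply: dhomogM => //; rewrite dhomogX.
have [E|ne] := eqVneq (mdeg m + e)%N d.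
  rewrite pihomog_dE -?E // leq_addl addnK linearZ /= pihomogX eqxx.
  by rewrite scalerAl.
rewrite (pihomog_ne0 ne homXf) scaler0; case: leqP => ed; last by rewrite mul0r.
rewrite linearZ /= pihomogX ifN ?scaler0 ?mul0r //.
by apply: contra ne => /eqP ->; rewrite subnK.
Qed.

(** The determinant trick: the adjugate turns [D *m b = 0] into the vanishing of [\det D] times each
    entry of [b], and one entry is 1. *)
Lemma char_poly_eigen (S : comNzRingType) (s : nat) (C : 'M[S]_s)
    (x : S) (b : 'cV[S]_s) k :
  C *m b = x *: b -> b k 0 = 1 -> (char_poly C).[x] = 0.
Proof.
move=> Cb bk; rewrite /char_poly -horner_evalE -det_map_mx.
have -> : map_mx (horner_eval x) (char_poly_mx C) = x%:M - C.
  apply/matrixP => i j; rewrite !mxE horner_evalE hornerD hornerN hornerC.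
  by rewrite hornerMn hornerX.
set D := x%:M - C.
have Db : D *m b = 0 by rewrite mulmxBl mul_scalar_mx Cb subrr.
have : (\adj D *m D) *m b = 0 by rewrite -mulmxA Db mulmx0.
by rewrite mul_adj_mx mul_scalar_mx => /matrixP/(_ k 0); rewrite !mxE bk mulr1.
Qed.

Section ProjectiveDimension.
Variables (K : closedFieldType) (n r : nat).
Variables (f : 'I_r -> {mpoly K[n.+1]}) (e : 'I_r -> nat).
Hypotheses (K0 : [pchar K] =i pred0) (rn : (r <= n)%N).
Hypothesis f_homog : forall i, (0 < e i)%N /\ f i \is (e i).-homog.
Hypothesis f_zero : forall c : 'I_n.+1 -> K, (forall i, (f i).@[c] = 0) ->
  forall l, c l = 0.

Let S := {mpoly K[n.+1]}.
Let ev : {mpoly K[r]} -> S := mmap (@mpolyC n.+1 K) f.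
HB.instance Definition _ := GRing.RMorphism.on ev.

Let evX i : ev 'X_i = f i. Proof. by rewrite /ev mmapX mmap1U. Qed.

Lemma power_in_ideal : exists M, (0 < M)%N /\ forall l, gen_ideal f ('X_l ^+ M).
Proof.
have [|k kP] := @choice _ _ (fun l k => gen_ideal f ('X_l ^+ k)).
  move=> l; apply: nullstellensatz; first exact: gen_ideal_set.
  move=> c fc; rewrite mevalXU; apply: f_zero => i.
  by apply: fc; exact: gen_ideal_gen.
exists (\sum_l k l).+1; split=> // l.
have [_ _ fM] := gen_ideal_set f.
have kl : (k l <= (\sum_l k l).+1)%N by rewrite (bigD1 l) //= -addnS leq_addr.
by rewrite -(subnK kl) exprD; apply: fM.
Qed.

(** Only the homogeneous part of the right degree is kept in each coefficient. As the [f i] have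
    positive degree, the coefficients have smaller degree than [m], which drives the induction for
    finiteness. *)
Lemma monomial_reduction : exists D, (0 < D)%N /\
  forall m : 'X_{1..n.+1}, (D <= mdeg m)%N -> exists g : 'I_r -> S,
    'X_[m] = \sum_i g i * f i /\
    forall i, {in msupp (g i), forall m', (mdeg m' < mdeg m)%N}.
Proof.
have [M [M0 MP]] := power_in_ideal.
(* In degree at least [n.+1 * M] some exponent is at least [M], by the pigeonhole principle. *)
exists (n.+1 * M)%N; split; first by rewrite muln_gt0.
move=> m Dm.
have [l Ml] : exists l, (M <= m l)%N.
  apply: contrapT => none; move: Dm; rewrite leqNgt => /negP; apply.
  rewrite mdegE; have lt l : (m l <= M.-1)%N.
    by rewrite -ltnS prednK // ltnNge; apply/negP => ?; apply: none; exists l.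
  apply: (@leq_ltn_trans (\sum_(l < n.+1) M.-1)%N).
    by apply: leq_sum => l _; exact: lt.
  by rewrite sum_nat_const card_ord ltn_pmul2l // prednK.
have [_ _ fM] := gen_ideal_set f.
have [h E] : gen_ideal f 'X_[m].
  have le : (U_(l) *+ M <= m)%MM.
    apply/mnm_lepP => j; rewrite mulmnE mnm1E.
    by case: eqP => [<-|]; rewrite ?mul1n.
  by rewrite -(submK le) mpolyXD -mpolyXn; apply: fM.
exists (fun i => if (e i <= mdeg m)%N then pihomog mdeg (mdeg m - e i) (h i) else 0).
split.
  rewrite -[LHS](pihomog_dE (mf := mdeg) (d := mdeg m)) ?dhomogX //.
  rewrite E linear_sum; apply: eq_bigr => i _ /=.
  exact: pihomogM (f_homog i).2.
move=> i m'; case: (leqP (e i) (mdeg m)) => [le|_]; last first.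
  by rewrite mcoeff_msupp => /eqP []; exact: mcoeff0.
have /dhomogP hom := pihomogP mdeg (mdeg m - e i) (h i).
move=> /hom E'; rewrite [mdeg m'](E' : _ = _).
by have [e0 _] := f_homog i; rewrite ltn_subrL e0 (leq_trans e0).
Qed.

Lemma finite_module : exists D, (0 < D)%N /\ forall p : S,
  exists c : 'X_{1..n.+1 < D} -> {mpoly K[r]}, p = \sum_b ev (c b) * 'X_[b].
Proof.
have [D [D0 red]] := monomial_reduction; exists D; split=> //.
pose sp (p : S) := exists c : 'X_{1..n.+1 < D} -> {mpoly K[r]},
  p = \sum_b ev (c b) * 'X_[b].
have sp0 : sp 0.
  by exists (fun=> 0); rewrite big1 // => b _; rewrite rmorph0 mul0r.
have spD p q : sp p -> sp q -> sp (p + q).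
  move=> [c ->] [c' ->]; exists (fun b => c b + c' b).
  by rewrite -big_split; apply: eq_bigr => b _; rewrite rmorphD mulrDl.
have spM a p : sp p -> sp (ev a * p).
  move=> [c ->]; exists (fun b => a * c b).
  by rewrite mulr_sumr; apply: eq_bigr => b _; rewrite rmorphM mulrA.
have sp_sum (p : S) : {in msupp p, forall m, sp 'X_[m]} -> sp p.
  move=> pm; rewrite [p]mpolyE big_seq.
  elim/big_ind: _ => [//|//|m mp]; rewrite -mul_mpolyC.
  have -> : (p@_m)%:MP = ev (p@_m)%:MP by rewrite /ev mmapC.
  by apply: spM; exact: pm.
have spX k : forall m : 'X_{1..n.+1}, (mdeg m < k)%N -> sp 'X_[m].
  elim: k => // k IH m; rewrite ltnS => mk.
  have [mD|Dm] := ltnP (mdeg m) D.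
    exists (fun b => (b == BMultinom mD)%:R).
    rewrite (bigD1 (BMultinom mD)) //= eqxx rmorph1 mul1r big1 ?addr0 //.
    by move=> b /negPf ->; rewrite rmorph0 mul0r.
  have [g [-> gm]] := red _ Dm.
  elim/big_ind: _ => // i _; rewrite mulrC -evX; apply: spM; apply: sp_sum.
  by move=> m' /gm lt; apply: IH; exact: leq_trans lt mk.
by move=> p; apply: sp_sum => m _; exact: (spX (mdeg m).+1).
Qed.

Lemma variable_integral l : exists2 p : {poly {mpoly K[r]}},
  p \is monic & horner_map ev 'X_l p = 0.
Proof.
have [D [D0 fin]] := finite_module.
have [c cP] := @choice _ _ (fun (b : 'X_{1..n.+1 < D})
   (c : 'X_{1..n.+1 < D} -> {mpoly K[r]}) =>
   'X_l * 'X_[b] = \sum_b' ev (c b') * 'X_[b'] :> S) (fun b => fin _).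
(* The matrix of multiplication by ['X_l] on the spanning monomials; their vector is an eigenvector,
   with entry 1 at the monomial of degree 0. *)
pose C := \matrix_(i < #|{: 'X_{1..n.+1 < D}}|, j < #|{: 'X_{1..n.+1 < D}}|)
   c (enum_val i) (enum_val j).
exists (char_poly C); first exact: char_poly_monic.
have z0 : (mdeg (0%MM : 'X_{1..n.+1}) < D)%N by rewrite mdeg0.
rewrite horner_mapE map_char_poly.
pose b : 'cV[S]_#|{: 'X_{1..n.+1 < D}}| := \col_i 'X_[(enum_val i : 'X_{1..n.+1 < D})].
apply: (@char_poly_eigen _ _ _ _ b (enum_rank (BMultinom z0))).
  apply/matrixP => i j; rewrite !mxE cP [RHS](reindex_onto enum_val enum_rank) /=.
    apply: eq_big => [k|k _]; first by rewrite enum_valK eqxx.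
    by rewrite !mxE.
  by move=> b' _; rewrite enum_rankK.
by rewrite mxE enum_rankK /= mpolyX0.
Qed.

Let L := {fraction S}.
Let phi : {rmorphism {mpoly K[r]} -> L} := (@tofrac S \o ev)%FUN.
Let iota : {rmorphism K -> L} := (@tofrac S \o @mpolyC n.+1 K)%FUN.

(** [v] is a derivation that kills the [f i], hence all polynomials in them. The variables are
    integral over these, so they are separable algebraic and are killed as well. *)
Lemma derivation_zero (v : 'I_n.+1 -> L) :
  (forall i, \sum_l tofrac (f i)^`M(l) * v l = 0) -> forall l, v l = 0.
Proof.
move=> fv l.
pose x j : L := tofrac ('X_j : S).
(* Modulo ['X^2], [t] is [p + 'X * D p], where [D] is the derivation with [D 'X_l = v l]. *)
pose t := mmap (polyC \o iota) (line_pt x v).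
have t1 p : 'X^2 %| t p - ((tofrac p)%:P + 'X * (\sum_l tofrac p^`M(l) * v l)%:P).
  have [q Eq] := mmap_taylor (polyC \o iota) (fun j => (x j)%:P)
    (fun j => (v j)%:P) 'X p.
  have ext q' : mmap (polyC \o iota) (fun j => (x j)%:P) q' = (tofrac q')%:P.
    have := @mmap_unique _ _ _ (mmap (polyC \o iota) (fun j => (x j)%:P))
      (polyC \o @tofrac S) _ _ q'; apply => [a|j] /=; first by rewrite mmapC.
    by rewrite mmapX mmap1U.
  have -> : t p = mmap (polyC \o iota) (fun j => (x j)%:P + 'X * (v j)%:P) p.
    by apply: mmap_congr => // j; rewrite /line_pt mulrC.
  rewrite Eq ext (eq_bigr (fun l => (tofrac p^`M(l) * v l)%:P)); last first.
    by move=> j _; rewrite ext polyCM.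
  by rewrite -raddf_sum addrAC subrr add0r dvdp_mulr.
have t2 a : 'X^2 %| t (ev a) - (phi a)%:P.
  apply: (@rmorph_congr _ _ _ _ (t \o ev) (polyC \o phi) (@X2_ideal L)) => [c|i].
    by rewrite /= /phi /ev /= mmapC /t mmapC subrr; exact: dvdp0.
  rewrite /= /phi /= evX; have := t1 (f i).
  by rewrite fv polyC0 mulr0 addr0.
have [p pm p0] := variable_integral l.
have L0 : [pchar L] =i pred0 by move=> q; rewrite (fmorph_pchar iota).
have hx q : horner_map phi (x l) q = tofrac (horner_map ev 'X_l q).
  pose g : {rmorphism {poly {mpoly K[r]}} -> L} := (@tofrac S \o horner_map ev 'X_l)%FUN.
  rewrite -[RHS]/(g q); apply: poly_unique => [a|].
    by rewrite /g /= !horner_mapC.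
  by rewrite /g /= !horner_mapX.
have [tr|[F [F0 lF Fmin _]]] := transcendental_or_minimal phi (x l).
  have : map_poly phi p = 0 by apply: tr; rewrite hx p0 tofrac0.
  move=> /(congr1 (fun q : {poly L} => q`_(size p).-1)); rewrite coef_map coef0.
  by move/monicP: pm => /=; rewrite lead_coefE => -> /eqP; rewrite rmorph1 oner_eq0.
have sep := minimal_relation_separable L0 F0 lF Fmin.
have evF : horner_map ev 'X_l F = 0.
  by move: F0; rewrite hx => /eqP; rewrite tofrac_eq0 => /eqP.
have tF : t (horner_map ev 'X_l F) = horner_map (t \o ev) (t 'X_l) F.
  pose g : {rmorphism {poly {mpoly K[r]}} -> {poly L}} := (t \o horner_map ev 'X_l)%FUN.
  rewrite -[LHS]/(g F); apply: poly_unique => [a|].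
    by rewrite /g /= !horner_mapC.
  by rewrite /g /= !horner_mapX.
have dF : 'X^2 %| horner_map (polyC \o phi) (t 'X_l) F.
  have : 'X^2 %| horner_map (t \o ev) (t 'X_l) F - horner_map (polyC \o phi) (t 'X_l) F.
    rewrite !horner_mapE -hornerN -hornerD horner_coef.
    elim/big_ind: _ => [|? ? *|i _]; [exact: dvdp0|exact: dvdp_add|].
    by apply: dvdp_mulr; rewrite coefD coefN !coef_map; exact: t2.
  by rewrite -tF evF /t mmap0 sub0r dvdpNr.
move: dF; rewrite /t mmapX mmap1U /line_pt => dF.
exact: first_order_root F0 sep dF.
Qed.

(** The Jacobian matrix has [n.+1] rows and at most [n] columns, so a nonzero derivation kills all
    the [f i]. *)
Lemma projective_dimension_false : False.
Proof.
pose J : 'M[L]_(n.+1, r) := \matrix_(l, i) tofrac (f i)^`M(l).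
have : kermx J != 0.
  rewrite -mxrank_eq0 mxrank_ker -lt0n subn_gt0.
  by rewrite (leq_ltn_trans (rank_leq_col _)).
move=> /rowV0Pn [v /sub_kermxP vJ v0].
move: v0; apply/negP/negPn/eqP/rowP => l; rewrite mxE.
apply: (@derivation_zero (v 0)) => i.
have /matrixP/(_ 0 i) := vJ; rewrite !mxE => E; rewrite -[RHS]E.
by apply: eq_bigr => j _; rewrite mxE mulrC.
Qed.

End ProjectiveDimension.

Theorem projective_dimension (K : closedFieldType) (n : nat)
    (s : seq {mpoly K[n.+1]}) : [pchar K] =i pred0 -> (size s <= n)%N ->
  (forall f, f \in s -> exists2 e, (0 < e)%N & f \is e.-homog) ->
  exists2 c : 'I_n.+1 -> K, (exists l, c l != 0) &
    forall f, f \in s -> f.@[c] = 0.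
Proof.
move=> K0 sn s_homog; apply: contrapT => none.
have [|e eP] := @choice _ _ (fun (i : 'I_(size s)) e =>
    (0 < e)%N /\ s`_i \is e.-homog).
  by move=> i; have [e] := s_homog _ (mem_nth 0 (ltn_ord i)); exists e.
apply: (projective_dimension_false K0 sn eP) => c sc l; apply/eqP.
apply: contrapT => /negP cl; apply: none; exists c; first by exists l.
by move=> g /(nthP 0) [i lt <-]; exact: (sc (Ordinal lt)).
Qed.

(** * Cones and general pairs of points *)

Lemma linear_predicate_vspace (K : fieldType) (V : vectType K) (Q : V -> Prop) :
  Q 0 -> (forall a u v, Q u -> Q v -> Q (a *: u + v)) ->
  exists U : {vspace V}, forall v, v \in U <-> Q v.
Proof.
move=> Q0 Qlin.
pose ok k := `[< exists U : {vspace V}, \dim U = k /\ forall v, v \in U -> Q v >].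
have ex : exists k, ok k.
  exists 0%N; apply/asboolP; exists 0%VS; rewrite dimv0; split=> // v.
  by rewrite memv0 => /eqP ->.
have ub k : ok k -> (k <= \dim {:V})%N.
  by move=> /asboolP [U [<- _]]; exact/dimvS/subvf.
case: (ex_maxnP ex ub) => k /asboolP [U [Uk UQ]] kmax.
exists U => v; split; first exact: UQ.
move=> Qv; apply: contrapT => /negP vU.
have : ok k.+1.
  apply/asboolP; exists (<[v]> + U)%VS; split.
    rewrite dimv_disjoint_sum ?Uk; last first.
      apply/eqP; rewrite -subv0; apply/subvP => w /memv_capP [/vlineP [a ->] aU].
      have [->|a0] := eqVneq a 0; first by rewrite scale0r mem0v.
      by case/negP: vU; rewrite -(scalerK a0 v) memvZ.
    rewrite dim_vline; case: eqP => // v0.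
    by case/negP: vU; rewrite v0 mem0v.
  move=> w /memv_addP [_ /vlineP [a ->] [w' Uw' ->]].
  by apply: Qlin => //; exact: UQ.
by move/kmax; rewrite ltnn.
Qed.

Lemma poly_zeroP (K : closedFieldType) (p : {poly K}) :
  (forall t, p.[t] = 0) -> p = 0.
Proof.
move=> pt; apply/eqP; apply: contrapT => /negP /closed_nonrootP [t].
by rewrite /root pt eqxx.
Qed.

Lemma pihomog_coef (K : comNzRingType) (n : nat) (u : 'I_n -> K) f e :
  (mmap polyC (line_pt (fun=> 0) u) f)`_e = (pihomog mdeg e f).@[u].
Proof.
have fk : (msize f <= (msize f + e).+1)%N by rewrite -addnS leq_addr.
rewrite {1}(pihomog_partitionE fk) (rmorph_sum (mmap polyC _)) coef_sum /=.
have E k : mmap polyC (line_pt (fun=> 0) u) (pihomog mdeg k f) =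
    ((pihomog mdeg k f).@[u])%:P * 'X^k.
  have -> : mmap polyC (line_pt (fun=> 0) u) (pihomog mdeg k f) =
      mmap polyC (fun l => 'X * (u l)%:P) (pihomog mdeg k f).
    by apply: mmap_congr => // l; rewrite /line_pt polyC0 add0r mulrC.
  rewrite (mmap_scale _ _ _ (pihomogP mdeg k f)) mulrC; congr (_ * _).
  rewrite /meval (mmap_comp idfun u (@polyC K)).
  exact: mmap_congr.
have elt : (e < (msize f + e).+1)%N by rewrite ltnS leq_addl.
rewrite (bigD1 (Ordinal elt)) //= E coefMXn ltnn subnn coefC eqxx big1 ?addr0 //.
move=> k ke; rewrite E coefMXn coefC; case: ltnP => // le.
rewrite subn_eq0 ifN //; apply: contra ke => ek; apply/eqP/val_inj/eqP.
by rewrite eqn_leq le.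
Qed.

Section Cone.
Variables (K : closedFieldType) (N : nat).
Local Notation PN := (proj_space K N).
Local Notation rV := 'rV[K]_N.+1.
Implicit Types (X : set PN) (f g : {mpoly K[N.+1]}).

Lemma point_of (u : rV) : u != 0 -> exists p : PN, (p : {vspace _}) = <[u]>%VS.
Proof.
move=> u0; have d1 : \dim <[u]> == 1%N by rewrite dim_vline u0.
by exists (ProjPoint d1).
Qed.

Lemma point_eq (p q : PN) : (p : {vspace _}) = (q : {vspace _}) -> p = q.
Proof. by move/val_inj. Qed.

Lemma point_line (p : PN) (u : rV) : u \in (p : {vspace _}) -> u != 0 ->
  (p : {vspace _}) = <[u]>%VS.
Proof.
case: p => V /= /eqP dV uV u0; apply/eqP; rewrite eq_sym eqEdim dV dim_vline u0.
by rewrite andbT -memvE.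
Qed.

Lemma point_vec (p : PN) : exists2 u : rV, u \in (p : {vspace _}) & u != 0.
Proof.
exists (vpick p); first exact: memv_pick.
rewrite vpick0; case: p => V /= /eqP dV; apply/eqP => V0.
by move: dV; rewrite V0 dimv0.
Qed.

Definition cone (X : set PN) (u : rV) : Prop :=
  exists2 p : PN, X p & u \in (p : {vspace _}).

Lemma cone_point X (p : PN) (u : rV) :
  cone X u -> u != 0 -> u \in (p : {vspace _}) -> X p.
Proof.
move=> [q Xq uq] u0 up; rewrite (_ : p = q) //; apply: point_eq.
by rewrite (point_line up u0) (point_line uq u0).
Qed.

Lemma cone_scale X a (u : rV) : cone X u -> cone X (a *: u).
Proof. by move=> [p Xp up]; exists p => //; rewrite memvZ. Qed.

Lemma vanishing_idealP X f :
  vanishing_ideal X f <-> forall u, cone X u -> f.@[u 0] = 0.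
Proof.
split=> [If u [p Xp up]|If p Xp u up]; first exact: If up.
by apply: If; exists p.
Qed.

Lemma vanishing_homog X f e :
  vanishing_ideal X f -> vanishing_ideal X (pihomog mdeg e f).
Proof.
move=> /vanishing_idealP If; apply/vanishing_idealP => u Xu.
rewrite -pihomog_coef (_ : mmap _ _ f = 0) ?coef0 //; apply: poly_zeroP => t.
have -> : (mmap polyC (line_pt (fun=> 0) (u 0)) f).[t] = f.@[(t *: u) 0].
  rewrite -horner_evalE (mmap_comp polyC _ (horner_eval t)).
  apply: mmap_congr => [a|l]; first by rewrite /= horner_evalE hornerC.
  by rewrite /= horner_evalE /line_pt !hornerE mxE mulrC.
by apply: If; exact: cone_scale.
Qed.

Lemma meval_point_scale f e (u : rV) a : f \is e.-homog ->
  f.@[(a *: u) 0] = a ^+ e * f.@[u 0].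
Proof.
move=> fe; rewrite -(mmap_scale idfun a (u 0) fe).
by apply: mmap_congr => // l; rewrite mxE.
Qed.

(** Irreducibility concerns zero loci of homogeneous polynomials, so [f] and [g] are replaced by
    their homogeneous components. Along the line of a point these are the coefficients of a
    polynomial in one variable, and a product of such polynomials is zero only if a factor is. *)
Lemma vanishing_prime X f g : irreducible_set X ->
  vanishing_ideal X (f * g) -> vanishing_ideal X f \/ vanishing_ideal X g.
Proof.
move=> [_ Xirr] /vanishing_idealP Ifg.
pose Z (f : {mpoly K[N.+1]}) := zero_locus (K := K) (N := N)
  [set pihomog mdeg e f | e in setT].
have Zcl h : zariski_closed (Z h).
  by eexists; last reflexivity; move=> _ [e _ <-]; exists e; exact: pihomogP.
have hsc h t (u : rV) : (mmap polyC (line_pt (fun=> 0) (u 0)) h).[t] = h.@[(t *: u) 0].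
  rewrite -horner_evalE (mmap_comp polyC _ (horner_eval t)).
  apply: mmap_congr => [a|l]; first by rewrite /= horner_evalE hornerC.
  by rewrite /= horner_evalE /line_pt !hornerE mxE mulrC.
have Zp h (p : PN) (u : rV) : u \in (p : {vspace _}) -> u != 0 ->
    mmap polyC (line_pt (fun=> 0) (u 0)) h = 0 -> Z h p.
  move=> up u0 hu _ [e _ <-] w; rewrite (point_line up u0) => /vlineP [a ->].
  rewrite (meval_point_scale _ _ (pihomogP mdeg e h)).
  by rewrite -pihomog_coef hu coef0 mulr0.
have ZI h : X `<=` Z h -> vanishing_ideal X h.
  move=> XZ; apply/vanishing_idealP => u [p Xp up].
  rewrite [h](pihomog_partitionE (leqnn (msize h))) (rmorph_sum (meval _)) big1 // => e _ /=.
  by apply: (XZ p Xp) up; exists (nat_of_ord e).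
have [|XZ|XZ] := Xirr (Z f) (Z g) (Zcl f) (Zcl g); last 2 first.
- by left; exact: ZI.
- by right; exact: ZI.
move=> p Xp; have [u up u0] := point_vec p.
have : mmap polyC (line_pt (fun=> 0) (u 0)) (f * g) = 0.
  by apply: poly_zeroP => t; rewrite hsc; apply: Ifg; apply: cone_scale; exists p.
rewrite rmorphM => /eqP; rewrite mulf_eq0 => /orP [] /eqP h0.
  by left; apply: Zp h0.
by right; apply: Zp h0.
Qed.

End Cone.

Definition pair_pt (T : Type) (n : nat) (u v : 'I_n -> T) (k : 'I_(n + n)) : T :=
  match split k with inl i => u i | inr j => v j end.

Lemma pair_ptl (T : Type) (n : nat) (u v : 'I_n -> T) i :
  pair_pt u v (lshift n i) = u i.
Proof. by rewrite /pair_pt (unsplitK (inl i : 'I_n + 'I_n)). Qed.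

Lemma pair_ptr (T : Type) (n : nat) (u v : 'I_n -> T) i :
  pair_pt u v (rshift n i) = v i.
Proof. by rewrite /pair_pt (unsplitK (inr i : 'I_n + 'I_n)). Qed.

Lemma row_mx_pair (K : fieldType) (n : nat) (u v : 'rV[K]_n) (F : {mpoly K[n + n]}) :
  F.@[row_mx u v 0] = F.@[pair_pt (u 0) (v 0)].
Proof. by apply: meval_eq => k; rewrite mxE /pair_pt; case: split. Qed.

Section PairIdeal.
Variables (K : closedFieldType) (N : nat) (X : set (proj_space K N)).
Hypothesis X_irr : irreducible_set X.
Local Notation rV := 'rV[K]_N.+1.
Local Notation A := {mpoly K[N.+1 + N.+1]}.

Definition pair_ideal : set A :=
  [set F | forall u v, cone X u -> cone X v -> F.@[pair_pt (u 0) (v 0)] = 0].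

(** A product of irreducible varieties is irreducible. Suppose that [F] is not zero at [(u, v)], nor
    [F'] at [(u', v')]. For each [w] of the cone, [F] or [F'] vanishes on all of X when its second
    argument is [w]; so [F (u, w) * F' (u', w)] is zero for all [w], and one of the factors is. *)
Lemma pair_ideal_prime F F' :
  pair_ideal (F * F') -> pair_ideal F \/ pair_ideal F'.
Proof.
move=> FF'.
pose pl (u : rV) : A -> {mpoly K[N.+1]} := mmap (@mpolyC _ _)
  (pair_pt (fun i => (u 0 i)%:MP) (fun i => 'X_i)).
pose pr (v : rV) : A -> {mpoly K[N.+1]} := mmap (@mpolyC _ _)
  (pair_pt (fun i => 'X_i) (fun i => (v 0 i)%:MP)).
have plE H (u v : rV) : (pl u H).@[v 0] = H.@[pair_pt (u 0) (v 0)].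
  rewrite /meval (mmap_comp _ _ (meval (v 0))); apply: mmap_congr => [a|k] /=.
    by rewrite mevalC.
  by rewrite /pair_pt; case: split => i; rewrite ?mevalC ?mevalXU.
have prE H (u v : rV) : (pr v H).@[u 0] = H.@[pair_pt (u 0) (v 0)].
  rewrite /meval (mmap_comp _ _ (meval (u 0))); apply: mmap_congr => [a|k] /=.
    by rewrite mevalC.
  by rewrite /pair_pt; case: split => i; rewrite ?mevalC ?mevalXU.
apply: contrapT => /not_orP [nF nF'].
have bad H : ~ pair_ideal H -> exists u v, [/\ cone X u, cone X v &
    H.@[pair_pt (u 0) (v 0)] <> 0].
  move=> nH; apply: contrapT => none; apply: nH => u v Xu Xv.
  by apply: contrapT => ne; apply: none; exists u, v.
have [u [v [Xu Xv Fuv]]] := bad _ nF.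
have [u' [v' [Xu' Xv' Fuv']]] := bad _ nF'.
have [|I1|I1] := @vanishing_prime _ _ X (pl u F) (pl u' F') X_irr; last 2 first.
- by apply: Fuv; rewrite -plE; move/vanishing_idealP: I1; apply.
- by apply: Fuv'; rewrite -plE; move/vanishing_idealP: I1; apply.
apply/vanishing_idealP => w Xw; rewrite mevalM !plE.
have [|/vanishing_idealP I|/vanishing_idealP I] :=
    @vanishing_prime _ _ X (pr w F) (pr w F') X_irr.
- by apply/vanishing_idealP => x Xx; rewrite mevalM !prE -mevalM; exact: FF'.
- by rewrite -prE I // mul0r.
- by rewrite -[X in _ * X]prE I // mulr0.
Qed.

Let lw (m : 'X_{1..N.+1 + N.+1}) := (\sum_(i < N.+1) m (lshift N.+1 i))%N.
Let rw (m : 'X_{1..N.+1 + N.+1}) := (\sum_(i < N.+1) m (rshift N.+1 i))%N.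
(** Open sets of the product are defined by bihomogeneous polynomials, so a general polynomial is
    cut into bihomogeneous components. *)
Definition bicomp (a b : nat) (h : A) : A :=
  \sum_(m <- msupp h | (lw m == a) && (rw m == b)) h@_m *: 'X_[m].

Lemma bicomp_bihomog a b h : bihomogeneous (bicomp a b h).
Proof.
exists a, b => m; rewrite /bicomp => /msupp_sum_le /flatten_mapP [m'].
rewrite mem_filter => /andP [/andP [/eqP <- /eqP <-] _] /msuppZ_le.
by rewrite msuppX inE => /eqP ->.
Qed.

Lemma mmap1_pair (S : comNzRingType) (u v : 'I_N.+1 -> S) s t m :
  mmap1 (pair_pt (fun i => s * u i) (fun i => t * v i)) m =
  s ^+ lw m * t ^+ rw m * mmap1 (pair_pt u v) m.
Proof.
rewrite /mmap1 !big_split_ord /= /lw /rw.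
rewrite -!prodrXr [LHS](_ : _ =
  (\prod_i (s ^+ m (lshift N.+1 i) * u i ^+ m (lshift N.+1 i))) *
  (\prod_i (t ^+ m (rshift N.+1 i) * v i ^+ m (rshift N.+1 i)))).
  rewrite !big_split /= -!mulrA; congr (_ * _); rewrite mulrCA; congr (_ * _).
  by congr (_ * _); apply: eq_bigr => i _; rewrite ?pair_ptl ?pair_ptr.
by congr (_ * _); apply: eq_bigr => i _; rewrite ?pair_ptl ?pair_ptr exprMn.
Qed.

Lemma bicomp_coef (h : A) (u v : 'I_N.+1 -> K) a b :
  ((mmap (polyC \o polyC) (pair_pt (fun i => 'X%:P * (u i)%:P%:P)
      (fun i => 'X * (v i)%:P%:P)) h)`_b)`_a = (bicomp a b h).@[pair_pt u v].
Proof.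
rewrite /bicomp (rmorph_sum (meval _)) /mmap !coef_sum [RHS]big_mkcond /=.
apply: eq_bigr => m _.
rewrite mmap1_pair mevalZ /=.
have -> : mmap1 (pair_pt (fun i => (u i)%:P%:P) (fun i => (v i)%:P%:P)) m =
    ((mmap1 (pair_pt u v) m)%:P%:P : {poly {poly K}}).
  rewrite /mmap1 !rmorph_prod; apply: eq_bigr => k _.
  by rewrite /pair_pt; case: split => i; rewrite !rmorphXn.
have -> : ('X_[m] : A).@[pair_pt u v] = mmap1 (pair_pt u v) m.
  by rewrite /meval mmapX.
have -> : (h@_m)%:P%:P * ('X%:P ^+ lw m * 'X ^+ rw m * (mmap1 (pair_pt u v) m)%:P%:P) =
   ((h@_m * mmap1 (pair_pt u v) m)%:P * 'X ^+ lw m)%:P * 'X ^+ rw m :> {poly {poly K}}.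
  by rewrite !polyCM polyC_exp; ring.
rewrite coefMXn; case: ltnP => [lt|le].
  by rewrite coef0 [rw m == b]gtn_eqF ?andbF.
rewrite coefC subn_eq0; have [le'|lt] := leqP b (rw m); last first.
  by rewrite coef0 [rw m == b]ltn_eqF ?andbF.
have -> : rw m == b by rewrite eqn_leq le le'.
rewrite coefMXn coefC andbT; case: ltnP => [lt|le2].
  by rewrite gtn_eqF.
by rewrite subn_eq0 eqn_leq le2 /=; case: ifP.
Qed.

Lemma bicomp_scale a b h (u v : 'I_N.+1 -> K) s t :
  (bicomp a b h).@[pair_pt (fun i => s * u i) (fun i => t * v i)] =
  s ^+ a * t ^+ b * (bicomp a b h).@[pair_pt u v].
Proof.
rewrite /bicomp !(rmorph_sum (meval _)) mulr_sumr; apply: eq_bigr => m /andP [/eqP <- /eqP <-] /=.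
rewrite !mevalZ /meval !mmapX mmap1_pair; ring.
Qed.

(** [h] need not be bihomogeneous. The open set is where some component of [h] does not vanish;
    there, suitable multiples of the two vectors make [h] itself nonzero. *)
Lemma general_pairP (P : proj_space K N -> proj_space K N -> Prop) (h : A) :
  ~ pair_ideal h ->
  (forall (u v : rV) (p q : proj_space K N), X p -> X q ->
     u \in (p : {vspace _}) -> v \in (q : {vspace _}) -> u != 0 -> v != 0 ->
     h.@[pair_pt (u 0) (v 0)] <> 0 -> P p q) ->
  for_general_pair X P.
Proof.
move=> nh hP; pose S : set A := [set bicomp ab.1 ab.2 h | ab in setT].
exists [set xy | ~ (forall F, S F -> vanishes_at2 F xy.1 xy.2)].
pose big (u v : 'I_N.+1 -> K) := mmap (polyC \o polyC)
   (pair_pt (fun i => 'X%:P * (u i)%:P%:P) (fun i => 'X * (v i)%:P%:P)) h :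
   {poly {poly K}}.
have bigE (u v : rV) s t :
    (map_poly (horner_eval s) (big (u 0) (v 0))).[t] =
    h.@[pair_pt ((s *: u) 0) ((t *: v) 0)].
  rewrite -horner_mapE (mmap_comp _ _ (horner_map (horner_eval s) t)).
  apply: mmap_congr => [a|k].
    by rewrite /= horner_mapC /= /horner_eval hornerC.
  rewrite /= /pair_pt; case: split => i; rewrite rmorphM /= ?horner_mapX !horner_mapC.
    by rewrite /= /horner_eval hornerX hornerC mxE.
  by rewrite /= /horner_eval hornerC mxE.
split.
- by exists S => // _ [[a b] _ <-]; exact: bicomp_bihomog.
- have [u [v [Xu Xv huv]]] : exists u v, [/\ cone X u, cone X v &
      h.@[pair_pt (u 0) (v 0)] <> 0].
    apply: contrapT => none; apply: nh => u v Xu Xv.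
    by apply: contrapT => ne; apply: none; exists u, v.
  have [p Xp up] := Xu; have [q Xq vq] := Xv.
  exists (p, q); split=> //= vanish; apply: huv.
  rewrite -[u]scale1r -[v]scale1r -bigE (_ : big _ _ = 0) ?rmorph0 ?horner0 //.
  apply/polyP => b; rewrite coef0; apply/polyP => a; rewrite coef0 bicomp_coef.
  by rewrite -row_mx_pair; apply: vanish up vq; exists (a, b).
- move=> p q Xp Xq /= nvan.
  have [u up u0] := point_vec p; have [v vq v0] := point_vec q.
  have big0 : big (u 0) (v 0) != 0.
    apply/eqP => big0; apply: nvan => _ [[a b] _ <-] u' v' /= u'p v'q.
    move: u'p v'q; rewrite (point_line up u0) (point_line vq v0).
    move=> /vlineP [s ->] /vlineP [t ->].
    rewrite row_mx_pair.
    rewrite (meval_eq (v2 := pair_pt (fun i => s * u 0 i) (fun i => t * v 0 i))).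
      by rewrite bicomp_scale -bicomp_coef -/(big _ _) big0 !coef0 mulr0.
    by move=> k; rewrite /pair_pt; case: split => i; rewrite mxE.
  have [s s0 big1] : exists2 s, s != 0 &
      map_poly (horner_eval s) (big (u 0) (v 0)) != 0.
    (* The factor ['X] keeps [s] away from 0. *)
    have : lead_coef (big (u 0) (v 0)) * 'X != 0.
      by rewrite mulf_neq0 ?polyX_eq0 ?lead_coef_eq0.
    move=> /closed_nonrootP [s]; rewrite /root hornerMX mulf_eq0 negb_or.
    move=> /andP [ls s0]; exists s => //; apply: contraNneq ls => E.
    have := congr1 (fun q : {poly K} => q`_(size (big (u 0) (v 0))).-1) E.
    by rewrite coef_map coef0 -lead_coefE /= /horner_eval => ->.
  have : map_poly (horner_eval s) (big (u 0) (v 0)) * 'X != 0.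
    by rewrite mulf_neq0 ?polyX_eq0.
  move=> /closed_nonrootP [t]; rewrite /root hornerMX mulf_eq0 negb_or.
  move=> /andP [ht t0]; apply: (hP (s *: u) (t *: v)) => //; try exact: memvZ.
  - by rewrite scaler_eq0 negb_or s0.
  - by rewrite scaler_eq0 negb_or t0.
  - by apply/eqP; rewrite -bigE.
Qed.

End PairIdeal.

Section PairEmbeddings.
Variables (A : comNzRingType) (n : nat).

Definition pair_left : {mpoly A[n]} -> {mpoly A[n + n]} :=
  mmap (@mpolyC _ _) (fun l => 'X_(lshift _ l)).
HB.instance Definition _ := GRing.RMorphism.on pair_left.

Definition pair_right : {mpoly A[n]} -> {mpoly A[n + n]} :=
  mmap (@mpolyC _ _) (fun l => 'X_(rshift _ l)).
HB.instance Definition _ := GRing.RMorphism.on pair_right.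

Lemma mmap_pair_left (B : comNzRingType) (j : {rmorphism A -> B}) (u v : 'I_n -> B) f :
  mmap j (pair_pt u v) (pair_left f) = mmap j u f.
Proof.
rewrite (mmap_comp _ _ (mmap j (pair_pt u v))); apply: mmap_congr => [x|l] /=.
  by rewrite mmapC.
by rewrite mmapX mmap1U pair_ptl.
Qed.

Lemma mmap_pair_right (B : comNzRingType) (j : {rmorphism A -> B}) (u v : 'I_n -> B) f :
  mmap j (pair_pt u v) (pair_right f) = mmap j v f.
Proof.
rewrite (mmap_comp _ _ (mmap j (pair_pt u v))); apply: mmap_congr => [x|l] /=.
  by rewrite mmapC.
by rewrite mmapX mmap1U pair_ptr.
Qed.

Lemma meval_pair_left (u v : 'I_n -> A) f :
  (pair_left f).@[pair_pt u v] = f.@[u].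
Proof. exact: (mmap_pair_left idfun). Qed.

Lemma meval_pair_right (u v : 'I_n -> A) f :
  (pair_right f).@[pair_pt u v] = f.@[v].
Proof. exact: (mmap_pair_right idfun). Qed.

End PairEmbeddings.

(** * Chains of two lines *)

Section DefiningEquations.
Variables (K : closedFieldType) (N m : nat) (X : set (proj_space K N)).
Variables (G : 'I_m -> {mpoly K[N.+1]}) (d : 'I_m -> nat).
Hypotheses (X_irr : irreducible_set X) (X_def : set_theoretically_defined G X).
Hypothesis G_degree : forall i, G i != 0 /\ G i \is (d i).-homog.
Local Notation rV := 'rV[K]_N.+1.
Local Notation PN := (proj_space K N).

(** A nonzero constant among the equations would make X empty. *)
Lemma degree_gt0 i : (0 < d i)%N.
Proof.
have [Gi0 Gih] := G_degree i; rewrite lt0n; apply/eqP => d0.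
have [[p Xp] _] := X_irr; have [u up u0] := point_vec p.
have : (G i).@[u 0] = 0.
  by move: Xp; rewrite X_def => /(_ (G i)) Gip; apply: Gip up; exists i.
have sz : (msize (G i) <= 1)%N.
  rewrite msizeE; apply/bigmax_leqP_seq => mo mG _.
  by move/dhomogP: Gih => /(_ _ mG) E; rewrite ltnS -[mdeg mo]/(mdeg mo) (E : mdeg mo = _) d0.
rewrite (msize1_polyC sz) mevalC => c0.
by move: Gi0; rewrite (msize1_polyC sz) c0 mpolyC0 eqxx.
Qed.

Lemma coneP (u : rV) : cone X u <-> forall i, (G i).@[u 0] = 0.
Proof.
split=> [[p Xp up] i|Gu].
  by move: Xp; rewrite X_def => /(_ (G i)) Gip; apply: Gip up; exists i.
have [->|u0] := eqVneq u 0.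
  by have [[p Xp] _] := X_irr; exists p => //; rewrite mem0v.
have [p pu] := point_of u0; exists p; last by rewrite pu memv_line.
rewrite X_def => _ [i _ <-] w; rewrite pu => /vlineP [a ->].
by rewrite (meval_point_scale _ _ (G_degree i).2) Gu mulr0.
Qed.

Definition on_line (i : 'I_m) (u z : rV) : {poly K} :=
  mmap polyC (line_pt (u 0) (z 0)) (G i).

Lemma on_line_horner i u z t : (on_line i u z).[t] = (G i).@[(u + t *: z) 0].
Proof.
rewrite -horner_evalE (mmap_comp polyC _ (horner_eval t)).
apply: mmap_congr => [a|l]; first by rewrite /= horner_evalE hornerC.
by rewrite /= horner_evalE /line_pt !hornerE !mxE mulrC.
Qed.

Lemma line_in_cone u z : (forall i, on_line i u z = 0) ->
  forall a b, cone X (a *: u + b *: z).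
Proof.
move=> uz a b; apply/coneP => i.
have [->|a0] := eqVneq a 0.
  rewrite scale0r add0r (meval_point_scale _ _ (G_degree i).2).
  have [_] := mmap_line_top idfun (u 0) (z 0) (G_degree i).2.
  rewrite (_ : mmap _ _ _ = on_line i u z); last exact: mmap_congr.
  by rewrite uz coef0 /meval => <-; rewrite mulr0.
have -> : a *: u + b *: z = a *: (u + (a^-1 * b) *: z).
  by rewrite scalerDr scalerA mulVKf.
by rewrite (meval_point_scale _ _ (G_degree i).2) -on_line_horner uz horner0 mulr0.
Qed.

Lemma cone_line u z : (forall a b, cone X (a *: u + b *: z)) ->
  forall i, on_line i u z = 0.
Proof.
move=> uz i; apply: poly_zeroP => t; rewrite on_line_horner.
by have := uz 1 t; rewrite scale1r => /coneP.
Qed.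

(** If X contained the line through any two of its points, it would be a linear subspace, hence the
    whole space or part of a hyperplane. *)
Lemma nonlinear_pair : nondegenerate_variety X -> X <> setT ->
  exists2 t : {mpoly K[N.+1 + N.+1]}, ~ pair_ideal X t &
    forall u v : rV, t.@[pair_pt (u 0) (v 0)] <> 0 -> exists i, on_line i u v <> 0.
Proof.
move=> X_nondeg X_proper.
pose l i : {poly {mpoly K[N.+1 + N.+1]}} := mmap (polyC \o @mpolyC _ _)
  (line_pt (fun j => 'X_(lshift _ j)) (fun j => 'X_(rshift _ j))) (G i).
have lE i (u v : rV) : map_poly (meval (pair_pt (u 0) (v 0))) (l i) = on_line i u v.
  rewrite (mmap_comp _ _ (map_poly (meval _))); apply: mmap_congr => [a|j] /=.
    by rewrite map_polyC /= mevalC.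
  rewrite /line_pt rmorphD rmorphM /= !map_polyC map_polyX /= !mevalXU.
  by rewrite pair_ptl pair_ptr.
apply: contrapT => none.
have all0 i k : pair_ideal X (l i)`_k.
  apply: contrapT => nl; apply: none; exists (l i)`_k => // u v luv.
  by exists i => E; apply: luv; rewrite -coef_map lE E coef0.
have cone_lin a u v : cone X u -> cone X v -> cone X (a *: u + v).
  move=> Xu Xv; rewrite addrC -[v]scale1r; apply: line_in_cone => i.
  by rewrite -lE; apply/polyP => k; rewrite coef_map coef0; exact: all0.
have cone0 : cone X (0 : rV).
  by have [[p Xp] _] := X_irr; exists p => //; rewrite mem0v.
have [V VP] := linear_predicate_vspace cone0 cone_lin.
have XV p : X p <-> (p <= V)%VS.
  have [u up u0] := point_vec p; rewrite (point_line up u0) -memvE VP.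
  split=> [Xp|Xu]; first by exists p.
  exact: cone_point Xu u0 up.
have dV : (\dim V <= N)%N.
  rewrite -ltnS ltn_neqAle; apply/andP; split; last first.
    by apply: leq_trans (dimvS (subvf V)) _; rewrite dimvf /dim /= mul1n.
  apply/eqP => dV; apply: X_proper; apply/seteqP; split=> // p _.
  apply/XV; rewrite (_ : V = fullv) ?subvf //; apply/eqP.
  by rewrite eqEdim subvf /= dimvf /dim /= mul1n dV.
have [H [dH VH]] : exists H : {vspace rV}, \dim H = N /\ (V <= H)%VS.
  have hN k : (\dim V <= k)%N -> (k <= N)%N ->
      exists H : {vspace rV}, \dim H = k /\ (V <= H)%VS.
    elim: k => [|k IH] Vk kN; first by exists V; split=> //; apply/eqP; rewrite -leqn0.
    move: Vk; rewrite leq_eqVlt => /orP [/eqP Vk|Vk]; first by exists V.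
    have [H [dH VH]] := IH Vk (ltnW kN).
    have [w wH] : exists w, w \notin H.
      apply: contrapT => all; have : (fullv <= H)%VS.
        by apply/subvP => w _; apply: contrapT => /negP wH; apply: all; exists w.
      move=> /dimvS; rewrite dimvf dH /dim /= mul1n; lia.
    exists (<[w]> + H)%VS; split; last exact: subv_trans VH (addvSr _ _).
    rewrite dimv_disjoint_sum ?dH.
      rewrite dim_vline; case: eqP => // w0.
      by case/negP: wH; rewrite w0 mem0v.
    apply/eqP; rewrite -subv0; apply/subvP => x /memv_capP [/vlineP [a ->] aH].
    have [->|a0] := eqVneq a 0; first by rewrite scale0r mem0v.
    by case/negP: wH; rewrite -(scalerK a0 w) memvZ.
  exact: hN.
by apply: (X_nondeg H dH) => p /XV pV; exact: subv_trans pV VH.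
Qed.

(** Were [z] a multiple of [u], the line through [v] and [z] would be the line through [u] and [v],
    which is not in X. *)
Lemma common_direction_indep (u v z : rV) : z != 0 ->
  (exists i, on_line i u v <> 0) ->
  (forall i, on_line i u z = 0) -> (forall i, on_line i v z = 0) ->
  z \notin <[u]>%VS /\ z \notin <[v]>%VS.
Proof.
move=> z0 [i0 uv] /line_in_cone uz /line_in_cone vz; split.
  apply/vlineP => -[c zE]; apply: uv; apply: cone_line => a b.
  have c0 : c != 0 by apply: contraNneq z0 => c0; rewrite zE c0 scale0r.
  have -> : a *: u + b *: v = b *: v + (a / c) *: z.
    by rewrite addrC zE scalerA divfK.
  exact: vz.
apply/vlineP => -[c zE]; apply: uv; apply: cone_line => a b.
have c0 : c != 0 by apply: contraNneq z0 => c0; rewrite zE c0 scale0r.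
have -> : a *: u + b *: v = a *: u + (b / c) *: z.
  by rewrite zE scalerA divfK.
exact: uz.
Qed.

Lemma singular_conic_through (p q : PN) (u v z : rV) :
  X p -> X q -> u \in (p : {vspace _}) -> v \in (q : {vspace _}) ->
  u != 0 -> v != 0 -> z != 0 -> (exists i, on_line i u v <> 0) ->
  (forall i, on_line i u z = 0) -> (forall i, on_line i v z = 0) ->
  exists C : set PN, [/\ singular_conic C, C `<=` X, C p & C q].
Proof.
move=> Xp Xq up vq u0 v0 z0 uv uz vz.
have [zu zv] := common_direction_indep z0 uv uz vz.
move: uz vz => /line_in_cone uz /line_in_cone vz.
have dim2 w : w != 0 -> z \notin <[w]>%VS -> \dim (<[w]> + <[z]>) = 2%N.
  move=> w0 zw; rewrite dimv_disjoint_sum ?dim_vline ?w0 ?z0 //.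
  apply/eqP; rewrite -subv0; apply/subvP => x /memv_capP [xw /vlineP [a xE]].
  have [a0|a0] := eqVneq a 0; first by rewrite xE a0 scale0r mem0v.
  by case/negP: zw; rewrite -(scalerK a0 z) memvZ // -xE.
have sub w : (forall a b, cone X (a *: w + b *: z)) ->
    linear_subspace (<[w]> + <[z]>) `<=` X.
  move=> wz r rL; have [x xr x0] := point_vec r.
  apply: (cone_point _ x0 xr).
  have /memv_addP [_ /vlineP [a ->] [_ /vlineP [b ->] ->]] := subvP rL _ xr.
  exact: wz.
exists (linear_subspace (<[u]> + <[z]>) `|` linear_subspace (<[v]> + <[z]>)); split.
- exists (<[u]> + <[z]>)%VS, (<[v]> + <[z]>)%VS; split; rewrite ?dim2 //.
  have [r rz] := point_of z0; exists r; rewrite /linear_subspace /=.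
  by rewrite rz; split; exact: addvSr.
- by move=> r [] rL; [exact: (sub u)|exact: (sub v)].
- by left; rewrite /linear_subspace /= (point_line up u0) addvSl.
- by right; rewrite /linear_subspace /= (point_line vq v0) addvSl.
Qed.

(* The conditions on [z] are the vanishing of the coefficients of [t ^ a], for
   [1 <= a <= d j], in [G j (u + t z)], and for [1 <= a < d j] in [G j (v + t z)];
   both have the same leading coefficient [G j z]. *)
Lemma common_direction (J : seq 'I_m) (u v : rV) : [pchar K] =i pred0 ->
  (2 * \sum_(j <- J) d j <= N + size J)%N -> cone X u -> cone X v ->
  exists2 z : rV, z != 0 &
    forall j, j \in J -> on_line j u z = 0 /\ on_line j v z = 0.
Proof.
move=> K0 dJ /coneP Gu /coneP Gv.
pose h (w : rV) j : {poly {mpoly K[N.+1]}} := mmap (polyC \o @mpolyC _ _)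
  (line_pt (fun l => (w 0 l)%:MP) (fun l => 'X_l)) (G j).
have hE w j (z : rV) : map_poly (meval (z 0)) (h w j) = on_line j w z.
  rewrite (mmap_comp _ _ (map_poly (meval _))); apply: mmap_congr => [a|k] /=.
    by rewrite map_polyC /= mevalC.
  by rewrite /line_pt rmorphD rmorphM /= !map_polyC map_polyX /= mevalC mevalXU.
have h_homog w j e : (h w j)`_e \is e.-homog.
  rewrite /h; move: e; elim/mpoly_ring_ind: (G j) => [c|k|f g IHf IHg|f g IHf IHg] e.
  - rewrite mmapC coefC; case: eqP => [->|_]; last exact: dhomog0.
    by rewrite /= -alg_mpolyC; apply: dhomogZ; exact: dhomog1.
  - rewrite mmapX mmap1U /line_pt coefD coefC coefMX.
    case: e => [|[|e]] /=; rewrite ?coefC ?addr0 ?add0r //=.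
    + by rewrite -alg_mpolyC; apply: dhomogZ; exact: dhomog1.
    + by rewrite dhomogX; apply/eqP; exact: mdeg1.
    + exact: dhomog0.
  - by rewrite rmorphD coefD; apply: dhomogD; [exact: IHf|exact: IHg].
  - rewrite rmorphM coefM; apply: rpred_sum => k _.
    by have := dhomogM (IHf k) (IHg (e - k)%N); rewrite subnKC // -ltnS.
pose s := flatten [seq [seq (h u j)`_a.+1 | a <- iota 0 (d j)] ++
                       [seq (h v j)`_a.+1 | a <- iota 0 (d j).-1] | j <- J].
have ss : (size s <= N)%N.
  rewrite size_flatten /shape -map_comp sumnE big_map.
  rewrite -(leq_add2r (size J)); apply: leq_trans dJ.
  rewrite -sum1_size -big_split big_distrr /=; apply: leq_sum => j _.
  rewrite size_cat !size_map !size_iota; have := degree_gt0 j; lia.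
have [|c [l cl] sc] := projective_dimension K0 ss.
  move=> f /flatten_mapP [j _]; rewrite mem_cat => /orP [] /mapP [a _ ->].
    by exists a.+1 => //; exact: h_homog.
  by exists a.+1 => //; exact: h_homog.
pose z : rV := \row_l c l.
have zc : z 0 =1 c by move=> k; rewrite mxE.
exists z; first by apply/eqP => /rowP /(_ l); rewrite !mxE; exact/eqP.
have line_size w j : (size (on_line j w z) <= (d j).+1)%N.
  have [+ _] := mmap_line_top idfun (w 0) (z 0) (G_degree j).2.
  by rewrite (_ : mmap _ _ _ = on_line j w z) //; exact: mmap_congr.
have line_top w j : (on_line j w z)`_(d j) = (G j).@[z 0].
  have [_] := mmap_line_top idfun (w 0) (z 0) (G_degree j).2.
  by rewrite (_ : mmap _ _ _ = on_line j w z) //; exact: mmap_congr.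
have coef0w (w : rV) j : (forall i, (G i).@[w 0] = 0) -> (on_line j w z)`_0 = 0.
  by move=> Gw; rewrite -horner_coef0 on_line_horner scale0r addr0.
move=> j jJ.
have cu a : (a < d j)%N -> (on_line j u z)`_a.+1 = 0.
  move=> ad; rewrite -hE coef_map /= (meval_eq _ zc); apply: sc.
  apply/flatten_mapP; exists j => //; rewrite mem_cat; apply/orP; left.
  by apply/mapP; exists a => //; rewrite mem_iota.
have cv a : (a < (d j).-1)%N -> (on_line j v z)`_a.+1 = 0.
  move=> ad; rewrite -hE coef_map /= (meval_eq _ zc); apply: sc.
  apply/flatten_mapP; exists j => //; rewrite mem_cat; apply/orP; right.
  by apply/mapP; exists a => //; rewrite mem_iota.
have dj := degree_gt0 j.
have E : (on_line j v z)`_(d j) = 0.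
  by rewrite line_top -(line_top u) -(prednK dj) cu // prednK.
split; apply/polyP => -[|a]; rewrite coef0 ?coef0w //.
- have [/cu //|le] := ltnP a (d j).
  by rewrite nth_default //; apply: leq_trans (line_size _ _) _.
- have [/cv //|le] := ltnP a (d j).-1.
  have [ae|ne] := eqVneq a.+1 (d j); first by rewrite ae.
  rewrite nth_default //; apply: leq_trans (line_size _ _) _.
  by move: le ne dj; clear; lia.
Qed.

Theorem singular_conics_of_all_degrees : [pchar K] =i pred0 ->
  X <> setT -> nondegenerate_variety X ->
  (2 * \sum_(i < m) d i <= N + m)%N -> connected_by_singular_conics X.
Proof.
move=> K0 X_proper X_nondeg dm.
have [t tI tP] := nonlinear_pair X_nondeg X_proper.
apply: (general_pairP tI) => u v p q Xp Xq up vq u0 v0 /tP uv.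
have [|||z z0 zP] := @common_direction (enum 'I_m) u v K0.
- by rewrite size_enum_ord big_enum.
- by exists p.
- by exists q.
by apply: (singular_conic_through Xp Xq up vq u0 v0 z0 uv) => i;
  have [] := zP i (mem_enum _ _).
Qed.

End DefiningEquations.

(** * Jacobian relations *)

Section Homogenization.
Variables (K : closedFieldType) (N m : nat) (X : set (proj_space K N)).
Variables (G : 'I_m -> {mpoly K[N.+1]}) (d : 'I_m -> nat).
Hypothesis G_homog : forall i, G i \is (d i).-homog.

(** Modulo the ideal of the [G i], the part of degree [a] of the identity on the chart expresses
    [g_ a] by [g_ a.-1], whence [g_ a] is minus ['X_l ^+ (a - e) * f] for [a] at least [e]. Beyond
    the degree of [g] it is zero. *)
Lemma scheme_power_homog (l : 'I_N.+1) (f g : {mpoly K[N.+1]}) (h : 'I_m -> {mpoly K[N.+1]}) e :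
  f \is e.-homog -> f = \sum_i h i * G i + g * ('X_l - 1) ->
  exists M, gen_ideal G ('X_l ^+ M * f).
Proof.
move=> fe E.
have [I0 ID IM] := gen_ideal_set G.
have IN p : gen_ideal G p -> gen_ideal G (- p) by rewrite -mulN1r; exact: IM.
pose g_ a := pihomog mdeg a g.
have X1 : ('X_l : {mpoly K[N.+1]}) \is 1.-homog by rewrite dhomogX; apply/eqP; exact: mdeg1.
have step a : exists2 q, gen_ideal G q &
    (if a == e then f else 0) = q + (if (0 < a)%N then g_ a.-1 else 0) * 'X_l - g_ a.
  exists (\sum_i pihomog mdeg a (h i * G i)).
    apply: ideal_sum => [|i _]; first exact: gen_ideal_set.
    by rewrite (pihomogM _ _ (G_homog i)); apply: IM; exact: gen_ideal_gen.
  have -> : (if a == e then f else 0) = pihomog mdeg a f.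
    case: eqP => [->|/eqP ne]; first by rewrite pihomog_dE.
    by rewrite (pihomog_ne0 _ fe) // eq_sym.
  rewrite [in LHS]E mulrBr mulr1 !(linearD, linearB) linear_sum /= addrA.
  by rewrite (pihomogM _ _ X1) subn1 linearN.
have S a : gen_ideal G (g_ a + (if (e <= a)%N then 'X_l ^+ (a - e) * f else 0)).
  elim: a => [|a IH].
    have [q Iq] := step 0%N; rewrite ltnn mul0r addr0 leqn0 eq_sym.
    by case: eqP => [->|_] E0; rewrite ?subnn ?expr0 ?mul1r E0 addrC subrK //.
  have [q Iq /=] := step a.+1; rewrite [(e <= a.+1)%N]leq_eqVlt ltnS [a.+1 == e]eq_sym.
  have [ea|nea] := eqVneq e a.+1 => E1.
    move: IH; rewrite ea ltnn addr0 /= subnn expr0 mul1r => IH.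
    rewrite E1 addrC subrK; apply: ID => //; rewrite mulrC; exact: IM.
  move/eqP: E1; rewrite eq_sym subr_eq add0r => /eqP <- /=.
  case: leqP IH => ea IH; last first.
    by rewrite addr0 in IH; rewrite addr0; apply: (ID) => //; rewrite mulrC; exact: IM.
  rewrite subSn // exprS -mulrA -addrA -[g_ a * _]mulrC -mulrDr.
  by apply: ID => //; exact: IM.
exists (maxn (msize g) e - e)%N.
have := S (maxn (msize g) e); rewrite leq_maxr.
rewrite {1}/g_ /pihomog big_seq_cond big1 ?add0r // => mo /andP [mg /eqP E'].
have := msize_mdeg_lt mg; rewrite -[mdeg mo]/(mdeg mo) (E' : mdeg mo = _).
by rewrite ltnNge leq_maxl.
Qed.

Lemma scheme_power : scheme_theoretically_defined G X ->
  forall f, vanishing_ideal X f -> forall l, exists M, gen_ideal G ('X_l ^+ M * f).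
Proof.
move=> scheme f If l.
have [I0 ID IM] := gen_ideal_set G.
have hom e : exists M, gen_ideal G ('X_l ^+ M * pihomog mdeg e f).
  have [_ [|h [g E]]] := scheme l (pihomog mdeg e f).
    by move=> p Xp u up _; apply: (vanishing_homog e If) up.
  exact: scheme_power_homog (pihomogP _ _ _) E.
have [M MP] := choice hom.
have [k fk] : exists k, f = \sum_(e < k) pihomog mdeg e f.
  by exists (msize f); exact: pihomog_partitionE.
exists (\sum_(e < k) M e)%N; rewrite {1}fk mulr_sumr.
apply: ideal_sum => [|e _]; first exact: gen_ideal_set.
have le : (M e <= \sum_(e < k) M e)%N by rewrite (bigD1 e) //= leq_addr.
by rewrite -(subnK le) exprD -mulrA; apply: IM.
Qed.

End Homogenization.

(** If the minor is not zero, the rows [a k] span the row space, as the rank is at most [c], and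
    Cramer's rule expresses row [i]. The outer factor [\det A] covers the case of a zero minor. *)
Lemma minor_identity (F : fieldType) (m n c : nat) (M : 'M[F]_(m, n))
    (a : 'I_c -> 'I_m) (b : 'I_c -> 'I_n) (A := mxsub a b M) i l :
  (\rank M <= c)%N ->
  \det A * (\det A * M i l -
     \sum_k (\sum_j M i (b j) * \adj A j k) * M (a k) l) = 0.
Proof.
move=> rM; have [->|dA] := eqVneq (\det A) 0; first by rewrite mul0r.
have uA : A \in unitmx by rewrite unitmxE unitfE.
pose R := rowsub a M.
have AR : A = colsub b R by apply/matrixP => x y; rewrite !mxE.
have rR : (c <= \rank R)%N.
  rewrite -{1}(mxrank_unit uA) AR.
  have -> : colsub b R = R *m colsub b 1%:M.
    by rewrite mulmx_colsub mulmx1.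
  exact: mxrankM_maxl.
have RM : (R <= M)%MS by apply/row_subP => k; rewrite row_rowsub row_sub.
have MR : (M <= R)%MS by rewrite -(geq_leqif (mxrank_leqif_sup RM)) (leq_trans rM).
have /submxP [w wE] : (row i M <= R)%MS by apply: submx_trans MR; exact: row_sub.
have E y : M i y = \sum_k w 0 k * M (a k) y.
  have := congr1 (fun Q : 'rV_n => Q 0 y) wE; rewrite !mxE => ->.
  by apply: eq_bigr => k _; rewrite !mxE.
have cE k : \sum_j M i (b j) * \adj A j k = \det A * w 0 k.
  have : (w *m A *m \adj A) 0 k = \det A * w 0 k.
    by rewrite -mulmxA mul_mx_adj mul_mx_scalar mxE.
  move=> <-; rewrite mxE; apply: eq_bigr => j _; congr (_ * _).
  by rewrite E mxE; apply: eq_bigr => k' _; rewrite !mxE.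
rewrite (eq_bigr (fun k => \det A * (w 0 k * M (a k) l))).
  by rewrite -mulr_sumr -E subrr mulr0.
by move=> k _; rewrite cE mulrA.
Qed.

Lemma full_minor (F : fieldType) (m n c : nat) (M : 'M[F]_(m, n)) :
  (c <= \rank M)%N ->
  exists (a : {ffun 'I_c -> 'I_m}) (b : {ffun 'I_c -> 'I_n}),
    \det (mxsub a b M) != 0.
Proof.
move=> cM; pose w := widen_ord cM.
have w_inj : injective w by move=> x y /(congr1 val) /= /val_inj.
pose a := [ffun k => maxrankfun M (w k)].
pose R := rowsub a M.
have freeR : row_free R.
  have -> : R = rowsub w (rowsub (maxrankfun M) M).
    by apply/matrixP => x y; rewrite !mxE ffunE.
  have /row_freeP [B BM] := maxrowsub_free M.
  apply/row_freeP; exists (B *m colsub w 1%:M).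
  rewrite mulmxA mul_rowsub_mx BM.
  apply/matrixP => x y; rewrite !mxE (bigD1 (w x)) //= !mxE eqxx mul1r big1 ?addr0.
    by rewrite (inj_eq w_inj).
  by move=> k /negPf kx; rewrite !mxE eq_sym kx mul0r.
have fullRt : row_full R^T by rewrite /row_full mxrank_tr.
pose b := [ffun k => fullrankfun fullRt k].
exists a, b.
have -> : mxsub a b M = (rowsub (fullrankfun fullRt) R^T)^T.
  by apply/matrixP => x y; rewrite !mxE [b y]ffunE.
rewrite det_tr -unitfE -unitmxE; exact: fullrowsub_unit.
Qed.

Section Minors.
Variables (K : comNzRingType) (n m c : nat) (G : 'I_m -> {mpoly K[n]}).
Variables (a : 'I_c -> 'I_m) (b : 'I_c -> 'I_n).

Definition jac_mx : 'M[{mpoly K[n]}]_c := \matrix_(j, k) (G (a j))^`M(b k).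

Definition jac_minor : {mpoly K[n]} := \det jac_mx.

Definition jac_coef (i : 'I_m) (k : 'I_c) : {mpoly K[n]} :=
  \sum_j (G i)^`M(b j) * \adj jac_mx j k.

(* Cramer's rule: where [jac_minor] does not vanish and the Jacobian has rank [c],
   the differential of [G i] is the combination of those of the [G (a k)] with
   coefficients [jac_coef i k / jac_minor]. *)
Definition jac_rel (i : 'I_m) (l : 'I_n) : {mpoly K[n]} :=
  jac_minor * (jac_minor * (G i)^`M(l) - \sum_k jac_coef i k * (G (a k))^`M(l)).

End Minors.

Section Transversal.
Variables (K : comNzRingType) (B : idomainType) (n m c : nat).
Variables (G : 'I_m -> {mpoly K[n]}) (i : {rmorphism K -> B}).
Variables (a : 'I_c -> 'I_m) (b : 'I_c -> 'I_n).
Hypothesis B0 : [pchar B] =i pred0.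
Hypothesis rel_ideal : forall s l j,
  exists M, gen_ideal G ('X_j ^+ M * jac_rel G a b s l).

(* If an arc [p] with [p 0] on X satisfies the equations of X to order [k], then
   the leading terms of the [G s p] are related as the differentials are. *)
Lemma transversal_relation (p : 'I_n -> {poly B}) (k : nat) (r : 'I_m -> {poly B})
    (p0 : 'I_n -> B := fun l => (p l)`_0) :
  (0 < k)%N -> (forall s, mmap (polyC \o i) p (G s) = 'X^k * r s) ->
  (exists j, p0 j != 0) ->
  mmap i p0 (jac_minor G a b) != 0 ->
  forall s, mmap i p0 (jac_minor G a b) * (r s)`_0 =
    \sum_t mmap i p0 (jac_coef G a b s t) * (r (a t))`_0.
Proof.
move=> k0 Gp [j pj] D0 s.
set E := mmap (polyC \o i) p; set E0 := mmap i p0.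
have EM f g : E (f * g) = E f * E g by rewrite /E rmorphM.
have EB f g : E (f - g) = E f - E g by rewrite /E rmorphB.
have EX f e : E (f ^+ e) = E f ^+ e by rewrite /E rmorphXn.
have Esum (I : finType) (F : I -> {mpoly K[n]}) : E (\sum_i F i) = \sum_i E (F i).
  by rewrite /E (rmorph_sum (mmap _ _)).
have E0E f : E0 f = (E f)`_0.
  rewrite -horner_coef0 -horner_evalE /E (mmap_comp _ _ (horner_eval (0 : B))).
  apply: mmap_congr => [x|l] /=; rewrite horner_evalE ?hornerC //.
  by rewrite horner_coef0.
have kB : (k%:R : B) != 0 by move/pcharf0P: B0 => ->; rewrite -lt0n.
(* The derivative of ['X^k * r u] is ['X^(k.-1) * dr u], and the constant term of [dr u] is [k]
   times that of [r u]; characteristic 0 allows to cancel [k]. *)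
pose dr u := r u *+ k + 'X * (r u)^`().
have dG u : \sum_l E (G u)^`M(l) * (p l)^`() = 'X^(k.-1) * dr u.
  rewrite -mmap_chain Gp derivM derivXn /dr mulrDr mulrA -exprSr prednK //.
  by rewrite mulrnAl mulrnAr.
have [M MP] : exists M, forall l, gen_ideal G ('X_j ^+ M * jac_rel G a b s l).
  have [M MP] := choice (fun l => rel_ideal s l j).
  exists (\sum_l M l)%N => l; have [_ _ IM] := gen_ideal_set G.
  have le : (M l <= \sum_l M l)%N by rewrite (bigD1 l) //= leq_addr.
  by rewrite -(subnK le) exprD -mulrA; apply: IM.
have Xdiv q : gen_ideal G q -> exists q', E q = 'X^k * q'.
  move=> [h ->]; exists (\sum_u E (h u) * r u).
  by rewrite Esum mulr_sumr; apply: eq_bigr => u _; rewrite EM [E (G u)]Gp mulrCA.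
have [q qE] := choice (fun l => Xdiv _ (MP l)).
pose D := E (jac_minor G a b).
pose W := D * dr s - \sum_t E (jac_coef G a b s t) * dr (a t).
(* The relation between differentials holds modulo the ideal of the [G i]. Along [p] its error is
   divisible by ['X^k], one power more than the derivatives that it relates. *)
have key : 'X^(k.-1) * (E 'X_j ^+ M * D * W) =
    'X^(k.-1) * ('X * \sum_l q l * (p l)^`()).
  rewrite mulrA -exprSr prednK // mulr_sumr.
  rewrite [RHS](eq_bigr (fun l => E ('X_j ^+ M * jac_rel G a b s l) * (p l)^`())); last first.
    by move=> l _; rewrite qE mulrA.
  rewrite /jac_rel.
  have expand l : E ('X_j ^+ M * (jac_minor G a b * (jac_minor G a b * (G s)^`M(l) -
       \sum_k0 jac_coef G a b s k0 * (G (a k0))^`M(l)))) * (p l)^`() =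
     E 'X_j ^+ M * D * (D * (E (G s)^`M(l) * (p l)^`()) -
       \sum_t E (jac_coef G a b s t) * (E (G (a t))^`M(l) * (p l)^`())).
    rewrite EM EX EM EB EM (Esum _ (fun k0 => jac_coef G a b s k0 * (G (a k0))^`M(l))) -/D.
    rewrite -!mulrA; do 2 congr (_ * _); rewrite mulrBl mulrA; congr (_ - _).
    rewrite mulr_suml; apply: eq_bigr => t _.
    by rewrite EM mulrA.
  rewrite (eq_bigr _ (fun l _ => expand l)) -mulr_sumr sumrB -mulr_sumr dG.
  rewrite exchange_big /= mulrCA; congr (_ * _); rewrite mulrBr; congr (_ - _).
    by rewrite mulrCA.
  rewrite mulr_sumr; apply: eq_bigr => t _.
  by rewrite -mulr_sumr dG mulrCA.
have {key} /(congr1 (fun q : {poly B} => q`_0)) :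
    E 'X_j ^+ M * D * W = 'X * \sum_l q l * (p l)^`().
  by apply: mulfI key; rewrite expf_neq0 // polyX_eq0.
rewrite coefXM /= !coef0M => /eqP.
rewrite !mulf_eq0 -!horner_coef0 horner_exp expf_eq0 !horner_coef0 -!E0E.
rewrite {1}/E0 mmapX mmap1U (negPf pj) andbF (negPf D0) /=.
rewrite coefB coef_sum coef0M -E0E.
have dr0 u : (dr u)`_0 = (r u)`_0 *+ k by rewrite coefD coefMn coefXM addr0.
rewrite dr0 mulrnAr (eq_bigr (fun t => E0 (jac_coef G a b s t) * (r (a t))`_0 *+ k)).
  rewrite sumrMnl -mulrnBl -mulr_natr mulf_eq0 (negPf kB) orbF subr_eq0.
  by move/eqP.
by move=> t _; rewrite coef0M -E0E dr0 mulrnAr.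
Qed.

End Transversal.

Lemma dhomog_mderiv (A : comNzRingType) (n : nat) (f : {mpoly A[n]}) e l :
  f \is e.-homog -> f^`M(l) \is e.-1.-homog.
Proof.
move=> /dhomogP fe; rewrite [f]mpolyE (linear_sum (mderiv l)) big_seq.
apply: rpred_sum => mo mf /=; rewrite linearZ /= mderivX scalerA.
have [m0|m0] := eqVneq (mo l) 0%N.
  by rewrite m0 mulr0 scale0r; exact: dhomog0.
apply: dhomogZ; rewrite dhomogX; apply/eqP.
rewrite -(fe _ mf) -[RHS]/(mdeg mo).-1.
have le : (U_(l) <= mo)%MM by rewrite lep1mP.
by rewrite -{2}(submK le) mdegD mdeg1 addn1.
Qed.

Lemma dim_kernel (F : fieldType) (n r : nat) (M : 'M[F]_(n, r))
    (T : {vspace 'rV[F]_n}) :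
  (forall v, v \in T <-> v *m M = 0) -> \dim T = (n - \rank M)%N.
Proof.
move=> TM; pose k := \dim T.
pose Bm : 'M[F]_(k, n) := \matrix_(i, l) (vbasis T)`_i 0 l.
have BmE (w : 'rV_k) : w *m Bm = \sum_i w 0 i *: (vbasis T)`_i.
  apply/rowP => l; rewrite mxE summxE; apply: eq_bigr => i _.
  by rewrite !mxE.
have Tb := vbasisP T.
have Bfree : row_free Bm.
  rewrite -kermx_eq0; apply/rowV0P => w /sub_kermxP; rewrite BmE => wB.
  have /freeP := basis_free Tb; move=> /(_ (fun i => w 0 i)) fr.
  by apply/rowP => i; rewrite mxE; apply: fr; exact: wB.
have Bker : (Bm <= kermx M)%MS.
  apply/row_subP => i; apply/sub_kermxP/TM.
  have -> : row i Bm = (vbasis T)`_i by apply/rowP => l; rewrite !mxE.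
  by apply: vbasis_mem; rewrite mem_nth // size_tuple.
have kerB : (kermx M <= Bm)%MS.
  apply/row_subP => i; have /sub_kermxP/TM vT := row_sub i (kermx M).
  rewrite (coord_vbasis vT).
  have -> : \sum_i0 coord (vbasis T) i0 (row i (kermx M)) *: (vbasis T)`_i0 =
     (\row_i0 coord (vbasis T) i0 (row i (kermx M))) *m Bm.
    by rewrite BmE; apply: eq_bigr => j _; rewrite mxE.
  exact: submxMl.
have : \rank Bm = \rank (kermx M) by apply/eqP; rewrite eqn_leq !mxrankS.
by rewrite mxrank_ker (eqP Bfree).
Qed.

(** * The Jacobian criterion *)

Section Smooth.
Variables (K : closedFieldType) (N m n : nat) (X : set (proj_space K N)).
Variables (G : 'I_m -> {mpoly K[N.+1]}) (d : 'I_m -> nat).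
Hypotheses (X_irr : irreducible_set X) (X_def : set_theoretically_defined G X).
Hypothesis G_degree : forall i, G i != 0 /\ G i \is (d i).-homog.
Hypotheses (X_smooth : smooth_of_dimension X n)
  (X_scheme : scheme_theoretically_defined G X).
Local Notation rV := 'rV[K]_N.+1.

Definition jacobian (u : rV) : 'M[K]_(m, N.+1) :=
  \matrix_(i, l) ((G i)^`M(l)).@[u 0].

Let dir (v u : rV) (f : {mpoly K[N.+1]}) : K := \sum_l (f^`M(l)).@[u 0] * v 0 l.

Let dirM v u f g : dir v u (f * g) = f.@[u 0] * dir v u g + g.@[u 0] * dir v u f.
Proof.
rewrite /dir !mulr_sumr -big_split; apply: eq_bigr => l _ /=.
by rewrite mderivM mevalD !mevalM; ring.
Qed.

Let dir_sum v u (I : finType) (F : I -> {mpoly K[N.+1]}) :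
  dir v u (\sum_i F i) = \sum_i dir v u (F i).
Proof.
rewrite /dir exchange_big; apply: eq_bigr => l _ /=.
by rewrite (linear_sum (mderiv l)) (rmorph_sum (meval _)) mulr_suml.
Qed.

Let jac_dir v u : v *m (jacobian u)^T = \row_i dir v u (G i).
Proof.
apply/rowP => i; rewrite !mxE; apply: eq_bigr => l _.
by rewrite !mxE mulrC.
Qed.

(** Tangent vectors are defined by the whole ideal of X. For [f] in it, some ['X_l ^+ M * f] is in
    the ideal of the [G i]; differentiating at a point with nonzero coordinate [l] reduces [f] to
    the [G i]. *)
Lemma tangent_jacobian (p : proj_space K N) (u v : rV) : X p ->
  u \in (p : {vspace _}) -> u != 0 ->
  tangent_at X p v <-> v *m (jacobian u)^T = 0.
Proof.
move=> Xp up u0.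
have GI i : vanishing_ideal X (G i).
  apply/vanishing_idealP => w /(coneP X_irr X_def G_degree); exact.
split=> [Tv|].
  rewrite jac_dir; apply/rowP => i; rewrite !mxE; exact: Tv (GI i) u up u0.
rewrite jac_dir => /rowP Jv f If u' u'p u'0.
have Gu' i : dir v u' (G i) = 0.
  have := Jv i; rewrite !mxE.
  move: u'p; rewrite (point_line up u0) => /vlineP [s ->] Ju.
  rewrite /dir (eq_bigr (fun l => s ^+ (d i).-1 * (((G i)^`M(l)).@[u 0] * v 0 l))).
    by rewrite -mulr_sumr -/(dir v u (G i)) Ju mulr0.
  move=> l _; have := dhomog_mderiv l (G_degree i).2.
  by move=> /meval_point_scale ->; rewrite mulrA.
have [l ul] : exists l, u' 0 l != 0.
  apply: contrapT => none; move/eqP: u'0; apply; apply/rowP => l; rewrite mxE.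
  by apply/eqP; apply: contrapT => /negP ul; apply: none; exists l.
have [M [h E]] := scheme_power (fun i => (G_degree i).2) X_scheme If l.
have f0 : f.@[u' 0] = 0 by apply: If u'p.
have := congr1 (dir v u') E; rewrite dirM f0 mul0r addr0 dir_sum.
rewrite [RHS]big1 => [/eqP|i _]; last first.
  by rewrite dirM Gu' (GI i p Xp _ u'p) mulr0 mul0r addr0.
by rewrite mulf_eq0 rmorphXn /= mevalXU expf_eq0 (negPf ul) andbF => /eqP.
Qed.

Lemma jacobian_rank (u : rV) : cone X u -> u != 0 ->
  (n <= N)%N /\ \rank (jacobian u) = (N - n)%N.
Proof.
move=> [p Xp up] u0; have [T dT TP] := X_smooth Xp.
have TJ v : v \in T <-> v *m (jacobian u)^T = 0.
  by rewrite TP; exact: tangent_jacobian.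
have nN : (n <= N)%N.
  rewrite -ltnS -dT; apply: leq_trans (dimvS (subvf T)) _.
  by rewrite dimvf /dim /= mul1n.
have := dim_kernel TJ; rewrite mxrank_tr dT.
split=> //; have := rank_leq_col (jacobian u).
by move: nN; lia.
Qed.

Lemma cone_vec : exists2 u : rV, cone X u & u != 0.
Proof.
by have [[p Xp] _] := X_irr; have [u up u0] := point_vec p; exists u => //; exists p.
Qed.

(** The vertex of the cone lies on the line of a nonzero vector, and a polynomial in one variable
    that vanishes off 0 is zero. *)
Lemma vanishing_off_zero f :
  (forall u, cone X u -> u != 0 -> f.@[u 0] = 0) -> vanishing_ideal X f.
Proof.
move=> f0; apply/vanishing_idealP => u Xu.
have [u0|] := eqVneq u 0; last exact: f0.
have [w Xw w0] := cone_vec.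
pose q := mmap polyC (line_pt (fun=> 0) (w 0)) f.
have qE t : q.[t] = f.@[(t *: w) 0].
  rewrite -horner_evalE (mmap_comp polyC _ (horner_eval t)).
  apply: mmap_congr => [x|l]; first by rewrite /= horner_evalE hornerC.
  by rewrite /= horner_evalE /line_pt !hornerE mxE mulrC.
have : q * 'X = 0.
  apply: poly_zeroP => t; rewrite hornerMX qE.
  have [->|t0] := eqVneq t 0; first by rewrite mulr0.
  by rewrite f0 ?mul0r ?scaler_eq0 ?negb_or ?t0 //; exact: cone_scale.
move/eqP; rewrite mulf_eq0 polyX_eq0 orbF => /eqP q0.
by rewrite u0 -[0](scale0r w) -qE q0 horner0.
Qed.

Let c := (N - n)%N.

Lemma jac_minor_eval (a : 'I_c -> 'I_m) (b : 'I_c -> 'I_N.+1) (u : rV) :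
  (jac_minor G a b).@[u 0] = \det (mxsub a b (jacobian u)).
Proof.
rewrite /jac_minor -det_map_mx; congr (\det _).
by apply/matrixP => j k; rewrite !mxE.
Qed.

(** The Jacobian has rank [c] at all points of X, so Cramer's relations hold there; since the scheme
    is reduced, they lie in the ideal of the [G i] up to a power of a coordinate. *)
Lemma jac_rel_ideal (a : 'I_c -> 'I_m) (b : 'I_c -> 'I_N.+1) i l j :
  exists M, gen_ideal G ('X_j ^+ M * jac_rel G a b i l).
Proof.
apply: (scheme_power (fun i => (G_degree i).2) X_scheme).
apply: vanishing_off_zero => u Xu u0.
have [_ rk] := jacobian_rank Xu u0.
rewrite /jac_rel mevalM mevalB mevalM jac_minor_eval.
have := minor_identity a b i l (eq_leq rk); rewrite mxE => E.
rewrite -[RHS]E; congr (_ * (_ - _)); rewrite (rmorph_sum (meval _)).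
apply: eq_bigr => k _ /=.
rewrite mevalM [jacobian u _ _]mxE; congr (_ * _).
rewrite (rmorph_sum (meval _)); apply: eq_bigr => j' _ /=.
rewrite mevalM [jacobian u _ _]mxE; congr (_ * _).
have -> : mxsub a b (jacobian u) = map_mx (meval (u 0)) (jac_mx G a b).
  by apply/matrixP => x y; rewrite !mxE.
by rewrite -map_mx_adj [RHS]mxE.
Qed.

Lemma jac_minor_neq0 u : cone X u -> u != 0 ->
  exists (a : {ffun 'I_c -> 'I_m}) (b : {ffun 'I_c -> 'I_N.+1}),
    (jac_minor G a b).@[u 0] != 0.
Proof.
move=> Xu u0; have [_ rk] := jacobian_rank Xu u0.
have [a [b ab]] := @full_minor _ _ _ c (jacobian u) (eq_leq (esym rk)).
by exists a, b; rewrite jac_minor_eval.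
Qed.

End Smooth.

(** * Chains of two lines on smooth varieties *)

(** The values of [a] that are at least [c] are as many as the indices below [c] that [a] misses;
    [t], the largest degree from index [c] on, separates the two sums. *)
Lemma antitone_sum (m c : nat) (d : 'I_m -> nat) (a : 'I_c -> 'I_m) :
  (forall i j : 'I_m, (i <= j)%N -> (d j <= d i)%N) -> injective a ->
  (\sum_k d (a k) <= \sum_(i < m | (i < c)%N) d i)%N.
Proof.
move=> d_anti a_inj.
pose S := [set a k | k : 'I_c]%SET.
have -> : (\sum_k d (a k) = \sum_(i in S) d i)%N.
  by rewrite big_imset //= => x y _ _; exact: a_inj.
pose C := [set i : 'I_m | (i < c)%N]%SET.
have -> : (\sum_(i < m | (i < c)%N) d i = \sum_(i in C) d i)%N.
  by apply: eq_bigl => i; rewrite inE.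
have cS : #|S| = c by rewrite card_imset // card_ord.
have cm : (c <= m)%N by rewrite -[X in (_ <= X)%N]card_ord -{1}cS max_card.
have cC : #|C| = c.
  have w_inj : injective (widen_ord cm) by move=> x y /(congr1 val) /= /val_inj.
  rewrite -[RHS]card_ord -(card_imset _ w_inj).
  apply: eq_card => i; rewrite inE; apply/idP/imsetP => [ic|[j _ ->]] //=.
  by exists (Ordinal ic) => //; apply: val_inj.
have cDD : #|(S :\: C)%SET| = #|(C :\: S)%SET|.
  apply/eqP; rewrite -(eqn_add2l #|(S :&: C)%SET|) cardsID cS.
  by rewrite finset.setIC cardsID cC.
rewrite (big_setID C) /= [X in (_ <= X)%N](big_setID S) /= finset.setIC leq_add2l.
pose t := \max_(i < m | (c <= i)%N) d i.
apply: (@leq_trans (\sum_(i in (S :\: C)%SET) t)).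
  apply: leq_sum => i; rewrite !inE -leqNgt => /andP [ci _].
  exact: (leq_bigmax_cond (F := d)).
rewrite sum_nat_const cDD -sum_nat_const; apply: leq_sum => i.
rewrite !inE => /andP [_ ic]; apply/bigmax_leqP => j cj; apply: d_anti.
exact: leq_trans (ltnW ic) cj.
Qed.

Section SmoothSingularConics.
Variables (K : closedFieldType) (N m n : nat) (X : set (proj_space K N)).
Variables (G : 'I_m -> {mpoly K[N.+1]}) (d : 'I_m -> nat).
Hypotheses (X_irr : irreducible_set X) (X_def : set_theoretically_defined G X).
Hypothesis G_degree : forall i, G i != 0 /\ G i \is (d i).-homog.
Hypotheses (X_smooth : smooth_of_dimension X n)
  (X_scheme : scheme_theoretically_defined G X).
Hypothesis K0 : [pchar K] =i pred0.
Local Notation rV := 'rV[K]_N.+1.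
Let c := (N - n)%N.

Lemma line_extend (a : 'I_c -> 'I_m) (b : 'I_c -> 'I_N.+1) (u z : rV) :
  cone X u -> u != 0 -> (jac_minor G a b).@[u 0] != 0 ->
  (forall k, on_line G (a k) u z = 0) -> forall i, on_line G i u z = 0.
Proof.
move=> Xu u0 D0 az.
have lE i : mmap (polyC \o idfun) (line_pt (u 0) (z 0)) (G i) = on_line G i u z.
  exact: mmap_congr.
have p0E l : (line_pt (u 0) (z 0) l)`_0 = u 0 l.
  by rewrite /line_pt coefD coefC coefMX addr0.
have ev0 f : mmap idfun (fun l => (line_pt (u 0) (z 0) l)`_0) f = f.@[u 0].
  exact: mmap_congr.
have dX (q : {poly K}) : ('X %| q) = (q`_0 == 0).
  by rewrite -['X]subr0 -polyC0 dvdp_XsubCl /root horner_coef0.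
have step k i : (0 < k)%N -> (forall i, 'X^k %| on_line G i u z) ->
    'X^(k.+1) %| on_line G i u z.
  move=> k0 dvd.
  have E i' : mmap (polyC \o idfun) (line_pt (u 0) (z 0)) (G i') =
      'X^k * (on_line G i' u z %/ 'X^k) by rewrite lE mulrC divpK.
  have ex : exists l, (line_pt (u 0) (z 0) l)`_0 != 0.
    have [l ul] : exists l, u 0 l != 0.
      apply: contrapT => none; move/eqP: u0; apply; apply/rowP => l; rewrite mxE.
      by apply/eqP; apply: contrapT => /negP ul; apply: none; exists l.
    by exists l; rewrite p0E.
  have D0' : mmap idfun (fun l => (line_pt (u 0) (z 0) l)`_0) (jac_minor G a b) != 0.
    by rewrite ev0.
  have := transversal_relation K0
    (jac_rel_ideal X_irr X_def G_degree X_smooth X_scheme a b) k0 E ex D0' i.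
  rewrite ev0 big1 => [/eqP|t _]; last by rewrite az div0p coef0 mulr0.
  rewrite mulf_eq0 (negPf D0) /= => /eqP r0.
  rewrite -[on_line _ _ _ _](divpK (dvd i)) exprS dvdp_mul2r ?expf_neq0 ?polyX_eq0 //.
  by rewrite dX r0.
have all_k k : forall i, 'X^(k.+1) %| on_line G i u z.
  elim: k => [|k IH] i; last exact: step.
  rewrite expr1 dX -horner_coef0 on_line_horner scale0r addr0.
  by apply/eqP; move/(coneP X_irr X_def G_degree): Xu.
move=> i; apply/eqP; apply: contrapT => /negP ne.
have := dvdp_leq ne (all_k (size (on_line G i u z)) i).
by rewrite size_polyXn => /ltnW; rewrite ltnn.
Qed.

(** Injectivity is what bounds the sum of the chosen degrees by that of the [c] largest; a minor
    with a repeated row is zero. *)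
Lemma minor_nonvanishing : exists (a : 'I_c -> 'I_m) (b : 'I_c -> 'I_N.+1) (u : rV),
  [/\ injective a, cone X u, u != 0 & (jac_minor G a b).@[u 0] != 0].
Proof.
have [u Xu u0] := cone_vec X_irr.
have [a [b D]] := jac_minor_neq0 X_irr X_def G_degree X_smooth X_scheme Xu u0.
exists a, b, u; split=> // x y axy; apply/eqP; apply: contrapT => /negP xy.
move/eqP: D; apply; rewrite jac_minor_eval (determinant_alternate xy) // => k.
by rewrite !mxE axy.
Qed.

Hypotheses (X_proper : X <> setT) (X_nondeg : nondegenerate_variety X).
Hypothesis d_anti : forall i j : 'I_m, (i <= j)%N -> (d j <= d i)%N.
Hypothesis d_sum : (2 * \sum_(i < m | (i < N - n)%N) d i <= N + (N - n))%N.

Lemma general_common_line : exists t : {mpoly K[N.+1 + N.+1]},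
  ~ pair_ideal X t /\ forall u v : rV, cone X u -> cone X v ->
   t.@[pair_pt (u 0) (v 0)] <> 0 ->
   [/\ u != 0, v != 0, exists i, on_line G i u v <> 0 &
   exists2 z, z != 0 & forall i, on_line G i u z = 0 /\ on_line G i v z = 0].
Proof.
have [t tI tP] := nonlinear_pair X_irr X_def G_degree X_nondeg X_proper.
have [a [b [w [a_inj Xw w0 Dw]]]] := minor_nonvanishing.
have [l wl] : exists l, w 0 l != 0.
  apply: contrapT => none; move/eqP: w0; apply; apply/rowP => l; rewrite mxE.
  by apply/eqP; apply: contrapT => /negP wl; apply: none; exists l.
pose D := jac_minor G a b * 'X_l.
have Dw0 : D.@[w 0] != 0 by rewrite mevalM mevalXU mulf_neq0.
exists (t * (pair_left D * pair_right D)); split.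
  move=> /(pair_ideal_prime X_irr) [//|] /(pair_ideal_prime X_irr) [] I.
    by have := I w w Xw Xw; rewrite meval_pair_left; exact/eqP.
  by have := I w w Xw Xw; rewrite meval_pair_right; exact/eqP.
move=> u v Xu Xv; rewrite !mevalM meval_pair_left meval_pair_right => /eqP.
rewrite !mulf_eq0 !negb_or => /and3P [/eqP tuv].
rewrite !mevalM !mevalXU !mulf_eq0 !negb_or => /andP [Du ul] /andP [Dv vl].
have u0 : u != 0 by apply: contraNneq ul => ->; rewrite mxE.
have v0 : v != 0 by apply: contraNneq vl => ->; rewrite mxE.
split=> //; first exact: tP tuv.
have dJ : (2 * \sum_(j <- [seq a k | k <- enum 'I_c]) d j <=
           N + size [seq a k | k <- enum 'I_c])%N.
  rewrite size_map size_enum_ord big_map big_enum /=.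
  by apply: leq_trans d_sum; rewrite leq_pmul2l //; exact: antitone_sum.
have [z z0 zP] := common_direction X_irr X_def G_degree K0 dJ Xu Xv.
exists z => // i; split.
  apply: (line_extend Xu u0 Du) => k.
  by have [] := zP (a k) (map_f _ (mem_enum _ _)).
apply: (line_extend Xv v0 Dv) => k.
by have [] := zP (a k) (map_f _ (mem_enum _ _)).
Qed.

Theorem singular_conics_of_top_degrees : connected_by_singular_conics X.
Proof.
have [t [tI tP]] := general_common_line.
apply: (general_pairP tI) => u v p q Xp Xq up vq u0 v0 tuv.
have Xu : cone X u by exists p.
have Xv : cone X v by exists q.
have [_ _ uv [z z0 zP]] := tP u v Xu Xv tuv.
by apply: (singular_conic_through X_irr X_def G_degree Xp Xq up vq u0 v0 z0 uv) => i;
  have [] := zP i.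
Qed.

End SmoothSingularConics.

(** * Smoothing a chain of two lines to finite order *)

Lemma poly_divX (B : comNzRingType) (p : {poly B}) :
  p`_0 = 0 -> exists q, p = q * 'X.
Proof.
move=> p0; exists (drop_poly 1 p); rewrite -{1}(poly_take_drop 1 p) expr1.
rewrite [take_poly 1 p](_ : _ = 0) ?add0r //.
by apply/polyP => -[|i]; rewrite coef_take_poly coef0.
Qed.

Lemma poly_divXY (B : comNzRingType) (F : {poly {poly B}}) :
  F`_0 = 0 -> (swapXY F)`_0 = 0 -> exists R, F = 'X%:P * 'X * R.
Proof.
move=> /poly_divX [q ->] s0.
have : (swapXY q)`_0 = 0.
  apply/polyP => j; have : ((swapXY (q * 'X))`_0)`_j.+1 = 0 by rewrite s0 coef0.
  by rewrite !coef_swapXY coefMX coef0.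
move=> /poly_divX [r E]; exists (swapXY r).
have -> : q = swapXY r * 'X%:P.
  by rewrite -[LHS]swapXYK E rmorphM /= swapXY_X.
by rewrite [RHS]mulrC mulrA.
Qed.

(* Substitutes [q = u v], where [u] is the inner variable of [{poly {poly B}}] and
   [v] the outer one. *)
Definition tau (B : comNzRingType) : {poly B} -> {poly {poly B}} :=
  horner_map (polyC \o polyC) ('X%:P * 'X).
HB.instance Definition _ (B : comNzRingType) := GRing.RMorphism.on (@tau B).

Lemma coef_tau (B : comNzRingType) (p : {poly B}) e :
  (tau p)`_e = (p`_e)%:P * 'X^e.
Proof.
elim/poly_ind: p e => [|p a IH] e; first by rewrite rmorph0 !coef0 polyC0 mul0r.
rewrite rmorphD rmorphM /= /tau !horner_mapC horner_mapX -/(tau p) /=.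
rewrite mulrA !coefD !coefMX !coefC; case: e => [|e] /=.
  by rewrite expr0 mulr1 add0r add0r.
by rewrite !addr0 coefMC IH exprSr mulrA.
Qed.

(* The conic [u x + zeta + v y] with [u v = q] and [zeta] a function of [q]. *)
Definition conic (B : comNzRingType) (n : nat) (x : 'I_n -> B)
    (zeta : 'I_n -> {poly B}) (y : 'I_n -> B) (l : 'I_n) : {poly {poly B}} :=
  ('X * (x l)%:P)%:P + tau (zeta l) + (y l)%:P%:P * 'X.

Lemma swap_conic (B : comNzRingType) (n : nat) (x : 'I_n -> B)
    (zeta : 'I_n -> {poly B}) (y : 'I_n -> B) l :
  swapXY (conic x zeta y l) = conic y zeta x l.
Proof.
have swap_tau p : swapXY (@tau B p) = tau p.
  pose f : {rmorphism {poly B} -> {poly {poly B}}} := (@swapXY B \o @tau B)%FUN.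
  rewrite -[LHS]/(f p); apply: poly_unique => [a|].
    by rewrite /f /= /tau horner_mapC /= swapXY_polyC map_polyC.
  rewrite /f /= /tau horner_mapX rmorphM /= swapXY_X swapXY_polyC map_polyX.
  by rewrite mulrC.
rewrite /conic !rmorphD !rmorphM /= swap_tau !swapXY_polyC swapXY_X.
rewrite !map_polyX !map_polyC /=; ring.
Qed.

Lemma conic_coef0 (B : comNzRingType) (n : nat) (x : 'I_n -> B)
    (zeta : 'I_n -> {poly B}) (y : 'I_n -> B) l :
  (conic x zeta y l)`_0 = line_pt (fun l => (zeta l)`_0) x l.
Proof.
rewrite /conic !coefD coefC coef_tau coefMX expr0 mulr1 addr0 /line_pt.
by rewrite addrC mulrC.
Qed.

(** The term [tau (zeta l)] has weight 0, as [u v] does. The resulting weight of an equation on the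
    conic bounds the degree of its error terms. *)
Lemma weighted_conic (B : comNzRingType) (n : nat) (x : 'I_n -> B)
    (zeta : 'I_n -> {poly B}) (y : 'I_n -> B) l :
  weighted 1 (x l) (conic x zeta y l).
Proof.
rewrite /conic => e; rewrite !coefD coefC coef_tau coefMX; case: e => [|e] /=.
  rewrite expr0 mulr1 addr0 addn0; split.
    apply: leq_trans (size_polyD _ _) _; rewrite geq_max.
    rewrite (leq_trans (size_polyMleq _ _)) ?size_polyX /=.
      by rewrite size_polyC (leq_trans (leq_b1 _)).
    by rewrite size_polyC ltnS leq_b1.
  by rewrite coefXM !coefC /= ?addr0.
rewrite add0r coefC; set y' := if _ then _ else _.
have sy : (size y' <= 1)%N.
  by rewrite /y'; case: ifP => _; rewrite ?size_poly0 ?size_polyC ?leq_b1.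
have sz : (size ((((zeta l)`_(e.+1))%:P * 'X^(e.+1)) : {poly B})%R <= e.+2)%N.
  apply: leq_trans (size_polyMleq _ _) _; rewrite size_polyXn size_polyC.
  by case: (_ != 0).
split.
  apply: leq_trans (size_polyD _ _) _; rewrite geq_max.
  by apply/andP; split; [exact: leq_trans sz _|exact: leq_trans sy _].
rewrite coef0 add0r coefMXn ltnNge leq_addl /= addnK coefC /= add0r.
by rewrite nth_default // (leq_trans sy).
Qed.

Section Deformation.
Variables (K : closedFieldType) (L : fieldType) (iota : {rmorphism K -> L}).
Variables (n m c : nat) (G : 'I_m -> {mpoly K[n]}) (d : 'I_m -> nat).
Hypothesis L0 : [pchar L] =i pred0.
Hypothesis G_homog : forall i, (0 < d i)%N /\ G i \is (d i).-homog.
Hypothesis rel_ideal : forall (a : 'I_c -> 'I_m) (b : 'I_c -> 'I_n) s l j,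
  exists M, gen_ideal G ('X_j ^+ M * jac_rel G a b s l).
Hypothesis cover : forall l, exists M
   (h : {ffun 'I_c -> 'I_m} * {ffun 'I_c -> 'I_n} -> {mpoly K[n]})
   (g : 'I_m -> {mpoly K[n]}),
  'X_l ^+ M = \sum_ab h ab * jac_minor G ab.1 ab.2 + \sum_i g i * G i.

Definition diff (B : comNzRingType) (j : {rmorphism K -> B}) (p w : 'I_n -> B)
   (i : 'I_m) : B := \sum_l mmap j p (G i)^`M(l) * w l.

Lemma diffD (B : comNzRingType) (j : {rmorphism K -> B}) p w w' i :
  diff j p (fun l => w l + w' l) i = diff j p w i + diff j p w' i.
Proof.
by rewrite /diff -big_split; apply: eq_bigr => l _; rewrite mulrDr.
Qed.

Lemma diffZ (B : comNzRingType) (j : {rmorphism K -> B}) p w s i :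
  diff j p (fun l => s * w l) i = s * diff j p w i.
Proof.
by rewrite /diff mulr_sumr; apply: eq_bigr => l _; rewrite mulrCA.
Qed.

Lemma diff_ext (B : comNzRingType) (j : {rmorphism K -> B}) p w w' i :
  w =1 w' -> diff j p w i = diff j p w' i.
Proof. by move=> E; apply: eq_bigr => l _; rewrite E. Qed.

Lemma diff_morph (B C : comNzRingType) (j : {rmorphism K -> B}) p w i
    (t : {rmorphism B -> C}) :
  t (diff j p w i) = diff (t \o j) (t \o p) (t \o w) i.
Proof.
rewrite /diff rmorph_sum; apply: eq_bigr => l _ /=.
by rewrite rmorphM /= mmap_comp.
Qed.

Lemma diff_line_top (z x : 'I_n -> L) (r : 'I_n -> {poly L}) e i :
  (forall l, size (r l) <= e.+1)%N ->
  (diff (polyC \o iota) (line_pt z x) r i)`_((d i).-1 + e) =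
  diff iota x (fun l => (r l)`_e) i.
Proof.
move=> re; rewrite /diff coef_sum; apply: eq_bigr => l _.
have [s t] := mmap_line_top iota z x (dhomog_mderiv l (G_homog i).2).
by rewrite coefM_top // t.
Qed.

Lemma jac_rel_zero (p : 'I_n -> L) (a : 'I_c -> 'I_m) (b : 'I_c -> 'I_n) s l :
  (exists j, p j != 0) -> (forall i, mmap iota p (G i) = 0) ->
  mmap iota p (jac_rel G a b s l) = 0.
Proof.
move=> [j pj] Gp; have [M [h E]] := rel_ideal a b s l j.
have := congr1 (mmap iota p) E; rewrite (rmorph_sum (mmap _ _)) big1.
  rewrite rmorphM rmorphXn /= mmapX mmap1U => /eqP.
  by rewrite mulf_eq0 expf_eq0 (negPf pj) andbF => /eqP.
by move=> i _; rewrite /= rmorphM /= Gp mulr0.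
Qed.

Definition jacL (p : 'I_n -> L) : 'M[L]_(m, n) :=
  \matrix_(i, l) mmap iota p (G i)^`M(l).

Lemma jac_minorL p (a : 'I_c -> 'I_m) (b : 'I_c -> 'I_n) :
  mmap iota p (jac_minor G a b) = \det (mxsub a b (jacL p)).
Proof.
rewrite /jac_minor -det_map_mx; congr (\det _).
by apply/matrixP => j k; rewrite !mxE.
Qed.

(** Smoothness at points with coordinates in [L], where the hypotheses on X do not apply directly.
    Polynomial identities carry it over: [rel_ideal] bounds the rank from above, and [cover]
    provides a nonzero minor. *)
Lemma jacL_rank p : (exists j, p j != 0) -> (forall i, mmap iota p (G i) = 0) ->
  \rank (jacL p) = c.
Proof.
move=> p0 Gp; have [j pj] := p0.
have [M [h [g E]]] := cover j.
have [[a b] /= D] : exists ab : {ffun 'I_c -> 'I_m} * {ffun 'I_c -> 'I_n},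
    mmap iota p (jac_minor G ab.1 ab.2) != 0.
  apply: contrapT => none.
  have := congr1 (mmap iota p) E; rewrite rmorphD !(rmorph_sum (mmap _ _)).
  rewrite !big1 ?addr0 => [/eqP|i _|ab _] /=.
  - by rewrite rmorphXn /= mmapX mmap1U expf_eq0 (negPf pj) andbF.
  - by rewrite rmorphM /= Gp mulr0.
  - have [D0|D] := eqVneq (mmap iota p (jac_minor G ab.1 ab.2)) 0.
      by rewrite rmorphM /= D0 mulr0.
    by case: none; exists ab.
have dA : \det (mxsub a b (jacL p)) != 0 by rewrite -jac_minorL.
apply/eqP; rewrite eqn_leq; apply/andP; split.
  have MR : (jacL p <= rowsub a (jacL p))%MS.
    apply/row_subP => s.
    pose w : 'rV[L]_c := \row_k (mmap iota p (jac_coef G a b s k) /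
       mmap iota p (jac_minor G a b)).
    have -> : row s (jacL p) = w *m rowsub a (jacL p).
      apply/rowP => l; rewrite !mxE.
      have /eqP := jac_rel_zero a b s l p0 Gp.
      rewrite /jac_rel rmorphM rmorphB rmorphM /= mulf_eq0 (negPf D) /= subr_eq0.
      move=> /eqP E'; apply: (mulfI D); rewrite E'.
      rewrite (rmorph_sum (mmap _ _)) mulr_sumr; apply: eq_bigr => k _ /=.
      by rewrite rmorphM /= !mxE mulrA [_ * (_ / _)]mulrC divfK.
    exact: submxMl.
  exact: leq_trans (mxrankS MR) (rank_leq_row _).
have uA : mxsub a b (jacL p) \in unitmx by rewrite unitmxE unitfE.
rewrite -{1}(mxrank_unit uA).
have -> : mxsub a b (jacL p) = rowsub a 1%:M *m jacL p *m colsub b 1%:M.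
  by rewrite mul_rowsub_mx mul1mx mulmx_colsub mulmx1 -mxsub_comp.
by apply: leq_trans (mxrankM_maxl _ _) _; exact: mxrankM_maxr.
Qed.

Section Branch.
Variables z x : 'I_n -> L.
Hypothesis zx_line : forall i, mmap (polyC \o iota) (line_pt z x) (G i) = 0.
Hypothesis zx_indep : exists l l', z l * x l' - z l' * x l != 0.
Hypothesis zx_free : forall v, (forall i, diff iota x v i = 0) ->
  exists w, forall i, diff (polyC \o iota) (line_pt z x) (line_pt w v) i = 0.

Let image (R : 'I_m -> {poly L}) := exists r : 'I_n -> {poly L},
  forall i, diff (polyC \o iota) (line_pt z x) r i = R i.

Let image_ideal R : ideal_set [set q | image (fun i => q * R i)].
Proof.
split.
- exists (fun=> 0) => i; rewrite mul0r /diff big1 // => l _; exact: mulr0.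
- move=> q q' [r rE] [r' rE']; exists (fun l => r l + r' l) => i.
  by rewrite diffD rE rE' mulrDl.
- move=> e q [r rE]; exists (fun l => e * r l) => i.
  by rewrite diffZ rE mulrA.
Qed.

(** Cramer's solution: the adjugate applied to the entries [R (a k)] and placed in the columns
    [b j]. The relations make it fit the other rows. *)
Let minor_image (R : 'I_m -> {poly L}) (a : 'I_c -> 'I_m) (b : 'I_c -> 'I_n) :
  let D := mmap (polyC \o iota) (line_pt z x) (jac_minor G a b) in
  (D != 0 -> forall s, D * R s =
    \sum_t mmap (polyC \o iota) (line_pt z x) (jac_coef G a b s t) * R (a t)) ->
  image (fun i => D * R i).
Proof.
move=> D DR; have [D0|Dn0] := eqVneq D 0.
  exists (fun=> 0) => i; rewrite D0 mul0r /diff big1 // => l _; exact: mulr0.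
pose E := mmap (polyC \o iota) (line_pt z x).
exists (fun l => \sum_(j | b j == l) \sum_k E (\adj (jac_mx G a b) j k) * R (a k)) => s.
rewrite (DR Dn0) /diff -/E.
rewrite (eq_bigr (fun l => \sum_(j | b j == l) E (G s)^`M(b j) *
    \sum_k E (\adj (jac_mx G a b) j k) * R (a k))); last first.
  by move=> l _; rewrite mulr_sumr; apply: eq_bigr => j /eqP ->.
transitivity (\sum_j E (G s)^`M(b j) *
    \sum_k E (\adj (jac_mx G a b) j k) * R (a k)).
  by rewrite [RHS](partition_big b xpredT).
rewrite (eq_bigr (fun j => \sum_k E ((G s)^`M(b j) * \adj (jac_mx G a b) j k) * R (a k))).
  rewrite exchange_big; apply: eq_bigr => k _ /=.
  by rewrite -mulr_suml /jac_coef /E (rmorph_sum (mmap _ _)).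
by move=> j _; rewrite mulr_sumr; apply: eq_bigr => k _; rewrite /E rmorphM mulrA.
Qed.

(** Since [R i] has degree less than [d i], the top coefficients of [r] form a tangent vector at
    [x]. By [zx_free] it extends to a solution, of degree at most 1, of the homogeneous system, and
    the multiple of this by ['X^e] cancels them. *)
Let reduce_degree (R : 'I_m -> {poly L}) e (r : 'I_n -> {poly L}) : (forall i, size (R i) <= d i)%N ->
  (forall l, size (r l) <= e.+1)%N ->
  (forall i, diff (polyC \o iota) (line_pt z x) r i = R i) ->
  exists w : 'I_n -> L,
    forall i, diff (polyC \o iota) (line_pt z x) (fun l => (w l)%:P) i = R i.
Proof.
move=> Rd; elim: e r => [|e IH] r re rR.
  exists (fun l => (r l)`_0) => i; rewrite -rR; apply: diff_ext => l.
  by rewrite -size1_polyC.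
have top i : diff iota x (fun l => (r l)`_e.+1) i = 0.
  rewrite -(diff_line_top z x i re) rR nth_default //.
  apply: leq_trans (Rd i) _; have [d0 _] := G_homog i.
  by rewrite addnS -addSn prednK // leq_addr.
have [w wP] := zx_free top.
pose r' l := r l + (- 'X^e) * line_pt w (fun l => (r l)`_e.+1) l.
apply: (IH r') => [l|i].
  apply/leq_sizeP => j ej; rewrite /r' coefD mulNr coefN mulrC coefMXn.
  rewrite ltnNge (leq_trans (leqnSn e) ej) /= /line_pt coefD coefC coefMX coefC.
  move: ej; rewrite leq_eqVlt => /orP [/eqP <-|ej].
    by rewrite subSnn /= add0r subrr.
  rewrite [(r l)`_j]nth_default ?(leq_trans (re l)) // add0r.
  have -> : (j - e)%N = (j - e.+2).+2 by move: ej; lia.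
  by rewrite /= add0r oppr0.
rewrite diffD [X in _ + X]diffZ rR.
by rewrite (_ : diff _ _ _ _ = 0) ?mulr0 ?addr0 //; exact: wP.
Qed.

(** The multipliers that bring [R] into the image form an ideal. It contains the minors, hence
    powers of all coordinates of the line, hence 1, because two coordinates are coprime; then the
    degree of the solution is lowered to 0. *)
Lemma branch_lift (R : 'I_m -> {poly L}) :
  (forall i, size (R i) <= d i)%N ->
  (forall (a : 'I_c -> 'I_m) (b : 'I_c -> 'I_n),
    let D := mmap (polyC \o iota) (line_pt z x) (jac_minor G a b) in
    D != 0 -> forall s, D * R s =
    \sum_t mmap (polyC \o iota) (line_pt z x) (jac_coef G a b s t) * R (a t)) ->
  exists w : 'I_n -> L,
    forall i, diff (polyC \o iota) (line_pt z x) (fun l => (w l)%:P) i = R i.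
Proof.
move=> Rd RD; have [I0 ID IM] := image_ideal R.
have power l : exists M, image (fun i => line_pt z x l ^+ M * R i).
  have [M [h [g E]]] := cover l; exists M.
  have -> : line_pt z x l ^+ M = \sum_ab mmap (polyC \o iota) (line_pt z x) (h ab) *
      mmap (polyC \o iota) (line_pt z x) (jac_minor G ab.1 ab.2).
    have := congr1 (mmap (polyC \o iota) (line_pt z x)) E.
    rewrite rmorphXn rmorphD !(rmorph_sum (mmap _ _)) /= mmapX mmap1U => ->.
    rewrite [X in _ + X]big1 ?addr0 => [|i _]; last by rewrite rmorphM /= zx_line mulr0.
    by apply: eq_bigr => ab _; rewrite rmorphM.
  apply: (ideal_sum _ (image_ideal R)) => ab _; apply: IM.
  exact: minor_image (RD ab.1 ab.2).
have [l [l' zx0]] := zx_indep.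
have [M IMl] := power l; have [M' IMl'] := power l'.
have cop : coprimep (line_pt z x l ^+ M) (line_pt z x l' ^+ M').
  apply/coprimep_expl/coprimep_expr.
  apply/Bezout_eq1_coprimepP; set D := z l * x l' - z l' * x l in zx0.
  (* Eliminating ['X] between two coordinates of the line leaves the minor [D]. *)
  exists ((x l' / D)%:P, (- x l / D)%:P) => /=; rewrite /line_pt.
  have -> : 1 = (D / D)%:P :> {poly L} by rewrite divff.
  by rewrite /D !polyCM !polyCB !polyCN !polyCM; ring.
move/Bezout_eq1_coprimepP: cop => [[u v] /= uv].
have [r rR] : image R.
  have : image (fun i => (u * line_pt z x l ^+ M + v * line_pt z x l' ^+ M') * R i).
    by apply: (ID); exact: IM.
  by rewrite uv => -[r rE]; exists r => i; rewrite rE mul1r.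
apply: (reduce_degree (e := \max_l size (r l)) (r := r)) => // k.
by apply: leqW; exact: (leq_bigmax k).
Qed.

Lemma branch_step (y : 'I_n -> L) (zeta : 'I_n -> {poly L}) k
    (R : 'I_m -> {poly {poly L}}) :
  (forall l, (zeta l)`_0 = z l) -> (0 < k)%N ->
  (forall i, mmap (polyC \o (polyC \o iota)) (conic x zeta y) (G i) =
     ('X%:P * 'X) ^+ k * R i) ->
  exists w : 'I_n -> L, forall i,
    diff (polyC \o iota) (line_pt z x) (fun l => (w l)%:P) i = - (R i)`_0.
Proof.
move=> zeta0 k0 GR.
have p0E l : (conic x zeta y l)`_0 = line_pt z x l.
  by rewrite conic_coef0 /line_pt zeta0.
apply: (@branch_lift (fun i => - (R i)`_0)) => [i|a b D D0 s].
  (* In outer degree [k] the error is the [k]-th power of the inner variable times the constant term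
     of [R i]. The weight bounds its degree by [d i + k], and for positive [k] the bound is not
     attained. *)
  have W := weighted_mmap iota (G_homog i).2 (weighted_conic x zeta y).
  have := W k; rewrite GR exprMn -mulrA [_ ^+ k * R i]mulrC mulrA coefMXn ltnn subnn.
  rewrite -polyC_exp coefCM gtn_eqF // size_polyN => -[sz top].
  have [->|R0] := eqVneq (R i)`_0 0; first by rewrite size_poly0.
  move: top sz; rewrite mulrC coefMXn ltnNge leq_addl addnK /= => top.
  rewrite size_mulXn // addnC -addSn leq_add2r => sz.
  apply/leq_sizeP => j; rewrite leq_eqVlt => /orP [/eqP <- //|dj].
  by rewrite nth_default // (leq_trans sz).
have cB : [pchar {poly L}] =i pred0 by move=> q; rewrite pchar_poly L0.
(* The conic is now an arc in the outer variable, over the polynomials in the inner one; it starts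
   at the point of the line and its error has order [k]. *)
pose r i := ('X ^+ k)%:P * R i.
have Gr i : mmap (polyC \o (polyC \o iota)) (conic x zeta y) (G i) = 'X^k * r i.
  by rewrite GR exprMn -polyC_exp /r mulrCA mulrA.
have ex : exists j, (conic x zeta y j)`_0 != 0.
  have [l [l' zx0]] := zx_indep; apply: contrapT => none.
  have z0 j : z j = 0.
    have : line_pt z x j = 0.
      by rewrite -p0E; apply/eqP; apply: contrapT => /negP ?; apply: none; exists j.
    move=> /(congr1 (fun q : {poly L} => q.[0])).
    by rewrite /line_pt !hornerE ?mulr0 ?addr0.
  by move: zx0; rewrite !z0 !mul0r subrr eqxx.
have evE f : mmap (polyC \o iota) (fun l => (conic x zeta y l)`_0) f =
    mmap (polyC \o iota) (line_pt z x) f by apply: mmap_congr.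
have D0' : mmap (polyC \o iota) (fun l => (conic x zeta y l)`_0) (jac_minor G a b) != 0.
  by rewrite evE.
have := transversal_relation cB (rel_ideal a b) k0 Gr ex D0' s.
rewrite evE -/D /r coefCM => E.
apply: (@mulfI _ ('X ^+ k : {poly L})); first by rewrite expf_neq0 ?polyX_eq0.
rewrite mulrCA [X in D * X]mulrN mulrN E -sumrN mulr_sumr.
by apply: eq_bigr => t _; rewrite evE coefCM !mulrN mulrCA.
Qed.

End Branch.

Lemma linear_diff_vspace (k : nat) (B : comNzRingType) (j : {rmorphism K -> B})
    (t : {rmorphism L -> B}) (p : 'I_n -> B) (f : 'rV[L]_k -> 'I_n -> B) :
  (forall l, f 0 l = 0) ->
  (forall a u v l, f (a *: u + v) l = t a * f u l + f v l) ->
  exists U : {vspace 'rV[L]_k}, forall v, v \in U <-> forall i, diff j p (f v) i = 0.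
Proof.
move=> f0 fD; apply: linear_predicate_vspace => [i|a u v fu fv i].
  by rewrite (diff_ext _ _ _ (w' := fun=> 0)) // /diff big1 // => l _; exact: mulr0.
rewrite (diff_ext _ _ _ (fD a u v)) (diffD _ _ (fun l => t a * f u l)) diffZ.
by rewrite fu fv mulr0 addr0.
Qed.

Lemma diff_line0 (z x w v : 'I_n -> L) i :
  (diff (polyC \o iota) (line_pt z x) (line_pt w v) i)`_0 = diff iota z w i.
Proof.
rewrite -horner_coef0 -horner_evalE (diff_morph _ _ _ _ (horner_eval (0 : L))).
apply: eq_bigr => l _; congr (_ * _).
  apply: mmap_congr => [a|j] /=; first by rewrite horner_evalE hornerC.
  by rewrite horner_evalE /line_pt !hornerE ?mulr0 ?addr0.
by rewrite /= horner_evalE /line_pt !hornerE ?mulr0 ?addr0.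
Qed.

Lemma diff_line1 (z x w v : 'I_n -> L) i :
  diff (polyC \o iota) (line_pt z x) (line_pt w v) i = 0 -> diff iota x v i = 0.
Proof.
move=> E; have := @diff_line_top z x (line_pt w v) 1 i _.
rewrite E coef0 => ->; last first.
  move=> l; apply: leq_trans (size_polyD _ _) _; rewrite geq_max size_polyC.
  rewrite (leq_trans (leq_b1 _)) //=.
  apply: leq_trans (size_polyMleq _ _) _; rewrite size_polyX size_polyC addn2 /=.
  by case: (_ != 0).
by apply: diff_ext => l; rewrite /line_pt coefD coefC coefMX coefC /= add0r.
Qed.

Lemma line_zeros (z x : 'I_n -> L) :
  (forall i, mmap (polyC \o iota) (line_pt z x) (G i) = 0) ->
  forall i, mmap iota z (G i) = 0 /\ mmap iota x (G i) = 0.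
Proof.
move=> zx i; split.
  rewrite -[RHS](horner0 0) -(zx i) -horner_evalE (mmap_comp _ _ (horner_eval (0 : L))).
  apply: mmap_congr => [a|j] /=; first by rewrite horner_evalE hornerC.
  by rewrite horner_evalE /line_pt !hornerE ?mulr0 ?addr0.
have [_ <-] := mmap_line_top iota z x (G_homog i).2.
by rewrite zx coef0.
Qed.

Section TwoBranches.
Variables x y z : 'I_n -> L.
Hypothesis zx_line : forall i, mmap (polyC \o iota) (line_pt z x) (G i) = 0.
Hypothesis zy_line : forall i, mmap (polyC \o iota) (line_pt z y) (G i) = 0.
Hypothesis zx_indep : exists l l', z l * x l' - z l' * x l != 0.
Hypothesis zy_indep : exists l l', z l * y l' - z l' * y l != 0.
Hypothesis free : forall v1 v2,
  (forall i, diff iota x v1 i = 0) -> (forall i, diff iota y v2 i = 0) ->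
  exists w, (forall i, diff (polyC \o iota) (line_pt z x) (line_pt w v1) i = 0) /\
            (forall i, diff (polyC \o iota) (line_pt z y) (line_pt w v2) i = 0).

Let diff0 p i : diff iota p (fun=> 0) i = 0.
Proof. by rewrite /diff big1 // => l _; rewrite mulr0. Qed.

Let kernel_dim p (T : {vspace 'rV[L]_n}) :
  (exists j, p j != 0) -> (forall i, mmap iota p (G i) = 0) ->
  (forall v, v \in T <-> forall i, diff iota p (v 0) i = 0) -> \dim T = (n - c)%N.
Proof.
move=> p0 Gp Tp; rewrite -(jacL_rank p0 Gp) -mxrank_tr; apply: dim_kernel => v.
rewrite Tp; split=> [vi|/rowP vi i].
  apply/rowP => i; rewrite !mxE -[RHS](vi i).
  by apply: eq_bigr => l _; rewrite !mxE mulrC.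
have := vi i; rewrite !mxE => <-.
by apply: eq_bigr => l _; rewrite !mxE mulrC.
Qed.

(** Let [S] be the tangent fields of degree at most 1 along the line. By [free] they reach all
    tangent vectors at [y]; those vanishing at [z] inject into those vanishing at [y]; and the
    tangent spaces at [z] and [y] have equal dimension. So [S] also maps onto the tangent space at
    [z]. *)
Lemma tangent_section w : (forall i, diff iota z w i = 0) ->
  exists v, forall i, diff (polyC \o iota) (line_pt z y) (line_pt w v) i = 0.
Proof.
move=> zw.
pose f (s : 'rV[L]_(n + n)) := line_pt (lsubmx s 0) (rsubmx s 0).
have [||S SP] := @linear_diff_vspace (n + n) _ (polyC \o iota) polyC (line_pt z y) f.
- by move=> l; rewrite /f /line_pt !mxE polyC0 mul0r addr0.
- by move=> a u v l; rewrite /f /line_pt !mxE !polyCD !polyCM; ring.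
have [||Tz TzP] := @linear_diff_vspace n _ iota idfun z (fun s => s 0).
- by move=> l; rewrite mxE.
- by move=> a u v l; rewrite !mxE.
have [||Ty TyP] := @linear_diff_vspace n _ iota idfun y (fun s => s 0).
- by move=> l; rewrite mxE.
- by move=> a u v l; rewrite !mxE.
have y0 : exists j, y j != 0.
  have [l [l' zy]] := zy_indep; apply: contrapT => none.
  have y0 j : y j = 0 by apply/eqP; apply: contrapT => /negP ?; apply: none; exists j.
  by move: zy; rewrite !y0 !mulr0 subrr eqxx.
have z0 : exists j, z j != 0.
  have [l [l' zy]] := zy_indep; apply: contrapT => none.
  have z0 j : z j = 0 by apply/eqP; apply: contrapT => /negP ?; apply: none; exists j.
  by move: zy; rewrite !z0 !mul0r subrr eqxx.
have dTz := kernel_dim z0 (fun i => (line_zeros zy_line i).1) TzP.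
have dTy := kernel_dim y0 (fun i => (line_zeros zy_line i).2) TyP.
pose pr1 : 'Hom('rV[L]_(n + n), 'rV[L]_n) := linfun (mulmxr (col_mx 1%:M 0)).
pose pr2 : 'Hom('rV[L]_(n + n), 'rV[L]_n) := linfun (mulmxr (col_mx 0 1%:M)).
pose sw : 'Hom('rV[L]_(n + n), 'rV[L]_(n + n)) :=
  linfun (mulmxr (block_mx 0 1%:M 1%:M 0)).
have pr1E s : pr1 s = lsubmx s.
  by rewrite lfunE /= -{1}[s]hsubmxK mul_row_col mulmx1 mulmx0 addr0.
have pr2E s : pr2 s = rsubmx s.
  by rewrite lfunE /= -{1}[s]hsubmxK mul_row_col mulmx1 mulmx0 add0r.
have swE s : sw s = row_mx (rsubmx s) (lsubmx s).
  rewrite lfunE /= -{1}[s]hsubmxK mul_row_block.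
  by rewrite !mulmx1 !mulmx0 addr0 add0r.
have sub1 : (pr1 @: S <= Tz)%VS.
  apply/subvP => _ /memv_imgP [s /SP sS ->]; apply/TzP => i.
  by rewrite pr1E -(diff_line0 z y _ (rsubmx s 0)) sS coef0.
have sub2 : (Ty <= pr2 @: S)%VS.
  apply/subvP => v /TyP Tv.
  have [w0 [_ w0P]] := free (fun i => diff0 x i) Tv.
  apply/memv_imgP; exists (row_mx (\row_l w0 l) v); last by rewrite pr2E row_mxKr.
  apply/SP => i; rewrite /f row_mxKl row_mxKr -[RHS](w0P i).
  by apply: diff_ext => l; rewrite /line_pt mxE.
have swdim : (\dim (S :&: lker pr1) <= \dim (S :&: lker pr2))%N.
  rewrite -[X in (X <= _)%N](limg_dim_eq (f := sw)).
    apply: dimvS; apply/subvP => _ /memv_imgP [s /memv_capP [/SP sS s1] ->].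
    move: s1; rewrite memv_ker pr1E => /eqP s1.
    apply/memv_capP; split; last by rewrite memv_ker pr2E swE row_mxKr s1.
    apply/SP => i; rewrite /f swE row_mxKl row_mxKr s1.
    have := sS i; rewrite /f s1.
    have -> : diff (polyC \o iota) (line_pt z y) (line_pt ((0 : 'rV[L]_n) 0) (rsubmx s 0)) i =
      'X * diff (polyC \o iota) (line_pt z y) (line_pt (rsubmx s 0) ((0 : 'rV[L]_n) 0)) i.
      rewrite -diffZ; apply: diff_ext => l.
      by rewrite /line_pt mxE polyC0 mul0r add0r addr0 mulrC.
    by move/eqP; rewrite mulf_eq0 polyX_eq0 => /eqP.
  apply/eqP; rewrite -subv0; apply/subvP => s /memv_capP [_].
  rewrite memv_ker swE memv0 => /eqP s0.
  have := row_mxKl (rsubmx s) (lsubmx s); have := row_mxKr (rsubmx s) (lsubmx s).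
  by rewrite s0 !linear0 => l0 r0; rewrite -[s]hsubmxK -l0 -r0 row_mx0.
have E1 := limg_ker_dim pr1 S; have E2 := limg_ker_dim pr2 S.
have TzS : (pr1 @: S)%VS = Tz.
  apply/eqP; rewrite eqEdim sub1 /=; have le := dimvS sub2.
  have arith (k1 i1 k2 i2 s t : nat) : (k1 + i1 = s -> k2 + i2 = s -> k1 <= k2 ->
    t <= i2 -> t <= i1)%N by lia.
  by apply: arith E1 E2 swdim _; rewrite dTz -dTy.
have /memv_imgP [s /SP sS wE] : (\row_l w l) \in (pr1 @: S)%VS.
  rewrite TzS; apply/TzP => i; rewrite -[RHS](zw i).
  by apply: diff_ext => l; rewrite mxE.
exists (rsubmx s 0) => i; rewrite -[RHS](sS i); apply: diff_ext => l.
rewrite /f /line_pt.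
by move/rowP: wE => /(_ l); rewrite mxE pr1E => ->.
Qed.

Lemma tangent_split w : (forall i, diff iota z w i = 0) ->
  exists p1 p2 : 'I_n -> L, [/\ forall l, w l = p1 l + p2 l,
    forall i, diff (polyC \o iota) (line_pt z x) (fun l => (p1 l)%:P) i = 0 &
    forall i, diff (polyC \o iota) (line_pt z y) (fun l => (p2 l)%:P) i = 0].
Proof.
move=> /tangent_section [v wv].
have Tv i : diff iota y v i = 0 by apply: diff_line1 (wv i).
(* With [x] fixed and [y] moved along [v], the meeting point moves by [p1]. So [p1] is a constant
   tangent field on the first line and, after subtraction from the field of [w] and [v], [w - p1] is
   one on the second. *)
have [p1 [p1x p1y]] := free (fun i => diff0 x i) Tv.
exists p1, (fun l => w l - p1 l); split=> [l|i|i].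
- by rewrite addrC subrK.
- rewrite -[RHS](p1x i); apply: diff_ext => l.
  by rewrite /line_pt polyC0 mul0r addr0.
- have := diffD (polyC \o iota) (line_pt z y) (line_pt w v) (fun l => (-1) * line_pt p1 v l) i.
  rewrite diffZ wv p1y mulr0 addr0 => <-.
  by apply: diff_ext => l; rewrite /line_pt polyCB; ring.
Qed.

Lemma truncated_conic k : exists2 zeta : 'I_n -> {poly L},
  (forall l, (zeta l)`_0 = z l) &
  forall i, exists R,
    mmap (polyC \o (polyC \o iota)) (conic x zeta y) (G i) = ('X%:P * 'X) ^+ k.+1 * R.
Proof.
have zx_free v : (forall i, diff iota x v i = 0) ->
    exists w, forall i, diff (polyC \o iota) (line_pt z x) (line_pt w v) i = 0.
  by move=> /free /(_ (fun i => diff0 y i)) [w [wx _]]; exists w.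
have zy_free v : (forall i, diff iota y v i = 0) ->
    exists w, forall i, diff (polyC \o iota) (line_pt z y) (line_pt w v) i = 0.
  by move=> /(free (fun i => diff0 x i)) [w [_ wy]]; exists w.
have ev0 (u v : 'I_n -> L) (zeta : 'I_n -> {poly L}) : (forall l, (zeta l)`_0 = z l) -> forall f,
    (mmap (polyC \o (polyC \o iota)) (conic u zeta v) f)`_0 =
    mmap (polyC \o iota) (line_pt z u) f.
  move=> zeta0 f; rewrite -horner_coef0 -horner_evalE.
  rewrite (mmap_comp _ _ (horner_eval (0 : {poly L}))); apply: mmap_congr => [a|l] /=.
    by rewrite horner_evalE hornerC.
  by rewrite horner_evalE horner_coef0 conic_coef0 /line_pt zeta0.
have swap_ev (u v : 'I_n -> L) (zeta : 'I_n -> {poly L}) f :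
    swapXY (mmap (polyC \o (polyC \o iota)) (conic u zeta v) f) =
    mmap (polyC \o (polyC \o iota)) (conic v zeta u) f.
  have := mmap_comp (polyC \o (polyC \o iota)) (conic u zeta v) (@swapXY L) f.
  move=> ->; apply: mmap_congr => [a|l].
    by rewrite /= swapXY_polyC map_polyC.
  exact: swap_conic.
have swap_uv : swapXY ('X%:P * 'X : {poly {poly L}}) = 'X%:P * 'X.
  by rewrite rmorphM /= swapXY_X swapXY_Y mulrC.
elim: k => [|k [zeta zeta0 zetaP]].
  have z0 l : ((z l)%:P : {poly L})`_0 = z l by rewrite coefC.
  (* Both lines lie in X, so the error vanishes on both axes and is divisible by [q]. *)
  exists (fun l => (z l)%:P) => // i; rewrite expr1.
  apply: poly_divXY; first by rewrite ev0.
  by rewrite swap_ev ev0.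
have [R RP] := choice zetaP.
have [w1 w1P] := branch_step zx_line zx_indep zx_free zeta0 (ltn0Sn k) RP.
have RP' i : mmap (polyC \o (polyC \o iota)) (conic y zeta x) (G i) =
    ('X%:P * 'X) ^+ k.+1 * swapXY (R i).
  by rewrite -swap_ev RP rmorphM rmorphXn /= swap_uv.
have [w2 w2P] := branch_step zy_line zy_indep zy_free zeta0 (ltn0Sn k) RP'.
have const (u w : 'I_n -> L) i :
    (diff (polyC \o iota) (line_pt z u) (fun l => (w l)%:P) i)`_0 = diff iota z w i.
  rewrite -(diff_line0 z u w (fun=> 0)).
  rewrite (diff_ext _ _ _ (w' := line_pt w (fun=> 0))) // => l.
  by rewrite /line_pt polyC0 mul0r addr0.
(* The branches ask for different corrections [w1] and [w2], but their errors agree at the common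
   point, so [w1 - w2] is tangent at [z] and can be shared out. *)
have [|p1 [p2 [p12 p1P p2P]]] := @tangent_split (fun l => w1 l + (-1) * w2 l).
  move=> i; rewrite diffD diffZ -(const x w1) -(const y w2) w1P w2P.
  by rewrite !coefN coef_swapXY; ring.
pose w l := w1 l - p1 l.
have wE l : w l = w2 l + p2 l.
  have := p12 l; rewrite mulN1r => /eqP; rewrite subr_eq => /eqP E.
  by rewrite /w E; ring.
have wx i : diff (polyC \o iota) (line_pt z x) (fun l => (w l)%:P) i = - (R i)`_0.
  rewrite -w1P -[RHS]addr0 -(mulr0 (-1)) -(p1P i) -diffZ -diffD.
  by apply: diff_ext => l; rewrite /w polyCB mulN1r.
have wy i : diff (polyC \o iota) (line_pt z y) (fun l => (w l)%:P) i =
    - (swapXY (R i))`_0.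
  rewrite -w2P -[RHS]addr0 -(p2P i) -diffD.
  by apply: diff_ext => l; rewrite wE polyCD.
have sum0 (u v : 'I_n -> L) i :
    (\sum_l mmap (polyC \o (polyC \o iota)) (conic u zeta v) (G i)^`M(l) *
       (w l)%:P%:P)`_0 = diff (polyC \o iota) (line_pt z u) (fun l => (w l)%:P) i.
  rewrite coef_sum; apply: eq_bigr => l _.
  by rewrite coef0M ev0 // coefC.
exists (fun l => zeta l + 'X^(k.+1) * (w l)%:P) => [l|i].
  by rewrite coefD zeta0 coefXnM /= addr0.
have conicE l : conic x (fun l => zeta l + 'X^(k.+1) * (w l)%:P) y l =
    conic x zeta y l + ('X%:P * 'X) ^+ k.+1 * (w l)%:P%:P.
  rewrite /conic (rmorphD (@tau L)) (rmorphM (@tau L)) (rmorphXn (@tau L)) /=.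
  rewrite [tau 'X]horner_mapX [tau (w l)%:P]horner_mapC /= addrA.
  by rewrite [LHS]addrAC.
have [r rE] := mmap_taylor (polyC \o (polyC \o iota)) (conic x zeta y)
   (fun l => (w l)%:P%:P) (('X%:P * 'X) ^+ k.+1) (G i).
rewrite (mmap_congr (j := polyC \o (polyC \o iota)) _ _ conicE) // rE RP.
set S := \sum_l _.
(* The linear term vanishes on both axes and gains a factor [q]; the quadratic remainder has order
   [2 (k + 1)], at least [k + 2]. *)
have [||Q QE] := @poly_divXY _ (R i + S).
- by rewrite coefD sum0 wx addrN.
- rewrite rmorphD coefD /=.
  have -> : swapXY S = \sum_l mmap (polyC \o (polyC \o iota)) (conic y zeta x)
      (G i)^`M(l) * (w l)%:P%:P.
    rewrite rmorph_sum; apply: eq_bigr => l _ /=.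
    by rewrite rmorphM /= swap_ev swapXY_polyC map_polyC.
  by rewrite sum0 wy addrN.
exists (Q + ('X%:P * 'X) ^+ k * r).
by rewrite -mulrDr QE !exprS; ring.
Qed.

End TwoBranches.

End Deformation.

(** * The generic pair of points *)

Section PairIdealGenerators.
Variables (K : closedFieldType) (N : nat) (X : set (proj_space K N)).
Local Notation poly := {mpoly K[N.+1]}.
Local Notation A := {mpoly K[N.+1 + N.+1]}.

Let leftM f g : pair_left (f * g) = pair_left f * pair_left g :> A.
Proof. exact: rmorphM. Qed.

Let rightM f g : pair_right (f * g) = pair_right f * pair_right g :> A.
Proof. exact: rmorphM. Qed.

Let tensor (s : seq (poly * poly)) : A :=
  \sum_(ab <- s) pair_left ab.1 * pair_right ab.2.

Let tensor_cons ab s : tensor (ab :: s) = pair_left ab.1 * pair_right ab.2 + tensor s.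
Proof. by rewrite /tensor big_cons. Qed.

Let tensorP F : exists s, F = tensor s.
Proof.
elim/mpoly_ring_ind: F => [a|k|F F' [s ->] [s' ->]|F F' [s ->] [s' ->]].
- exists [:: (a%:MP, 1)]; rewrite /tensor big_seq1 /= rmorph1 mulr1.
  by rewrite /pair_left mmapC.
- case: (split_ordP k) => l ->.
    exists [:: ('X_l, 1)]; rewrite /tensor big_seq1 /= rmorph1 mulr1.
    by rewrite /pair_left mmapX mmap1U.
  exists [:: (1, 'X_l)]; rewrite /tensor big_seq1 /= rmorph1 mul1r.
  by rewrite /pair_right mmapX mmap1U.
- by exists (s ++ s'); rewrite /tensor big_cat.
- exists [seq (p.1 * q.1, p.2 * q.2) | p <- s, q <- s'].
  rewrite /tensor big_allpairs_dep mulr_suml; apply: eq_bigr => p _.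
  rewrite mulr_sumr; apply: eq_bigr => q _ /=.
  by rewrite (leftM p.1 q.1) (rightM p.2 q.2); exact: mulrACA.
Qed.

(** Induction on the number of summands. A left factor [a] that is not zero at some [u0] of the cone
    is eliminated from the other summands, after which its partner belongs to the ideal of X. *)
Lemma pair_ideal_generated (J : set A) : ideal_set J ->
  (forall f, vanishing_ideal X f -> J (pair_left f) /\ J (pair_right f)) ->
  forall F, pair_ideal X F -> J F.
Proof.
move=> [J0 JD JM] JX F; have [s ->] := tensorP F.
have [k sk] := ubnP (size s); elim: k s sk => // k IH [_ _|[a b] s]; first by rewrite /tensor big_nil.
rewrite ltnS /= => sk; rewrite tensor_cons /= => sI.
have [Ia|nIa] := pselect (vanishing_ideal X a).
  apply: JD; first by rewrite mulrC; apply: JM; exact: (JX a Ia).1.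
  apply: IH => // u v Xu Xv; have := sI u v Xu Xv.
  rewrite mevalD (mevalM _ (pair_left a)) meval_pair_left.
  by move/vanishing_idealP: Ia => ->//; rewrite mul0r add0r.
have [u0 Xu0 au0] : exists2 u0, cone X u0 & a.@[u0 0] != 0.
  apply: contrapT => none; apply: nIa; apply/vanishing_idealP => u Xu.
  by apply/eqP; apply: contrapT => /negP ne; apply: none; exists u.
(* With this ratio all remaining left factors vanish at [u0], so evaluation there leaves only [b']
   times the value of [a]. *)
pose r (ab : poly * poly) := ab.1.@[u0 0] / a.@[u0 0].
pose b' := b + \sum_(ab <- s) (r ab)%:MP * ab.2.
pose s' := [seq (ab.1 - (r ab)%:MP * a, ab.2) | ab <- s].
have pC c : pair_left c%:MP = pair_right c%:MP :> A.
  by rewrite /pair_left /pair_right !mmapC.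
have E : pair_left a * pair_right b + tensor s = pair_left a * pair_right b' + tensor s'.
  rewrite /b' rmorphD mulrDr /= -!addrA; congr (_ + _).
  rewrite /tensor big_map (rmorph_sum (@pair_right K N.+1)) mulr_sumr -big_split.
  have arith (e1 e2 e3 e4 : A) : e1 * e4 = e2 * (e3 * e4) + (e1 - e3 * e2) * e4 by ring.
  apply: eq_bigr => ab _ /=.
  have -> : pair_left (ab.1 - (r ab)%:MP * a) = pair_left ab.1 - pair_left (r ab)%:MP * pair_left a :> A.
    by rewrite -(leftM (r ab)%:MP a); exact: rmorphB.
  by rewrite (rightM (r ab)%:MP ab.2) pC -arith.
have Ib' : vanishing_ideal X b'.
  apply/vanishing_idealP => v Xv.
  have := sI u0 v Xu0 Xv; rewrite mevalD mevalM meval_pair_left meval_pair_right.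
  rewrite (rmorph_sum (meval _)) /= => sum0.
  apply: (mulfI au0); rewrite mulr0 -[RHS]sum0 /b' mevalD mulrDr; congr (_ + _).
  rewrite (rmorph_sum (meval _)) mulr_sumr; apply: eq_bigr => ab _ /=.
  rewrite !mevalM mevalC meval_pair_left meval_pair_right /r mulrA.
  by rewrite [a.@[_] * _]mulrC divfK.
rewrite E; apply: JD; first by apply: JM; exact: (JX b' Ib').2.
apply: IH; first by rewrite size_map.
move=> u v Xu Xv; have := sI u v Xu Xv; rewrite E mevalD mevalM meval_pair_right.
by move/vanishing_idealP: Ib' => ->//; rewrite mulr0 add0r.
Qed.

End PairIdealGenerators.

Lemma not_proportional (F : fieldType) (n : nat) (u z : 'rV[F]_n) :
  u != 0 -> z \notin <[u]>%VS -> exists l l', z 0 l * u 0 l' - z 0 l' * u 0 l != 0.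
Proof.
move=> u0 zu; apply: contrapT => none.
have [l ul] : exists l, u 0 l != 0.
  apply: contrapT => none'; move/eqP: u0; apply; apply/rowP => l; rewrite mxE.
  by apply/eqP; apply: contrapT => /negP ul; apply: none'; exists l.
case/negP: zu; apply/vlineP; exists (z 0 l / u 0 l); apply/rowP => k.
rewrite !mxE; apply: (mulIf ul); rewrite mulrAC divfK //.
apply/eqP; rewrite -subr_eq0; apply: contrapT => /negP ne; apply: none.
by exists k, l.
Qed.

Section GenericPair.
Variables (K : closedFieldType) (N m n : nat) (X : set (proj_space K N)).
Variables (G : 'I_m -> {mpoly K[N.+1]}) (d : 'I_m -> nat).
Hypotheses (X_irr : irreducible_set X) (X_def : set_theoretically_defined G X).
Hypothesis G_degree : forall i, G i != 0 /\ G i \is (d i).-homog.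
Hypotheses (X_smooth : smooth_of_dimension X n)
  (X_scheme : scheme_theoretically_defined G X).
Local Notation rV := 'rV[K]_N.+1.
Local Notation A := {mpoly K[N.+1 + N.+1]}.
Let c := (N - n)%N.

(** The minors and the equations have no common zero but the origin; the Nullstellensatz turns this
    into an identity that makes sense over [L] too. *)
Lemma minors_cover l : exists M
   (h : {ffun 'I_c -> 'I_m} * {ffun 'I_c -> 'I_N.+1} -> {mpoly K[N.+1]})
   (g : 'I_m -> {mpoly K[N.+1]}),
  'X_l ^+ M = \sum_ab h ab * jac_minor G ab.1 ab.2 + \sum_i g i * G i.
Proof.
pose I := ({ffun 'I_c -> 'I_m} * {ffun 'I_c -> 'I_N.+1} + 'I_m)%type.
pose f (s : I) := match s with inl ab => jac_minor G ab.1 ab.2 | inr i => G i end.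
have [M [h E]] : exists M, gen_ideal f ('X_l ^+ M).
  apply: nullstellensatz; first exact: gen_ideal_set.
  move=> v fv; rewrite mevalXU; apply/eqP; apply: contrapT => /negP vl.
  pose u : rV := \row_i v i.
  have uv : u 0 =1 v by move=> i; rewrite mxE.
  have u0 : u != 0 by apply: contraNneq vl => u0; rewrite -uv u0 mxE.
  have Xu : cone X u.
    apply/(coneP X_irr X_def G_degree) => i; rewrite (meval_eq _ uv).
    by apply: fv; exact: (gen_ideal_gen f (inr i)).
  have [a [b D]] := jac_minor_neq0 X_irr X_def G_degree X_smooth X_scheme Xu u0.
  move/eqP: D; apply; rewrite (meval_eq _ uv); apply: fv.
  exact: (gen_ideal_gen f (inl (a, b))).
exists M, (fun ab => h (inl ab)), (fun i => h (inr i)).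
by rewrite E big_sumType.
Qed.

Variable t : A.
Hypothesis t_generic : ~ pair_ideal X t.
Hypothesis t_line : forall u v : rV, cone X u -> cone X v ->
   t.@[pair_pt (u 0) (v 0)] <> 0 ->
   [/\ u != 0, v != 0, exists i, on_line G i u v <> 0 &
   exists2 z, z != 0 & forall i, on_line G i u z = 0 /\ on_line G i v z = 0].

Lemma off_pair_ideal F : ~ pair_ideal X F -> exists u v, [/\ cone X u, cone X v &
  F.@[pair_pt (u 0) (v 0)] <> 0].
Proof.
move=> nF; apply: contrapT => none; apply: nF => u v Xu Xv.
by apply: contrapT => ne; apply: none; exists u, v.
Qed.

Lemma pair_ideal_1 : ~ pair_ideal X 1.
Proof.
have [u [v [Xu Xv _]]] := off_pair_ideal t_generic.
by move=> /(_ u v Xu Xv); rewrite meval1; apply/eqP; exact: oner_neq0.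
Qed.

(* The generic point of X x X, with the meeting point [z] of two lines of X through
   [x] and [y], over an extension of the function field of X x X. *)
Lemma generic_chain : exists (L : fieldType) (phi : {rmorphism {mpoly A[N.+1]} -> L}),
  let iota := (phi \o (@mpolyC N.+1 A \o @mpolyC (N.+1 + N.+1) K))%FUN in
  let x l := phi ('X_(lshift N.+1 l))%:MP in
  let y l := phi ('X_(rshift N.+1 l))%:MP in
  let z l := phi 'X_l in
  [/\ forall a, phi a%:MP = 0 <-> pair_ideal X a,
      (forall i, mmap (polyC \o iota) (line_pt z x) (G i) = 0) /\
      (forall i, mmap (polyC \o iota) (line_pt z y) (G i) = 0),
      exists l l', z l * x l' - z l' * x l != 0 &
      exists l l', z l * y l' - z l' * y l != 0].
Proof.
pose B := {mpoly A[N.+1]}.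
pose ev (u v z : rV) : B -> K := mmap (meval (pair_pt (u 0) (v 0))) (z 0).
pose I : set B := [set b | forall u v z : rV, cone X u -> cone X v ->
  (forall i, on_line G i z u = 0 /\ on_line G i z v = 0) -> ev u v z b = 0].
have I_ideal : ideal_set I.
  split=> [u v z _ _ _|a b Ia Ib u v z Xu Xv uz|a b Ib u v z Xu Xv uz].
  - by rewrite /ev rmorph0.
  - by rewrite /ev rmorphD /= -/(ev u v z a) Ia // -/(ev u v z b) Ib // addr0.
  - by rewrite /ev rmorphM /= -/(ev u v z b) Ib // mulr0.
pose minor (ll : 'I_N.+1 * 'I_N.+1) (x : 'I_N.+1 -> A) : B :=
  'X_ll.1 * (x ll.2)%:MP - 'X_ll.2 * (x ll.1)%:MP.
pose xA (l : 'I_N.+1) : A := 'X_(lshift N.+1 l).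
pose yA (l : 'I_N.+1) : A := 'X_(rshift N.+1 l).
pose Q := (('I_N.+1 * 'I_N.+1) * ('I_N.+1 * 'I_N.+1))%type.
pose P (q : Q) := minor q.1 xA * minor q.2 yA.
(* Avoiding [T q] makes the pair generic and keeps [z] independent of [x] and of [y], by the minors
   chosen in [q]. *)
pose T q : set B := [set b | exists a k, ~ pair_ideal X a /\ b = a%:MP * P q ^+ k].
have T_mult q : mult_set (T q).
  split; first by exists 1, 0%N; rewrite expr0 mulr1 mpolyC1; split=> //; exact: pair_ideal_1.
  move=> _ _ [a [k [na ->]]] [a' [k' [na' ->]]]; exists (a * a'), (k + k')%N.
  split; first by move/(pair_ideal_prime X_irr) => [].
  by rewrite mpolyCM exprD mulrACA.
(* Otherwise each [q] has an [a] outside the ideal of pairs with [a%:MP * P q ^+ k] in [I]. At a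
   pair where [t] and these finitely many [a] do not vanish, a chain of lines exists, and some [P q]
   is nonzero on it. *)
have [q qI] : exists q, forall b, I b -> ~ T q b.
  apply: contrapT => none.
  have bad q : exists ak : A * nat, ~ pair_ideal X ak.1 /\ I (ak.1%:MP * P q ^+ ak.2).
    apply: contrapT => nbad; apply: none; exists q => b Ib [a [k [na bE]]].
    by apply: nbad; exists (a, k); rewrite /= -bE.
  have [ak akP] := choice bad.
  have prod_n (s : seq Q) : ~ pair_ideal X (t * \prod_(q <- s) (ak q).1).
    elim: s => [|q s IH]; first by rewrite big_nil mulr1.
    rewrite big_cons mulrCA => /(pair_ideal_prime X_irr) [] //.
    exact: (akP q).1.
  have [u [v [Xu Xv]]] := off_pair_ideal (prod_n (enum {: Q})).
  rewrite mevalM (rmorph_prod (meval _)) /= => /eqP; rewrite mulf_eq0 negb_or.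
  move=> /andP [/eqP tuv prod0].
  have [u0 v0 uv [z z0 zP]] := t_line Xu Xv tuv.
  have uz i := (zP i).1; have vz i := (zP i).2.
  have [zu zv] := common_direction_indep X_irr X_def G_degree z0 uv uz vz.
  have [l [l' ll]] := not_proportional u0 zu.
  have [r [r' rr]] := not_proportional v0 zv.
  pose q : Q := ((l, l'), (r, r')).
  have [_ Iq] := akP q.
  have flip w : (forall i, on_line G i w z = 0) -> forall i, on_line G i z w = 0.
    move=> /(line_in_cone X_irr X_def G_degree) wz.
    by apply: (cone_line X_irr X_def G_degree) => a b; rewrite addrC; exact: wz.
  have := Iq u v z Xu Xv (fun i => conj (flip u uz i) (flip v vz i)).
  rewrite /ev rmorphM rmorphXn /= mmapC => /eqP; rewrite mulf_eq0 expf_eq0.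
  have aq : (ak q).1.@[pair_pt (u 0) (v 0)] != 0.
    by move: prod0; rewrite prodf_seq_neq0 => /allP /(_ q (mem_enum _ _)).
  rewrite (negPf aq) /= /P rmorphM /= mulf_eq0.
  rewrite /minor !rmorphB !rmorphM /= !mmapC !mmapX !mmap1U /= !mevalXU.
  by rewrite !pair_ptl !pair_ptr (negPf ll) (negPf rr) andbF.
have [L [phi [phiI phiT]]] := avoiding_field I_ideal (T_mult q) qI.
exists L, phi => iota x y z.
have phiC a : phi a%:MP = 0 <-> pair_ideal X a.
  split=> [a0|aI]; last first.
    by apply: phiI => u v w Xu Xv _; rewrite /ev mmapC; exact: aI.
  apply: contrapT => na; apply: (phiT a%:MP) => //.
  by exists a, 0%N; rewrite expr0 mulr1.
have line (w : 'I_N.+1 -> A) (pr : rV -> rV -> rV) :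
    (forall u v : rV, forall l, (w l).@[pair_pt (u 0) (v 0)] = pr u v 0 l) ->
    (forall u v z, (forall i, on_line G i z u = 0 /\ on_line G i z v = 0) ->
        forall i, on_line G i z (pr u v) = 0) ->
    forall i, mmap (polyC \o iota) (line_pt z (fun l => phi (w l)%:MP)) (G i) = 0.
  move=> wE wP i.
  pose e : {poly B} := mmap (polyC \o (@mpolyC N.+1 A \o @mpolyC (N.+1 + N.+1) K))
    (line_pt (fun l => 'X_l) (fun l => (w l)%:MP)) (G i).
  have -> : mmap (polyC \o iota) (line_pt z (fun l => phi (w l)%:MP)) (G i) = map_poly phi e.
    rewrite /e (mmap_comp _ _ (map_poly phi)); apply: mmap_congr => [a|l] /=.
      by rewrite map_polyC.
    by rewrite /line_pt rmorphD rmorphM /= !map_polyC map_polyX.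
  apply/polyP => k; rewrite coef_map coef0; apply: phiI => u v z' Xu Xv uz.
  rewrite -[LHS]coef_map.
  have -> : map_poly (ev u v z') e = on_line G i z' (pr u v).
    rewrite /e (mmap_comp _ _ (map_poly (mmap (meval (pair_pt (u 0) (v 0))) (z' 0)))).
    apply: mmap_congr => [a|l] /=.
      by rewrite map_polyC /= mmapC /= mevalC.
    rewrite /line_pt rmorphD rmorphM /= !map_polyC map_polyX /=.
    rewrite mmapX mmap1U mmapC.
    by rewrite /= wE.
  by rewrite (wP u v z' uz) coef0.
have Pq : phi (P q) != 0.
  apply/eqP; apply: phiT; exists 1, 1%N; rewrite expr1 mpolyC1 mul1r; split=> //.
  exact: pair_ideal_1.
move: Pq; rewrite /P rmorphM /= mulf_eq0 negb_or /minor !rmorphB !rmorphM /=.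
move=> /andP [mx my]; split=> //.
- split.
    apply: (line xA (fun u v => u)) => [u v l|u v w uz i]; last exact: (uz i).1.
    by rewrite mevalXU pair_ptl.
  apply: (line yA (fun u v => v)) => [u v l|u v w uz i]; last exact: (uz i).2.
  by rewrite mevalXU pair_ptr.
- by exists q.1.1, q.1.2.
- by exists q.2.1, q.2.2.
Qed.

End GenericPair.

Section GenericTangent.
Variables (K : closedFieldType) (N m : nat) (X : set (proj_space K N)).
Variables (G : 'I_m -> {mpoly K[N.+1]}) (d : 'I_m -> nat).
Hypothesis G_homog : forall i, G i \is (d i).-homog.
Hypothesis X_scheme : scheme_theoretically_defined G X.

(** A tangent vector for the [G i] is one for the whole ideal of X: some ['X_j ^+ M * f] is in the
    ideal of the [G i], and the coordinate [j] along the line, with nonzero constant term, cancels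
    modulo ['X^2]. *)
Lemma first_order_point (L : fieldType) (iota : {rmorphism K -> L}) (p v : 'I_N.+1 -> L) :
  (exists j, p j != 0) -> (forall i, mmap iota p (G i) = 0) ->
  (forall i, diff G iota p v i = 0) ->
  forall f, vanishing_ideal X f -> 'X^2 %| mmap (polyC \o iota) (line_pt p v) f.
Proof.
move=> [j pj] Gp Dv f If; have [M [h E]] := scheme_power G_homog X_scheme If j.
have TG i : 'X^2 %| mmap (polyC \o iota) (line_pt p v) (G i).
  have [r rE] := mmap_taylor (polyC \o iota) (fun l => (p l)%:P) (fun l => (v l)%:P) 'X (G i).
  have cE g : mmap (polyC \o iota) (fun l => (p l)%:P) g = (mmap iota p g)%:P.
    by rewrite (mmap_comp _ _ (@polyC L)); exact: mmap_congr.
  rewrite (mmap_congr (q := fun l => (p l)%:P + 'X * (v l)%:P) (j := polyC \o iota)) //; last first.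
    by move=> l; rewrite /line_pt mulrC.
  rewrite rE cE Gp polyC0 add0r.
  have -> : \sum_l mmap (polyC \o iota) (fun l => (p l)%:P) (G i)^`M(l) * (v l)%:P =
     (diff G iota p v i)%:P.
    rewrite /diff (rmorph_sum (@polyC L)); apply: eq_bigr => l _ /=.
    by rewrite cE polyCM.
  by rewrite Dv polyC0 mulr0 add0r dvdp_mulr.
have : 'X^2 %| mmap (polyC \o iota) (line_pt p v) ('X_j ^+ M * f).
  rewrite E (rmorph_sum (mmap _ _)); apply: (ideal_sum _ (X2_ideal L)) => i _ /=.
  by rewrite rmorphM /= dvdp_mull.
rewrite rmorphM rmorphXn /= mmapX mmap1U Gauss_dvdpr //.
apply/coprimep_expl/coprimep_expr; rewrite coprimep_sym -['X]subr0 -polyC0.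
by rewrite coprimep_XsubC /root /line_pt !hornerE ?mulr0 ?addr0.
Qed.

Local Notation A := {mpoly K[N.+1 + N.+1]}.
Variables (L : fieldType) (phi : {rmorphism {mpoly A[N.+1]} -> L}).
Hypothesis L0 : [pchar L] =i pred0.
Hypothesis phiC : forall a, phi a%:MP = 0 <-> pair_ideal X a.
Let iota : {rmorphism K -> L} := (phi \o (@mpolyC N.+1 A \o @mpolyC (N.+1 + N.+1) K))%FUN.
Let x l := phi ('X_(lshift N.+1 l))%:MP.
Let y l := phi ('X_(rshift N.+1 l))%:MP.
Let z l := phi 'X_l.
Hypothesis x0 : exists j, x j != 0.
Hypothesis y0 : exists j, y j != 0.
Hypothesis zx_line : forall i, mmap (polyC \o iota) (line_pt z x) (G i) = 0.
Hypothesis zy_line : forall i, mmap (polyC \o iota) (line_pt z y) (G i) = 0.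
Hypothesis Gx : forall i, mmap iota x (G i) = 0.
Hypothesis Gy : forall i, mmap iota y (G i) = 0.

(* The generic point of X x X may be moved to first order in any direction tangent
   to X x X, and the meeting point of the two lines moves along. *)
Lemma generic_tangent (v1 v2 : 'I_N.+1 -> L) :
  (forall i, diff G iota x v1 i = 0) -> (forall i, diff G iota y v2 i = 0) ->
  exists w, (forall i, diff G (polyC \o iota) (line_pt z x) (line_pt w v1) i = 0) /\
    (forall i, diff G (polyC \o iota) (line_pt z y) (line_pt w v2) i = 0).
Proof.
move=> xv1 yv2.
(* The motion of the generic pair along [(v1, v2)]; it is admissible because the ideal of pairs is
   generated from the two factors. *)
pose Phi0 : {rmorphism A -> {poly L}} :=
  mmap (polyC \o iota) (pair_pt (line_pt x v1) (line_pt y v2)).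
have Phi0E a : (Phi0 a).[0] = phi a%:MP.
  pose f : {rmorphism A -> L} := (horner_eval 0 \o Phi0)%FUN.
  pose g : {rmorphism A -> L} := (phi \o @mpolyC N.+1 A)%FUN.
  rewrite -[LHS]/(f a) -[RHS]/(g a); apply: mmap_unique => [b|k].
    by rewrite /f /g /= mmapC horner_evalE hornerC.
  rewrite /f /g /= mmapX mmap1U horner_evalE.
  case: (split_ordP k) => l ->; rewrite ?pair_ptl ?pair_ptr /line_pt.
    by rewrite !hornerE ?mulr0 ?addr0.
  by rewrite !hornerE ?mulr0 ?addr0.
have adm0 : admissible Phi0.
  move=> a; rewrite Phi0E => /phiC.
  have [J0 JD JM] := X2_ideal L.
  apply: (pair_ideal_generated (J := [set F | 'X^2 %| Phi0 F])) => [|f If].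
    split=> [|F F' FX F'X|F F' FX] /=; first by rewrite rmorph0 dvdp0.
      by rewrite rmorphD; exact: JD.
    by rewrite rmorphM; exact: JM.
  rewrite /Phi0 /= mmap_pair_left mmap_pair_right.
  by split; apply: first_order_point.
(* The motion extends to the coordinates of [z], in characteristic 0, and [w] is its value there. *)
have [w admw] := admissible_mpoly L0 Phi0E adm0.
pose Phi1 : {rmorphism {mpoly A[N.+1]} -> {poly L}} := mmap Phi0 (line_pt z w).
have Phi1E b : (Phi1 b).[0] = phi b.
  pose f : {rmorphism {mpoly A[N.+1]} -> L} := (horner_eval 0 \o Phi1)%FUN.
  rewrite -[LHS]/(f b); apply: mmap_unique => [a|l].
    by rewrite /f /= mmapC horner_evalE Phi0E.
  by rewrite /f /= mmapX mmap1U horner_evalE /line_pt !hornerE ?mulr0 ?addr0.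
have side (t : 'I_N.+1 -> A) (v : 'I_N.+1 -> L) :
    (forall l, Phi0 (t l) = line_pt (fun l => phi (t l)%:MP) v l) ->
    (forall i, mmap (polyC \o iota) (line_pt z (fun l => phi (t l)%:MP)) (G i) = 0) ->
    forall i, diff G (polyC \o iota) (line_pt z (fun l => phi (t l)%:MP)) (line_pt w v) i = 0.
  move=> tv line i.
  pose xx l := phi (t l)%:MP; rewrite -/xx in tv line *.
  pose e : {poly {mpoly A[N.+1]}} :=
    mmap (polyC \o (@mpolyC N.+1 A \o @mpolyC (N.+1 + N.+1) K))
    (line_pt (fun l => 'X_l) (fun l => (t l)%:MP)) (G i).
  have e0 : map_poly phi e = 0.
    rewrite -[RHS](line i) /e (mmap_comp _ _ (map_poly phi)); apply: mmap_congr => [a|l] /=.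
      by rewrite map_polyC.
    by rewrite /line_pt rmorphD rmorphM /= !map_polyC map_polyX.
  have e1 k : 'X^2 %| Phi1 e`_k.
    by apply: admw; rewrite [LHS]Phi1E -coef_map e0 coef0.
  pose base l := map_poly polyC (line_pt z xx l).
  pose dir l := map_poly polyC (line_pt w v l).
  (* Of the two variables, the outer one runs along the line and the inner one is infinitesimal. *)
  have eE : map_poly Phi1 e =
      mmap (polyC \o (polyC \o iota)) (fun l => base l + 'X%:P * dir l) (G i).
    rewrite /e (mmap_comp _ _ (map_poly Phi1)); apply: mmap_congr => [a|l] /=.
      by rewrite map_polyC /= mmapC /= mmapC.
    rewrite /line_pt rmorphD rmorphM /= !map_polyC map_polyX /= mmapX mmap1U mmapC /=.
    have := tv l; rewrite /Phi0 /= => ->.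
    rewrite /base /dir /line_pt !rmorphD !rmorphM /= !map_polyC map_polyX /=.
    set zl := (z l)%:P%:P; set wl := (w l)%:P%:P; set xl := (xx l)%:P%:P.
    by rewrite -/xl; ring.
  have baseE f : mmap (polyC \o (polyC \o iota)) base f =
      map_poly polyC (mmap (polyC \o iota) (line_pt z xx) f).
    have := mmap_comp (polyC \o iota) (line_pt z xx) (map_poly polyC) f => ->.
    by apply: mmap_congr => [a|l] //=; rewrite map_polyC.
  have [r rE] := mmap_taylor (polyC \o (polyC \o iota)) base dir 'X%:P (G i).
  apply/polyP => k; rewrite coef0.
  have := e1 k; rewrite -coef_map eE rE baseE line rmorph0 add0r.
  have -> : \sum_l mmap (polyC \o (polyC \o iota)) base (G i)^`M(l) * dir l =
      map_poly polyC (diff G (polyC \o iota) (line_pt z xx) (line_pt w v) i).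
    rewrite /diff (rmorph_sum (map_poly polyC)); apply: eq_bigr => l _ /=.
    by rewrite rmorphM /= baseE.
  rewrite -polyC_exp coefD !coefCM coef_map /= X2_dvdp => /andP [_].
  by rewrite coefD coefXM coefXnM coefC /= addr0 => /eqP.
exists w; split.
  apply: (side (fun l => 'X_(lshift N.+1 l)) v1) => // l.
  by rewrite /Phi0 /= mmapX mmap1U pair_ptl.
apply: (side (fun l => 'X_(rshift N.+1 l)) v2) => // l.
by rewrite /Phi0 /= mmapX mmap1U pair_ptr.
Qed.

End GenericTangent.

(** * From truncated to true conics *)

Lemma Xn_dvdp (L : fieldType) (p : {poly L}) k :
  (forall j, (j < k)%N -> p`_j = 0) -> 'X^k %| p.
Proof.
move=> p0; rewrite -(poly_take_drop k p) [take_poly k p](_ : _ = 0).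
  by rewrite add0r dvdp_mull.
by apply/polyP => j; rewrite coef_take_poly coef0; case: ltnP => // /p0.
Qed.

(* Substituting [q = u v] and [s = u]. *)
Definition monoidal (B : comNzRingType) : {poly {poly B}} -> {poly {poly B}} :=
  horner_map (@tau B) 'X%:P.
HB.instance Definition _ (B : comNzRingType) := GRing.RMorphism.on (@monoidal B).

Lemma tauC (B : comNzRingType) (a : B) : tau a%:P = a%:P%:P.
Proof. exact: horner_mapC. Qed.

Lemma tauX (B : comNzRingType) : tau ('X : {poly B}) = 'X%:P * 'X.
Proof. exact: horner_mapX. Qed.

Lemma monoidalC (B : comNzRingType) (c : {poly B}) : monoidal c%:P = tau c.
Proof. exact: horner_mapC. Qed.

Lemma monoidalX (B : comNzRingType) : monoidal ('X : {poly {poly B}}) = 'X%:P.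
Proof. exact: horner_mapX. Qed.

Lemma coef_monoidal (B : comNzRingType) (F : {poly {poly B}}) b :
  (monoidal F)`_b = (swapXY F)`_b * 'X^b.
Proof.
elim/poly_ind: F => [|F c IH]; first by rewrite !rmorph0 !coef0 mul0r.
rewrite !rmorphD !rmorphM /= monoidalX monoidalC.
rewrite swapXY_X swapXY_polyC !coefD !coefMC IH coef_tau coef_map /=; ring.
Qed.

Section SpreadConics.
Variables (K : closedFieldType) (N m : nat) (X : set (proj_space K N)).
Variables (G : 'I_m -> {mpoly K[N.+1]}) (d : 'I_m -> nat).
Hypothesis X_irr : irreducible_set X.
Hypothesis G_homog : forall i, G i \is (d i).-homog.
Local Notation A := {mpoly K[N.+1 + N.+1]}.
Local Notation rV := 'rV[K]_N.+1.
Variables (L : fieldType) (phi : {rmorphism {mpoly A[N.+1]} -> L}).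
Hypothesis pair_ideal_1 : ~ pair_ideal X 1.
Hypothesis phiC : forall a, phi a%:MP = 0 <-> pair_ideal X a.
Let iota : {rmorphism K -> L} := (phi \o (@mpolyC N.+1 A \o @mpolyC (N.+1 + N.+1) K))%FUN.
Let x l := phi ('X_(lshift N.+1 l))%:MP.
Let y l := phi ('X_(rshift N.+1 l))%:MP.
Hypothesis truncated : forall k, exists zeta : 'I_N.+1 -> {poly L}, forall i, exists R,
  mmap (polyC \o (polyC \o iota)) (conic x zeta y) (G i) = ('X%:P * 'X) ^+ k.+1 * R.

(** The conic multiplied by [u]: for [q = u v] it becomes [u^2 x + u zeta + q y], polynomial in the
    unknowns [zeta] and [q] and in the parameter [u]. *)
Let parabola (B : comNzRingType) (q : B) (u z v : 'I_N.+1 -> B) l : {poly B} :=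
  'X^2 * (u l)%:P + 'X * (z l)%:P + (q * v l)%:P.

Let parabola_morph (B C : comNzRingType) (t : {rmorphism B -> C}) q u z v q' u' z' v' l :
  t q = q' -> (forall l, t (u l) = u' l) -> (forall l, t (z l) = z' l) ->
  (forall l, t (v l) = v' l) ->
  map_poly t (parabola q u z v l) = parabola q' u' z' v' l.
Proof.
move=> <- uE zE vE.
rewrite /parabola !rmorphD !rmorphM /= !map_polyX !map_polyC /=.
by rewrite uE zE vE.
Qed.

(** The substitution [s = u], [q = u v] sends [s^a q^b] to [u^(a + b) v^b]. Distinct monomials stay
    distinct, so divisibility by [v^(k + 1)] afterwards means divisibility by [q^(k + 1)] before. *)
Let parabola_dvd k (zeta : 'I_N.+1 -> {poly L}) i e :
  (exists R, mmap (polyC \o (polyC \o iota)) (conic x zeta y) (G i) =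
     ('X%:P * 'X) ^+ k.+1 * R) ->
  'X^(k.+1) %| (mmap (polyC \o (polyC \o iota))
    (parabola 'X (fun l => (x l)%:P) zeta (fun l => (y l)%:P)) (G i))`_e.
Proof.
move=> [R RE]; set F := mmap _ _ _; apply: Xn_dvdp => b bk.
have : (monoidal F)`_b = 0.
  have -> : monoidal F = 'X%:P ^+ d i * (('X%:P * 'X) ^+ k.+1 * R).
    rewrite -RE -(mmap_scale _ _ _ (G_homog i)).
    have := mmap_comp (polyC \o (polyC \o iota))
      (parabola 'X (fun l => (x l)%:P) zeta (fun l => (y l)%:P)) (@monoidal L) (G i).
    move=> ->; apply: mmap_congr => [a|l] /=.
      by rewrite monoidalC tauC.
    rewrite /parabola /conic !rmorphD !rmorphM /= !monoidalX !monoidalC.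
    rewrite !tauC tauX.
    ring.
  by rewrite exprMn mulrCA -mulrA mulrCA coefXnM bk.
rewrite coef_monoidal => /eqP; rewrite mulf_eq0 expf_eq0 polyX_eq0 andbF orbF => /eqP E.
by rewrite -coef_swapXY E coef0.
Qed.

Lemma spread_conics : exists h : A, ~ pair_ideal X h /\ forall u v : rV,
  cone X u -> cone X v -> h.@[pair_pt (u 0) (v 0)] <> 0 ->
  exists (z : rV) (q : K), q != 0 /\ forall i,
    mmap polyC (fun l => 'X^2 * (u 0 l)%:P + 'X * (z 0 l)%:P + (q * v 0 l)%:P) (G i) = 0.
Proof.
have [zeta zetaP] := choice truncated.
(* The unknowns are [q], the variable [ord0], and the [N.+1] coordinates of [zeta], over the
   functions of the pair. *)
pose B := {mpoly A[N.+2]}.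
pose theta k : {rmorphism B -> {poly L}} :=
  mmap (polyC \o (phi \o @mpolyC N.+1 A)) (cons_var 'X (zeta k)).
have thetaC k a : theta k a%:MP = (phi a%:MP)%:P by rewrite /theta /= mmapC.
pose I : set B := [set b | forall k, 'X^(k.+1) %| theta k b].
have I_ideal : ideal_set I.
  split=> [k|b b' Ib Ib' k|b b' Ib k]; first by rewrite rmorph0 dvdp0.
    by rewrite rmorphD dvdp_addr.
  by rewrite rmorphM dvdp_mull.
pose T : set B := [set b | exists t j, ~ pair_ideal X t /\ b = t%:MP * 'X_ord0 ^+ j].
have T_mult : mult_set T.
  split; first by exists 1, 0%N; rewrite expr0 mulr1 mpolyC1.
  move=> _ _ [t [j [nt ->]]] [t' [j' [nt' ->]]]; exists (t * t'), (j + j')%N.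
  split; first by move/(pair_ideal_prime X_irr) => [].
  by rewrite mpolyCM exprD mulrACA.
(* The truncation of order [j] shows that [t * q^j] is not divisible by [q^(j + 1)]; this is what
   keeps [q] nonzero in the true solution. *)
have IT b : I b -> ~ T b.
  move=> Ib [t [j [nt bE]]]; have := Ib j.
  rewrite bE rmorphM rmorphXn thetaC /theta /= mmapX mmap1U cons_var0 => /dvdpP [r rE].
  have := congr1 (fun p : {poly L} => p`_j) rE.
  by rewrite coefCM coefXn eqxx mulr1 coefMXn ltnSn => /phiC.
have [L' [psi [psiI psiT]]] := avoiding_field I_ideal T_mult IT.
have psiC a : psi a%:MP = 0 -> pair_ideal X a.
  move=> a0; apply: contrapT => na; apply: (psiT a%:MP) => //.
  by exists a, 0%N; rewrite expr0 mulr1.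
have [|h h0 spec] := @specialize_mpoly L' K _ _ psi 'X_ord0.
  by apply: psiT; exists 1, 1%N; rewrite expr1 mpolyC1 mul1r.
exists h; split=> [hI|u v Xu Xv huv].
  by apply: h0; apply: psiI => k; rewrite thetaC (phiC h).2.
have kill a : psi a%:MP = 0 -> meval (pair_pt (u 0) (v 0)) a = 0.
  by move=> /psiC aI; exact: aI.
have [c kc qc] := spec (meval (pair_pt (u 0) (v 0))) kill huv.
exists (\row_l c (lift ord0 l)), (c ord0); split.
  by move: qc; rewrite mmapX mmap1U => /eqP.
move=> i; pose E : {poly B} := mmap (polyC \o (@mpolyC N.+2 A \o @mpolyC (N.+1 + N.+1) K))
  (parabola 'X_ord0 (fun l => ('X_(lshift N.+1 l))%:MP) (fun l => 'X_(lift ord0 l))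
     (fun l => ('X_(rshift N.+1 l))%:MP)) (G i).
have E0 : map_poly psi E = 0.
  apply/polyP => e; rewrite coef_map coef0; apply: psiI => k.
  rewrite -coef_map.
  have -> : map_poly (theta k) E = mmap (polyC \o (polyC \o iota))
    (parabola 'X (fun l => (x l)%:P) (zeta k) (fun l => (y l)%:P)) (G i).
    rewrite /E (mmap_comp _ _ (map_poly (theta k))); apply: mmap_congr => [a|l] /=.
      by rewrite map_polyC /= mmapC.
    apply: parabola_morph => [|l'|l'|l']; rewrite /theta /= ?mmapC ?mmapX ?mmap1U //.
    - exact: cons_var0.
    - exact: cons_varS.
  by apply: parabola_dvd; exact: zetaP.
have : map_poly (mmap (meval (pair_pt (u 0) (v 0))) c) E = 0.
  apply/polyP => e; rewrite coef_map coef0; apply: kc.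
  by rewrite -[LHS]coef_map E0 coef0.
move=> <-; rewrite /E (mmap_comp _ _ (map_poly (mmap (meval (pair_pt (u 0) (v 0))) c))).
apply: mmap_congr => [a|l] /=.
  by rewrite map_polyC /= mmapC /= mevalC.
symmetry; rewrite -[RHS]/(parabola (c ord0) (u 0) ((\row_l c (lift ord0 l)) 0) (v 0) l).
apply: parabola_morph => [|l'|l'|l']; rewrite /= ?mmapC ?mmapX ?mmap1U //=.
- by rewrite mevalXU pair_ptl.
- by rewrite mxE.
- by rewrite mevalXU pair_ptr.
Qed.

End SpreadConics.

(** * Smooth conics *)

Section SmoothConic.
Variables (K : closedFieldType) (N m : nat) (X : set (proj_space K N)).
Variables (G : 'I_m -> {mpoly K[N.+1]}) (d : 'I_m -> nat).
Hypotheses (X_irr : irreducible_set X) (X_def : set_theoretically_defined G X).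
Hypothesis G_degree : forall i, G i != 0 /\ G i \is (d i).-homog.
Local Notation rV := 'rV[K]_N.+1.
Local Notation PN := (proj_space K N).

Variables (u v z : rV) (q : K).
Hypotheses (Xu : cone X u) (Xv : cone X v).
Hypothesis uv : exists i, on_line G i u v <> 0.
Hypothesis q0 : q != 0.
Hypothesis parabola : forall s, cone X (s ^+ 2 *: u + s *: z + q *: v).

Lemma line_not_in_cone : ~ forall a b, cone X (a *: u + b *: v).
Proof.
by move=> /(cone_line X_irr X_def G_degree) uv0; case: uv => i; rewrite uv0.
Qed.

(* If the parabola [s |-> s^2 u + s z + q v] lay in the span of [u] and [v], it would
   cover all but at most one of the points [v + t u]. *)
Lemma parabola_not_in_line a b : z <> a *: u + b *: v.
Proof.
move=> zE; apply: line_not_in_cone => c e; rewrite addrC.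
apply: (line_in_cone X_irr X_def G_degree) => i.
have P s : cone X ((s ^+ 2 + a * s) *: u + (b * s + q) *: v).
  have := parabola s; rewrite zE scalerDr !scalerA !scalerDl -!addrA.
  by rewrite [s * a]mulrC [s * b]mulrC.
have scaled c1 c2 k t : k != 0 -> cone X (c1 *: u + c2 *: v) -> c1 = k * t -> c2 = k ->
    (on_line G i v u).[t] = 0.
  move=> k0 C E1 E2; rewrite E1 E2 in C.
  rewrite on_line_horner; apply: (coneP X_irr X_def G_degree _).1.
  have := cone_scale k^-1 C; rewrite scalerDr !scalerA mulrA mulVf // mul1r scale1r.
  by rewrite addrC.
(* The point of parameter [s] is a multiple of [v + t u] if [s (s + a) = (b s + q) t] and [b s + q]
   is not zero. Both sides can degenerate only if [q = a b]; then [s = b t] works, except for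
   [b t + a = 0]. *)
have [qE|nq] := eqVneq q (a * b); last first.
  apply: poly_zeroP => t.
  have [s sE] := @solve_monicpoly K 2 (fun k => if k is 0%N then q * t else b * t - a) isT.
  have E : s ^+ 2 + a * s = (b * s + q) * t.
    by rewrite sE !big_ord_recl big_ord0 /= expr0 expr1; ring.
  apply: (scaled _ _ (b * s + q) t _ (P s)) => //.
  apply: contraNneq nq => bs; move/eqP: E; rewrite bs mul0r.
  have -> : s ^+ 2 + a * s = s * (s + a) by ring.
  rewrite mulf_eq0 => /orP [/eqP s0|/eqP sa].
    by move: bs; rewrite s0 mulr0 add0r => q00; move/eqP: q0.
  apply/eqP; have -> : q = (b * s + q) - b * (s + a) + a * b by ring.
  by rewrite bs sa; ring.
have [a0 b0] : a != 0 /\ b != 0 by apply/andP; rewrite -negb_or -mulf_eq0 -qE.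
have : on_line G i v u * (b%:P * 'X + a%:P) = 0.
  apply: poly_zeroP => t; rewrite hornerM !hornerE.
  have [->|abt] := eqVneq (b * t + a) 0; first by rewrite mulr0.
  rewrite (scaled _ _ (b * (b * t + a)) t _ (P (b * t))) ?mul0r //.
  - by rewrite mulf_neq0.
  - by ring.
  - by rewrite qE; ring.
move/eqP; rewrite mulf_eq0 => /orP [/eqP //|/eqP ab].
have := congr1 (fun p : {poly K} => p.[0]) ab.
by rewrite !hornerE ?mulr0 ?add0r => a00; rewrite a00 eqxx in a0.
Qed.

Lemma parabola_independent a b c : a *: u + b *: z + c *: v = 0 ->
  [/\ a = 0, b = 0 & c = 0].
Proof.
move=> E; have [b0|b0] := eqVneq b 0; last first.
  case: (@parabola_not_in_line (- (b^-1 * a)) (- (b^-1 * c))).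
  rewrite !scaleNr -!scalerA -opprD -scalerDr.
  apply: (scalerI b0); rewrite scalerN scalerA divff // scale1r.
  by apply/eqP; rewrite -addr_eq0 addrCA addrA -E.
move: E; rewrite b0 scale0r addr0 => E.
have [a0|a0] := eqVneq a 0.
  split=> //; apply: contrapT => /eqP c0; apply: line_not_in_cone => e f.
  move/eqP: E; rewrite a0 scale0r add0r scaler_eq0 (negPf c0) => /eqP ->.
  by rewrite scaler0 addr0; exact: cone_scale.
case: line_not_in_cone => e f.
have -> : u = (- (a^-1 * c)) *: v.
  apply: (scalerI a0); rewrite scalerA mulrN mulVKf // scaleNr.
  by apply/eqP; rewrite -addr_eq0 E.
by rewrite scalerA -scalerDl; exact: cone_scale.
Qed.

Let row3_eq0 (w : 'rV[K]_3) : w 0 0 = 0 -> w 0 1 = 0 -> w 0 2 = 0 -> w = 0.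
Proof.
move=> w0 w1 w2; apply/rowP => j; rewrite [RHS]mxE.
case: j => -[|[|[|//]]] lt3.
- by rewrite -[RHS]w0; congr (w 0 _); apply: val_inj.
- by rewrite -[RHS]w1; congr (w 0 _); apply: val_inj.
- by rewrite -[RHS]w2; congr (w 0 _); apply: val_inj.
Qed.

Let conic_mx : 'M[K]_(3, N.+1) :=
  \matrix_(i < 3, l < N.+1) (if i == 0 then u 0 l else if i == 1 then z 0 l else v 0 l).

Let conic_mxE (w : 'rV[K]_3) :
  w *m conic_mx = w 0 0 *: u + w 0 1 *: z + w 0 2 *: v.
Proof.
apply/rowP => l; rewrite !mxE !big_ord_recl big_ord0 !mxE /= addr0 addrA.
by congr (_ * _ + w 0 _ * _ + w 0 _ * _); apply: val_inj.
Qed.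

Let conic_poly : {mpoly K[3]} := q%:MP * 'X_1 ^+ 2 - 'X_0 * 'X_2.

Let conic_polyE (w : 'I_3 -> K) : conic_poly.@[w] = q * w 1 ^+ 2 - w 0 * w 2.
Proof. by rewrite /conic_poly mevalB !mevalM mevalC !mevalXU. Qed.

Lemma smooth_conic_through (p p' : PN) : [pchar K] =i pred0 ->
  X p -> X p' -> u \in (p : {vspace _}) -> v \in (p' : {vspace _}) ->
  u != 0 -> v != 0 ->
  exists C : set PN, [/\ smooth_conic C, C `<=` X, C p & C p'].
Proof.
move=> K0 Xp Xp' up vp u0 v0.
exists (plane_curve conic_mx conic_poly); split.
- exists conic_mx, conic_poly; split=> //.
  + rewrite -kermx_eq0; apply/eqP/row_matrixP => i; rewrite row0.
    have : row i (kermx conic_mx) *m conic_mx = 0.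
      by apply/eqP; rewrite -sub_kermx row_sub.
    by rewrite conic_mxE => /parabola_independent [w0 w1 w2]; exact: row3_eq0.
  + apply: contraNneq q0 => c0; have := conic_polyE (fun i => (i == 1)%:R).
    by rewrite c0 meval0 /= expr1n mulr1 mul0r subr0 => <-.
  + have X1 (i : 'I_3) : ('X_i : {mpoly K[3]}) \is 1.-homog.
      by rewrite dhomogX; apply/eqP; exact: mdeg1.
    rewrite /conic_poly mul_mpolyC rpredB // ?rpredZ //; last exact: (dhomogM (X1 0) (X1 2)).
    exact: (dhomogM (X1 1) (X1 1)).
  + move=> w w0 _.
    have dX (i j : 'I_3) : ('X_i : {mpoly K[3]})^`M(j) = (i == j)%:R.
      rewrite mderivX mnm1E; case: eqP => [->|_]; last by rewrite scale0r.
      by rewrite scale1r -{1}[U_(j)%MM]add0m addmK mpolyX0.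
    have dE i : (conic_poly^`M(i)).@[w 0] = (2 * q * w 0 1) * (1 == i)%:R
       - ((0 == i)%:R * w 0 2 + (2 == i)%:R * w 0 0).
      rewrite /conic_poly mul_mpolyC mderivB mderivZ -['X_1 ^+ 2]/('X_1 * 'X_1) !mderivM.
      rewrite !dX mevalB mevalZ !mevalD !mevalM !mevalXU !rmorph_nat; ring.
    have [w00|?] := eqVneq (w 0 0) 0; last first.
      by exists 2; rewrite dE /= mulr0 mul0r mul1r !add0r oppr_eq0.
    have [w02|?] := eqVneq (w 0 2) 0; last first.
      by exists 0; rewrite dE /= mulr0 mul0r mul1r addr0 add0r oppr_eq0.
    (* The partial derivative [2 q w1] is nonzero, as the characteristic is not 2. *)
    exists 1; rewrite dE /= !mul0r addr0 subr0 mulr1 !mulf_neq0 //.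
      by have := K0 2; rewrite !inE /= => /negbT.
    by apply: contra_neq w0 => w01; exact: row3_eq0.
- move=> r [w /eqP]; rewrite conic_polyE subr_eq0 => /eqP w012 rE.
  have [x xr x0] := point_vec r; apply: (cone_point _ x0 xr).
  move: xr; rewrite rE => /vlineP [k ->]; apply: cone_scale; rewrite conic_mxE.
  have [w1|w1] := eqVneq (w 0 1) 0.
    move/esym/eqP: w012; rewrite w1 expr0n mulr0 scale0r addr0 mulf_eq0 => /orP [] /eqP ->.
      by rewrite scale0r add0r; exact: cone_scale.
    by rewrite scale0r addr0; exact: cone_scale.
  have w0 : w 0 0 != 0.
    have : w 0 0 * w 0 2 != 0 by rewrite -w012 mulf_neq0 // expf_neq0.
    by rewrite mulf_eq0 negb_or => /andP [].
  (* The point [w] has parameter [s = w0 / w1] on the parabola, up to the factor [w1^2 / w0]. *)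
  have := cone_scale (w 0 1 ^+ 2 / w 0 0) (parabola (w 0 0 / w 0 1)).
  rewrite !scalerDr !scalerA.
  have -> : w 0 1 ^+ 2 / w 0 0 * (w 0 0 / w 0 1) ^+ 2 = w 0 0 by field; rewrite w0 w1.
  have -> : w 0 1 ^+ 2 / w 0 0 * (w 0 0 / w 0 1) = w 0 1 by field; rewrite w0 w1.
  by have -> : w 0 1 ^+ 2 / w 0 0 * q = w 0 2 by rewrite mulrAC [_ * q]mulrC w012 mulrAC divff ?mul1r.
- exists (\row_j (j == 0)%:R); first by rewrite conic_polyE !mxE /= expr0n mulr0 mulr0 subr0.
  by rewrite conic_mxE !mxE /= scale1r !scale0r !addr0; exact: point_line.
- exists (\row_j (j == 2)%:R); first by rewrite conic_polyE !mxE /= expr0n mulr0 mul0r subr0.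
  by rewrite conic_mxE !mxE /= scale1r !scale0r !add0r; exact: point_line.
Qed.

End SmoothConic.

Section SmoothConics.
Variables (K : closedFieldType) (N m n : nat) (X : set (proj_space K N)).
Variables (G : 'I_m -> {mpoly K[N.+1]}) (d : 'I_m -> nat).
Hypotheses (X_irr : irreducible_set X) (X_def : set_theoretically_defined G X).
Hypothesis G_degree : forall i, G i != 0 /\ G i \is (d i).-homog.
Hypotheses (X_smooth : smooth_of_dimension X n)
  (X_scheme : scheme_theoretically_defined G X).
Hypothesis K0 : [pchar K] =i pred0.
Hypotheses (X_proper : X <> setT) (X_nondeg : nondegenerate_variety X).
Hypothesis d_anti : forall i j : 'I_m, (i <= j)%N -> (d j <= d i)%N.
Hypothesis d_sum : (2 * \sum_(i < m | (i < N - n)%N) d i <= N + (N - n))%N.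
Local Notation A := {mpoly K[N.+1 + N.+1]}.

Theorem smooth_conics_of_top_degrees : conic_connected_by_smooth_conics X.
Proof.
have [t [tI tP]] := general_common_line X_irr X_def G_degree X_smooth X_scheme K0
  X_proper X_nondeg d_anti d_sum.
have [L [phi [phiC [zx_line zy_line] zx_indep zy_indep]]] :=
  generic_chain X_irr X_def G_degree tI tP.
pose iota : {rmorphism K -> L} :=
  (phi \o (@mpolyC N.+1 A \o @mpolyC (N.+1 + N.+1) K))%FUN.
have L0 : [pchar L] =i pred0.
  by move=> p; rewrite (fmorph_pchar iota) K0.
have G_homog i := (G_degree i).2.
have G_pos i : (0 < d i)%N /\ G i \is (d i).-homog.
  by split=> //; exact: degree_gt0 X_irr X_def G_degree i.
have nz (z x : 'I_N.+1 -> L) : (exists l l', z l * x l' - z l' * x l != 0) ->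
    exists j, x j != 0.
  move=> [l [l' zx]]; apply: contrapT => none; move/eqP: zx; apply.
  have x0 j : x j = 0 by apply/eqP; apply: contrapT => /negP ?; apply: none; exists j.
  by rewrite !x0 !mulr0 subrr.
have free := generic_tangent G_homog X_scheme L0 phiC (nz _ _ zx_indep) (nz _ _ zy_indep)
  zx_line zy_line (fun i => (line_zeros G_pos zx_line i).2)
  (fun i => (line_zeros G_pos zy_line i).2).
have truncated := truncated_conic L0 G_pos
  (jac_rel_ideal X_irr X_def G_degree X_smooth X_scheme)
  (minors_cover X_irr X_def G_degree X_smooth X_scheme)
  zx_line zy_line zx_indep zy_indep free.
have [|h [hI hP]] := spread_conics X_irr G_homog (pair_ideal_1 tI) phiC.
  by move=> k; have [zeta _ zetaP] := truncated k; exists zeta.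
have thI : ~ pair_ideal X (t * h) by move/(pair_ideal_prime X_irr) => [].
apply: (general_pairP thI) => u v p q Xp Xq up vq u0 v0.
rewrite mevalM => /eqP; rewrite mulf_eq0 negb_or => /andP [/eqP tuv /eqP huv].
have Xu : cone X u by exists p.
have Xv : cone X v by exists q.
have [_ _ uv _] := tP u v Xu Xv tuv.
have [z [r [r0 rP]]] := hP u v Xu Xv huv.
apply: (smooth_conic_through X_irr X_def G_degree Xu Xv uv r0 (z := z)) => // s.
apply/(coneP X_irr X_def G_degree) => i.
rewrite -[RHS](horner0 s) -(rP i) -horner_evalE (mmap_comp polyC _ (horner_eval s)).
apply: mmap_congr => [a|l] /=; first by rewrite horner_evalE hornerC.
by rewrite horner_evalE !hornerE !mxE.
Qed.

End SmoothConics.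

Theorem theorem1 (R : realType) (N n m : nat) (X : set (proj_space R[i] N))
    (G : 'I_m -> {mpoly R[i][N.+1]}) (d : 'I_m -> nat)
    (X_irreducible : irreducible_variety X)
    (X_proper : X <> setT)
    (X_nondegenerate : nondegenerate_variety X)
    (X_dim : has_dimension X n)
    (n_ge1 : (1 <= n)%N)
    (G_degree : forall i : 'I_m, G i != 0 /\ G i \is (d i).-homog)
    (X_defined : set_theoretically_defined G X) :
  ((2 * \sum_(i < m) d i <= N + m)%N -> connected_by_singular_conics X)
  /\
  (smooth_of_dimension X n ->
   scheme_theoretically_defined G X ->
   (forall i j : 'I_m, (i <= j)%N -> (d j <= d i)%N) ->
   (2 * \sum_(i < m | (i < N - n)%N) d i <= N + (N - n))%N ->
   connected_by_singular_conics X /\ conic_connected_by_smooth_conics X).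
Proof.
have K0 : [pchar R[i]] =i pred0 by exact: Num.Theory.pchar_num.
have X_irr := X_irreducible.2; split=> [d_sum|X_smooth X_scheme d_anti d_sum].
  exact: singular_conics_of_all_degrees X_irr X_defined G_degree K0 X_proper
    X_nondegenerate d_sum.
split.
  exact: singular_conics_of_top_degrees X_irr X_defined G_degree X_smooth X_scheme K0
    X_proper X_nondegenerate d_anti d_sum.
exact: smooth_conics_of_top_degrees X_irr X_defined G_degree X_smooth X_scheme K0
  X_proper X_nondegenerate d_anti d_sum.
Qed.
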